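(* Let $(\mathcal{H},\|\cdot\|)$ be a separable Hilbert space and $\gamma$ a zero-mean Gaussian measure on $\mathcal{H}$. Let $g:\mathcal{H}\to\mathbb{R}$ be $\beta$-Hölder for some $\beta\in(0,1]$, i.e. there exists $C_g>0$ such that $|g(x)-g(y)|\le C_g\|x-y\|^{\beta}$ for all $x,y\in\mathcal{H}$. Let $\pi$ be the probability measure on $\mathcal{H}$ with $d\pi\propto\exp(-g)\,d\gamma$. Let $\rho\in[0,1)$ and let $P_{\mathrm{cn}}$ be the Markov kernel of the preconditioned Crank–Nicolson algorithm with target $\pi$ and design parameter $\rho$. Let $\theta>0$ be such that $\int_{\mathcal{H}}\exp(\theta\|\xi\|^2)\,d\gamma(\xi)<\infty$, and set $V(x)=\exp(s\|x\|^2)$ with $s=(1-\rho)^2\theta/16$, and $\kappa=\theta C_g^{-2/\beta}/36$. Then $P_{\mathrm{cn}}$ admits $\pi$ as its unique invariant probability measure, and there exist constants $C_1,C_2$ such that for all $x\in\mathcal{H}$ and all integers $n\ge2$ with $\log(n)-C_2\log(\log(n))\ge0$, $$W_{d_1}(P_{\mathrm{cn}}^n(x,\cdot),\pi)\le C_1V(x)\exp\left(-\kappa\left(\log(n)-C_2\log(\log(n))\right)^{2/\beta}\right),$$ where $d_1(x,y)=\|x-y\|^{\beta}\wedge1$.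
   Context: Under the Hölder assumption $\exp(-g)$ is $\gamma$-integrable; by Fernique's theorem some $\theta>0$ with $\int\exp(\theta\|\xi\|^2)d\gamma(\xi)<\infty$ exists. The preconditioned Crank–Nicolson kernel with parameter $\rho\in[0,1)$ is the following: set $\alpha(x,y)=1\wedge\exp(g(x)-g(y))$; from state $X_n$, draw independently $Z_{n+1}\sim\gamma$ and $U_{n+1}$ uniform on $[0,1]$; if $U_{n+1}\le\alpha(X_n,\rho X_n+\sqrt{1-\rho^2}Z_{n+1})$ set $X_{n+1}=\rho X_n+\sqrt{1-\rho^2}Z_{n+1}$, otherwise set $X_{n+1}=X_n$. That is, $$P_{\mathrm{cn}}(x,A)=\int_{\mathcal{H}}\alpha(x,\rho x+\sqrt{1-\rho^2}z)\mathbf{1}_A(\rho x+\sqrt{1-\rho^2}z)\,d\gamma(z)+\delta_x(A)\int_{\mathcal{H}}\left(1-\alpha(x,\rho x+\sqrt{1-\rho^2}z)\right)d\gamma(z).$$ For probability measures $\mu,\nu$ on $\mathcal{H}$, $W_{d_1}(\mu,\nu)=\inf_\lambda\int d_1(x,y)\,d\lambda(x,y)$ over all couplings $\lambda$ of $\mu$ and $\nu$. *)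

(* Defs.v *)
From HB Require Import structures.
From mathcomp Require Import all_boot all_order all_algebra.
From mathcomp Require Import all_classical all_reals all_analysis.
Set Implicit Arguments.
Unset Strict Implicit.
Unset Printing Implicit Defensive.
Import Order.TTheory GRing.Theory Num.Theory.
Import numFieldNormedType.Exports.

Local Open Scope classical_set_scope.
Local Open Scope ring_scope.

HB.mixin Record CompleteNormedModule_isHilbert (R : realType) H
    of CompleteNormedModule R H := {
  inner : H -> H -> R ;
  innerC : forall x y : H, inner x y = inner y x ;
  innerDl : forall x y z : H, inner (x + y) z = inner x z + inner y z ;
  innerZl : forall (a : R) (x y : H), inner (a *: x) y = a * inner x y ;
  inner_norm : forall x : H, inner x x = `|x| ^+ 2 }.

#[short(type="hilbertType")]
HB.structure Definition Hilbert (R : realType) :=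
  { H of CompleteNormedModule R H & CompleteNormedModule_isHilbert R H }.

Definition separable (T : topologicalType) :=
  exists2 D : set T, countable D & dense D.

Notation borel H := (g_sigma_algebraType (@open H)).

Section gaussian.
Context {R : realType} {H : hilbertType R}.

(* The case [s = 0] is the point mass at [0]; it is separated out because
   [normal_prob 0 0] is not a point mass in the library. *)
Definition centered_gaussian (gamma : probability (borel H) R) :=
  forall h : H, exists2 s : R, 0 <= s &
    forall A : set R, measurable A ->
      gamma [set x : borel H | A (inner h x)] =
      if s == 0 then \d_(0 : R) A else normal_prob 0 s A.

End gaussian.

Section markov.
Context {d : measure_display} {T : measurableType d} {R : realType}.
Local Open Scope ereal_scope.

(* A kernel is given by its values [P x A]; these are meant for measurable
   [A] only. *)
Fixpoint kernel_iter (P : T -> set T -> \bar R) (n : nat) (x : T) (A : set T) :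
    \bar R :=
  if n is m.+1 then \int[P x]_y kernel_iter P m y A else \d_x A.

Definition invariant (P : T -> set T -> \bar R) (mu : probability T R) :=
  forall A, measurable A -> \int[mu]_x P x A = mu A.

Definition unique_invariant (P : T -> set T -> \bar R) (pi : probability T R) :=
  invariant P pi /\
  forall mu : probability T R, invariant P mu ->
    forall A, measurable A -> mu A = pi A.

Definition coupling (mu nu : set T -> \bar R)
    (lambda : probability (T * T)%type R) :=
  forall A, measurable A ->
    lambda (A `*` setT) = mu A /\ lambda (setT `*` A) = nu A.

Definition wasserstein (c : T -> T -> R) (mu nu : set T -> \bar R) : \bar R :=
  ereal_inf [set \int[lambda]_p (c p.1 p.2)%:E | lambda in coupling mu nu].

End markov.

Section pcn.
Context {R : realType} {H : hilbertType R}.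

Definition holder (g : H -> R) (beta Cg : R) :=
  forall x y : H, `|g x - g y| <= Cg * `|x - y| `^ beta.

Definition gibbs (gamma : probability (borel H) R) (g : H -> R)
    (pi : probability (borel H) R) :=
  exists2 c : R, 0 < c & forall A : set (borel H), measurable A ->
    (pi A = c%:E * \int[gamma]_(x in A) (expR (- g x))%:E)%E.

Definition pcn_proposal (rho : R) (x z : H) : H :=
  rho *: x + Num.sqrt (1 - rho ^+ 2) *: z.

Definition pcn_accept (g : H -> R) (x y : H) : R :=
  Num.min 1 (expR (g x - g y)).

Definition pcn (gamma : probability (borel H) R) (g : H -> R) (rho : R)
    (x : borel H) (A : set (borel H)) : \bar R :=
  (\int[gamma]_z (pcn_accept g x (pcn_proposal rho x z)
                  * \1_A (pcn_proposal rho x z : borel H))%:E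
   + \d_x A
     * \int[gamma]_z (1 - pcn_accept g x (pcn_proposal rho x z))%:E)%E.

Definition holder_dist (beta : R) (x y : borel H) : R :=
  Num.min (`|(x : H) - (y : H)| `^ beta) 1.

End pcn.

(* Main.v *)
Require Import Defs.
From HB Require Import structures.
From mathcomp Require Import all_boot all_order all_algebra.
From mathcomp Require Import all_classical all_reals all_analysis.
From mathcomp Require Import measurable_realfun ring lra.
Set Implicit Arguments.
Unset Strict Implicit.
Unset Printing Implicit Defensive.
Import Order.TTheory GRing.Theory Num.Theory.
Import numFieldNormedType.Exports.

Local Open Scope classical_set_scope.
Local Open Scope ring_scope.

(** The chain is driven by the pair (Z, U); running two copies with the same pair
    couples them synchronously ([paired]).  When both copies accept, the noise
    cancels and the distance t = |x - y| ^ beta is multiplied by q = rho ^ beta < 1.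
    When exactly one accepts, the copies may fly apart; but the Hoelder condition
    bounds the log-ratio of the two acceptance probabilities by a multiple C t of
    the distance itself, so this event is rare compared with a joint acceptance.
    The concave bounded cost 1 - exp (- A t) with A = 2 C / (1 - q) balances the two
    effects ([coupled_step_contracts]): it never grows on average, and it contracts
    on balls, at a rate governed by the probability of accepting there.

    Far from the origin this rate degenerates: for |x| = r the acceptance
    probability is only bounded below by a(r) = exp (- Cg ((1 - rho) r + K) ^ beta).
    There the Lyapunov function exp (s0 |x| ^ 2) takes over, since up to an
    additive constant it decreases by a factor 1 - a(r) / 4 ([drift]).  The
    geometric mean of the cost and of this weight, as in the weak Harris theorem,
    contracts by 1 - c a(r) for all pairs in the ball of radius r
    ([weighted_dist_contracts]).  Pairs outside the ball leak an amount of order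
    exp (- (s - s0) r ^ 2), paid by the larger Lyapunov function
    V(x) = exp (s |x| ^ 2).  After n steps, for every r ([coupled_decay]),

      cost <= (1 - c a(r)) ^ n * 2 W + 4 n exp (- (s - s0) r ^ 2) * (W + b n),
      W = V(x) + V(y).

    Take r with ((1 - rho) r + K) ^ beta = (5 / 6) ^ beta * ln n / Cg and s0 = s / 5.
    The first term becomes exp (- c n ^ (1 - (5 / 6) ^ beta)), which is of smaller
    order than exp (- k (ln n) ^ p) for all k and p.  With
    X = (ln n / Cg) ^ (1 / beta), the exponent of the second is
    - (5 theta / 144) X ^ 2 up to terms linear in X, whereas
    kappa (ln n) ^ (2 / beta) = (4 theta / 144) X ^ 2; the difference absorbs the
    factor n ^ 2 = exp (2 Cg X ^ beta) and the linear terms ([subgeometric_rate]).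
    No iterated logarithm is lost, and C2 = 0 will do.

    The bound on the Wasserstein distance follows by starting the coupling from
    the product of a point mass and pi ([wasserstein_le_paired]).  Starting it
    from mu and pi for another invariant mu shows that both give the same integral
    to every function controlled by the cost ([le_invariant_integral]), in
    particular to the functions cos (<h, x> + c), which determine a probability
    measure ([cos_determines_measure]).  The same criterion proves that pi is
    invariant: the pair (x, rho x + sqrt (1 - rho ^ 2) z) is exchangeable under
    gamma because its linear marginals are normal with symmetric variances
    ([pcn_proposal_exchangeable]), and the acceptance rule then makes pi
    reversible ([pcn_invariant]). *)

(** * Smooth steps built from the sine *)

Section step.
Context {R : realType}.
Implicit Types (a u y : R) (n m : nat).

Lemma bernoulli_ineq a n : -1 <= a -> 1 + n%:R * a <= (1 + a) ^+ n.
Proof.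
move=> a1; elim: n => [|n IH]; first by rewrite mul0r addr0 expr0.
have a2 : 0 <= 1 + a by lra.
rewrite exprS; apply: le_trans (ler_wpM2l a2 IH).
have n0 : 0 <= n%:R :> R by exact: ler0n.
rewrite -natr1; nra.
Qed.

Lemma bernoulli_inv y n : 0 <= y <= 1 -> (1 - y) ^+ n <= (1 + n%:R * y)^-1.
Proof.
move=> /andP[y0 y1].
have n0 : 0 <= n%:R :> R by exact: ler0n.
have ny : 0 < 1 + n%:R * y by rewrite ltr_wpDr// mulr_ge0.
rewrite -[leRHS]mul1r ler_pdivlMr//.
have y2 : 0 <= 1 - y by lra.
apply: (@le_trans _ _ ((1 - y) ^+ n * (1 + y) ^+ n)).
  by rewrite ler_wpM2l ?exprn_ge0// bernoulli_ineq//; lra.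
rewrite -exprMn exprn_ile1//; nra.
Qed.

(** The sine vanishes at 0 with slope 1; only this germ is used below. *)
Lemma sin_ge_half : exists2 e : R, 0 < e & forall u, 0 < u < e -> u / 2 <= sin u.
Proof.
have := @is_derive_sin R 0 => -[d_sin]; rewrite cos0 => dE.
have : (h^-1 *: (sin (h *: 1 + 0) - sin 0)) @[h --> (0:R)^'] --> (1 : R).
  by rewrite -[X in _ --> X]dE; exact: d_sin.
move=> dcv; have h12 : (1/2 : R) < 1 by lra.
have [e /= e0 He] := cvgr_ge _ dcv _ h12; exists e => // u /andP[u0 ue].
have := He u; rewrite /= sub0r normrN gtr0_norm// => /(_ ue (lt0r_neq0 u0)).
rewrite sin0 subr0 addr0 /GRing.scale/= mulr1 => h.
have : u * (1/2) <= u * (u^-1 * sin u) by rewrite ler_wpM2l// ltW.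
by rewrite mulVKf ?lt0r_neq0//; lra.
Qed.

Lemma near_natS_gt (x : R) : \forall m \near \oo, x < m.+1%:R.
Proof.
exists (Num.trunc x) => // m /= hm.
by apply: lt_le_trans (truncnS_gt x) _; rewrite ler_nat.
Qed.

(** A periodic substitute for the indicator of the positive half-line.  With s the
    sine, 2 ^ n * ((1 + s) / 2) ^ n = (1 + s) ^ n, which is large for s > 0 and small
    for s < 0.  Stretching by m.+1 moves any fixed point into the region where the
    sine has the sign of its argument; the shift by m.+1^-1 settles the value at
    u = 0; there the slope is of order m.+1 ^- 2, which the exponent
    n = m.+1 ^ 3 overcomes. *)
Definition step m u : R :=
  let n := (m.+1 ^ 3)%N in
  1 - (1 - ((1 + sin ((u - m.+1%:R^-1) / m.+1%:R)) / 2) ^+ n) ^+ (2 ^ n).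

Lemma step01 m u : 0 <= step m u <= 1.
Proof.
rewrite /step; set n := (_ ^ 3)%N; set s := sin _.
have s1 : s <= 1 := sin_le1 _; have s2 : -1 <= s := sin_geN1 _.
have x01 : 0 <= ((1 + s)/2) ^+ n <= 1.
  by rewrite exprn_ge0 ?exprn_ile1//; lra.
set z := _ ^+ n in x01 *.
have : 0 <= (1 - z) ^+ (2 ^ n) <= 1 by rewrite exprn_ge0 ?exprn_ile1//; lra.
lra.
Qed.

(** Both sides reduce to Bernoulli: with x = ((1 + s) / 2) ^ n, the power
    (1 - x) ^ (2 ^ n) lies between 1 - 2 ^ n x and 1 / (1 + 2 ^ n x), where
    2 ^ n x = (1 + s) ^ n, and (1 + s) ^ n is in turn compared with 1 + n s. *)
Lemma step_near u : exists2 C : R, 0 < C &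
  \forall m \near \oo, `|step m u - (0 < u)%R%:R| <= C * m.+1%:R^-1.
Proof.
have [e e0 He] := sin_ge_half.
have M0 m : 0 < m.+1%:R :> R by [].
have M1 m : 1 <= m.+1%:R :> R by rewrite ler1n.
have [u0|u0] := ltP 0 u.
  exists (4 / u); first by rewrite divr_gt0.
  near=> m; have := step01 m u; rewrite /step.
  set n := (_ ^ 3)%N; have [M ME] : {M : R | M = m.+1%:R} by exists m.+1%:R.
rewrite -ME; set v := (u - _) / _.
  have MM : 0 < M by rewrite ME.
  have M2 : 2 / u <= M by apply: ltW; rewrite ME; near: m; exact: near_natS_gt.
  have Me : u / e < M.
    rewrite ME; near: m; exact: near_natS_gt.
  have Mu : M^-1 <= u / 2.
    by rewrite -(@invrK _ (u/2)) lef_pV2 ?posrE// ?invr_gt0 ?divr_gt0// invf_div.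
  have v_ge : u / 2 / M <= v by rewrite /v ler_pM2r ?invr_gt0//; lra.
  have v_gt0 : 0 < v by apply: lt_le_trans v_ge; rewrite !divr_gt0.
  have v_lt : v < e.
    rewrite /v ltr_pdivrMr//; apply: (@le_lt_trans _ _ u).
      by rewrite gerBl invr_ge0 ltW.
    by move: Me; rewrite ltr_pdivrMr// mulrC.
  have /He sv : 0 < v < e by rewrite v_gt0.
  have s1 : sin v <= 1 := sin_le1 _.
  have nM : n%:R = M ^+ 3 :> R by rewrite natrX ME.
  have Sn : 1 + M * u / 4 <= (1 + sin v) ^+ n.
    apply: le_trans (bernoulli_ineq _ _); last by lra.
    rewrite lerD2l nM; apply: (@le_trans _ _ (M ^+ 3 * (v / 2))); last first.
      by rewrite ler_pM2l ?exprn_gt0.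
    apply: (@le_trans _ _ (M ^+ 3 * (u / 2 / M / 2))); last first.
      by rewrite ler_pM2l ?exprn_gt0//; lra.
    rewrite [leRHS](_ : _ = M ^+ 2 * u / 4); last by field; rewrite gt_eqF.
    rewrite ler_pM2r// ler_pM2r// expr2 ler_peMl ?(ltW MM)// ME; exact: M1.
  set z := _ ^+ n => _.
  have z01 : 0 <= z <= 1.
    by have := sin_geN1 v; rewrite /z exprn_ge0 ?exprn_ile1//; lra.
  rewrite [X in `|X|](_ : _ = - (1 - z) ^+ (2 ^ n)); last by rewrite /=; ring.
  rewrite normrN ger0_norm ?exprn_ge0//; last by lra.
  have := bernoulli_inv (2 ^ n) z01.
  rewrite natrX /z expr_div_n mulrCA divff ?mulr1 ?expf_neq0//.
  move=> /le_trans; apply.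
  rewrite (_ : 4 / u / M = (M * u / 4)^-1); last by field; rewrite !gt_eqF.
  rewrite lef_pV2 ?posrE; last 2 first.
  - by have := mulr_gt0 MM u0; lra.
  - by have := mulr_gt0 MM u0; lra.
  by lra.
exists 2 => //.
near=> m; have := step01 m u; rewrite /step.
set n := (_ ^ 3)%N; have [M ME] : {M : R | M = m.+1%:R} by exists m.+1%:R.
rewrite -ME; set v := (u - _) / _.
have MM : 0 < M by rewrite ME.
have Me : (1 - u) / e < M.
  rewrite ME; near: m; exact: near_natS_gt.
have Mi : M^-1 <= 1 by rewrite invf_le1//; rewrite ME; exact: M1.
have Mi0 : 0 < M^-1 by rewrite invr_gt0.
have v_ge : M^-1 ^+ 2 <= - v.
  by rewrite expr2 -mulNr ler_pM2r//; lra.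
have v_gt0 : 0 < - v by apply: lt_le_trans v_ge; rewrite exprn_gt0.
have v_lt : - v < e.
  rewrite -mulNr ltr_pdivrMr//; apply: (@le_lt_trans _ _ (1 - u)); first lra.
  by move: Me; rewrite ltr_pdivrMr// mulrC.
have /He sv : 0 < - v < e by rewrite v_gt0.
have s1 : sin (- v) <= 1 := sin_le1 _.
have s3 : 0 <= sin (-v) by apply: le_trans sv; rewrite divr_ge0// ltW.
have -> : sin v = - sin (- v) by rewrite sinN opprK.
have nM : n%:R = M ^+ 3 :> R by rewrite natrX ME.
move=> /andP[h0 _]; rewrite subr0 ger0_norm//.
set s := sin (- v) in sv s1 s3 h0 *.
have Sn : (1 - s) ^+ n <= 2 * M^-1.
  apply: le_trans (bernoulli_inv _ _) _; first by rewrite s3.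
  rewrite -[2]invrK -invfM lef_pV2 ?posrE//; last 2 first.
  - by rewrite ltr_wpDr// mulr_ge0.
  - by rewrite mulr_gt0 ?invr_gt0.
  rewrite nM; apply: (@le_trans _ _ (M ^+ 3 * (M^-1 ^+ 2 / 2))).
    by rewrite exprVn le_eqVlt; apply/orP; left; apply/eqP; field; rewrite gt_eqF.
  apply: (@le_trans _ _ (M ^+ 3 * s)); last by lra.
  rewrite ler_pM2l ?exprn_gt0//; lra.
apply: le_trans Sn.
set z := (_ ^+ n).
have z01 : 0 <= z <= 1 by rewrite /z exprn_ge0 ?exprn_ile1//; lra.
have := @bernoulli_ineq (- z) (2 ^ n).
have -> : (1 - s) ^+ n = (2 ^ n)%:R * z.
  by rewrite natrX /z expr_div_n mulrCA divff ?mulr1 ?expf_neq0.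
rewrite mulrN => /(_ _); lra.
Unshelve. all: by end_near.
Qed.

Lemma cvg_step u : step m u @[m --> \oo] --> ((0 < u)%R%:R : R).
Proof.
have [C C0 HC] := step_near u.
apply/cvgrPdistC_le => e e0.
near=> m.
have /le_trans : `|step m u - (0 < u)%R%:R| <= C * m.+1%:R^-1 by near: m.
apply; near: m.
apply: filterS (near_natS_gt (C / e)) => m /ltW.
by rewrite ler_pdivrMr// ler_pdivrMr// mulrC.
Unshelve. all: by end_near.
Qed.

End step.

(** * Cosine integrals determine a probability measure *)

Section trigonometric.
Context {d : measure_display} {T : measurableType d} {R : realType}.
Implicit Types (L : set (T -> R)) (f g l : T -> R).

(** The role of the class of functions x |-> <h, x> + c: an abstract class lets one
    proof serve H and H * H. *)
Definition affine_class L :=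
  [/\ forall c, L (fun=> c), forall a l, L l -> L (fun x => a * l x),
      forall l1 l2, L l1 -> L l2 -> L (fun x => l1 x + l2 x) &
      forall l, L l -> measurable_fun setT l].

Inductive trig_poly L : (T -> R) -> Prop :=
| trig_cos l of L l : trig_poly L (fun x => cos (l x))
| trig_add f g of trig_poly L f & trig_poly L g : trig_poly L (fun x => f x + g x)
| trig_scale a f of trig_poly L f : trig_poly L (fun x => a * f x).

Lemma trig_poly_cst L c : affine_class L -> trig_poly L (fun=> c).
Proof.
move=> [Lc _ _ _]; have -> : (fun=> c) = (fun x : T => c * cos ((fun=> 0 : R) x)).
  by apply/funext => x; rewrite cos0 mulr1.
exact/trig_scale/trig_cos/Lc.
Qed.

(** Product-to-sum formulas turn products of cosines into sums. *)
Lemma trig_poly_mul L f g : affine_class L ->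
  trig_poly L f -> trig_poly L g -> trig_poly L (fun x => f x * g x).
Proof.
move=> [Lc LZ LD _] tf; elim: tf g => {f}.
- move=> l1 Ll1 g; elim=> {g}.
  + move=> l2 Ll2.
    have -> : (fun x => cos (l1 x) * cos (l2 x)) = (fun x => 2^-1 *
        (cos (l1 x + l2 x) + cos (l1 x + (-1) * l2 x))).
      by apply/funext => x; rewrite mulN1r cosB cosD; field.
    by apply: trig_scale; apply: trig_add; apply: trig_cos; apply: LD => //; exact: LZ.
  + move=> f g _ hf _ hg.
    under eq_fun do rewrite mulrDr.
    exact: trig_add.
  + move=> a f _ hf.
    under eq_fun do rewrite mulrCA.
    exact: trig_scale.
- move=> f1 f2 _ h1 _ h2 g tg.
  under eq_fun do rewrite mulrDl.
  by apply: trig_add; [exact: h1|exact: h2].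
- move=> a f _ h g tg.
  under eq_fun do rewrite -mulrA.
  by apply: trig_scale; exact: h.
Qed.

Lemma trig_poly_exp L f n : affine_class L ->
  trig_poly L f -> trig_poly L (fun x => f x ^+ n).
Proof.
move=> La tf; elim: n => [|n IH].
  by under eq_fun do rewrite expr0; exact: trig_poly_cst.
by under eq_fun do rewrite exprS; exact: trig_poly_mul.
Qed.

Lemma trig_poly_measurable L f : affine_class L -> trig_poly L f ->
  measurable_fun setT f.
Proof.
move=> [_ _ _ Lm]; elim=> {f}.
- move=> l Ll; apply: measurableT_comp; last exact: Lm.
  by apply: continuous_measurable_fun; exact: continuous_cos.
- by move=> f g _ mf _ mg; exact: measurable_funD.
- by move=> a f _ mf; exact: measurable_funM.
Qed.

Lemma trig_poly_bounded L f : trig_poly L f -> exists M, forall x, `|f x| <= M.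
Proof.
elim=> {f} [l _|f g _ [M1 h1] _ [M2 h2]|a f _ [M h]].
- by exists 1 => x; exact: cos_max.
- by exists (M1 + M2) => x; apply: le_trans (ler_normD _ _) _; exact: lerD.
- by exists (`|a| * M) => x; rewrite normrM ler_wpM2l.
Qed.

Lemma bounded_integrable (mu : probability T R) f (M : R) :
  measurable_fun setT f -> (forall x, `|f x| <= M) ->
  mu.-integrable setT (EFin \o f).
Proof.
move=> mf fM; apply: measurable_bounded_integrable => //.
  by rewrite ltey_eq fin_num_measure.
by exists M; split=> [|x Mx y _]; [exact: num_real|exact: le_trans (fM y) (ltW Mx)].
Qed.

Lemma trig_poly_integrable L f (mu : probability T R) : affine_class L ->
  trig_poly L f -> mu.-integrable setT (EFin \o f).
Proof.
move=> La tf; have [M fM] := trig_poly_bounded tf.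
exact: bounded_integrable (trig_poly_measurable La tf) fM.
Qed.

Lemma trig_poly_integral L f (mu nu : probability T R) : affine_class L ->
  (forall l, L l -> \int[mu]_x (cos (l x))%:E = \int[nu]_x (cos (l x))%:E)%E ->
  trig_poly L f -> (\int[mu]_x (f x)%:E = \int[nu]_x (f x)%:E)%E.
Proof.
move=> La munu; elim=> {f} [l /munu//|f g tf hf tg hg|a f tf hf].
- under eq_integral do rewrite EFinD; under [RHS]eq_integral do rewrite EFinD.
  rewrite !integralD//; [|exact: trig_poly_integrable La _..].
  by rewrite hf hg.
- under eq_integral do rewrite EFinM; under [RHS]eq_integral do rewrite EFinM.
  rewrite !integralZl//; [|exact: trig_poly_integrable La _..].
  by rewrite hf.
Qed.

(** A sine is a cosine with shifted phase, and constants belong to the affine class. *)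
Lemma trig_poly_step L l m : affine_class L -> L l ->
  trig_poly L (fun x => step m (l x)).
Proof.
move=> La Ll; have [Lc LZ LD _] := La.
have Bcl f : trig_poly L f -> trig_poly L (fun x => 1 - f x).
  move=> tf; under eq_fun do rewrite -mulN1r.
  by apply: trig_add; [exact: trig_poly_cst|exact: trig_scale].
apply: (Bcl); apply: trig_poly_exp => //; apply: Bcl; apply: trig_poly_exp => //.
under eq_fun do rewrite mulrC.
apply: trig_scale; apply: trig_add; first exact: trig_poly_cst.
have -> : (fun x => sin ((l x - m.+1%:R^-1) / m.+1%:R)) =
    (fun x => cos (m.+1%:R^-1 * (l x + - m.+1%:R^-1) + - (pi / 2))).
  by apply/funext => x; rewrite cosB cos_pihalf sin_pihalf mulr0 add0r mulr1 mulrC.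
by apply: trig_cos; apply: (LD) => //; apply: LZ; apply: LD.
Qed.

Definition trig_approximable L (A : set T) := measurable A /\
  exists2 phi : nat -> T -> R, (forall m, trig_poly L (phi m)) &
    (forall m x, 0 <= phi m x <= 1) /\
    forall x, phi m x @[m --> \oo] --> (\1_A x : R).

Lemma trig_approximable_setI L : affine_class L -> setI_closed (trig_approximable L).
Proof.
move=> La A B [mA [phi tphi [phi01 cphi]]] [mB [psi tpsi [psi01 cpsi]]].
split; first exact: measurableI.
exists (fun m x => phi m x * psi m x); first by move=> m; exact: trig_poly_mul.
split=> [m x|x].
  have /andP[? ?] := phi01 m x; have /andP[? ?] := psi01 m x.
  by rewrite mulr_ge0//= mulr_ile1.
by rewrite indicI; apply: cvgM.
Qed.

Lemma trig_approximable_integral L A (mu nu : probability T R) : affine_class L ->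
  (forall l, L l -> \int[mu]_x (cos (l x))%:E = \int[nu]_x (cos (l x))%:E)%E ->
  trig_approximable L A -> mu A = nu A.
Proof.
move=> La munu [mA [phi tphi [phi01 cphi]]].
have key (P : probability T R) :
    (\int[P]_x (phi m x)%:E @[m --> \oo] --> P A)%E.
  have -> : P A = (\int[P]_x (\1_A x)%:E)%E by rewrite integral_indic// setIT.
  apply: (@dominated_cvg _ _ _ P setT measurableT _ _ (cst 1%E)) => //.
  - by move=> m; apply/measurable_EFinP; exact: trig_poly_measurable La (tphi m).
  - by move=> x _; apply/cvg_EFin; [near=> m|exact: cphi].
  - by apply/finite_measure_integrable_cst.
  - move=> m x _; rewrite lee_fin; have /andP[? ?] := phi01 m x.
    by rewrite ger0_norm.
have := key mu; under eq_fun do rewrite (trig_poly_integral La munu (tphi _)).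
by move=> /cvg_unique; apply; [exact: ereal_hausdorff|exact: key].
Unshelve. all: by end_near.
Qed.

(** Cramer-Wold and the uniqueness of characteristic functions in one statement:
    indicators of half-spaces are bounded pointwise limits of trigonometric
    polynomials, which form an algebra, so finite intersections of half-spaces
    have the same mass under both measures and Dynkin's lemma concludes. *)
Theorem cos_determines_measure L (mu nu : probability T R) : affine_class L ->
  (forall A, measurable A -> <<s [set [set x | 0 < l x] | l in L] >> A) ->
  (forall l, L l -> \int[mu]_x (cos (l x))%:E = \int[nu]_x (cos (l x))%:E)%E ->
  forall A, measurable A -> mu A = nu A.
Proof.
move=> La gen munu A mA; have [Lc LZ LD Lm] := La.
have half l : L l -> trig_approximable L [set x | 0 < l x].
  move=> Ll; split.
    rewrite -[X in measurable X]setTI.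
    have -> : [set x | 0 < l x] = l @^-1` `]0, +oo[.
      by apply/seteqP; split=> x /=; rewrite in_itv/= andbT.
    by apply: Lm.
  exists (fun m x => step m (l x)); first by move=> m; exact: trig_poly_step.
  by split=> [m x|x]; [exact: step01|rewrite indicE mem_setE; exact: cvg_step].
have apT : trig_approximable L setT.
  rewrite (_ : setT = [set x | 0 < (fun=> 1 : R) x]); first exact/half/Lc.
  by apply/seteqP; split=> x//= _; exact: ltr01.
apply: (@g_sigma_algebra_measure_unique _ R T (trig_approximable L) _ (fun=> setT)).
- by move=> B [].
- by [].
- by rewrite bigcup_const//; exists 0%N.
- exact: trig_approximable_setI.
- by move=> B; exact: trig_approximable_integral.
- by move=> _; rewrite ltey_eq fin_num_measure.
- apply: sub_sigma_algebra2 (gen _ mA) => _ [l Ll <-]; exact: half.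
Qed.

End trigonometric.

(** * Integration against a density *)

Section density.
Context {d : measure_display} {T : measurableType d} {R : realType}.
Variables (mu nu : {measure set T -> \bar R}) (p : T -> R).
Hypotheses (mp : measurable_fun setT p) (p0 : forall x, 0 <= p x).
Hypothesis nuE : forall A, measurable A -> nu A = (\int[mu]_(x in A) (p x)%:E)%E.
Local Open Scope ereal_scope.
Import HBNNSimple.

Let density_nnsfun (h : {nnsfun T >-> R}) :
  \int[nu]_x (h x)%:E = \int[mu]_x ((h x)%:E * (p x)%:E).
Proof.
under [LHS]eq_integral do rewrite fimfunE -fsumEFin//.
rewrite [LHS]ge0_integral_fsum//; last 2 first.
  - by move=> r; exact/measurable_EFinP/measurableT_comp.
  - by move=> n x _; rewrite EFinM nnfun_muleindic_ge0.
under [RHS]eq_integral.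
  move=> x _; rewrite fimfunE -fsumEFin// ge0_mule_fsuml; last first.
    by move=> r; rewrite EFinM nnfun_muleindic_ge0.
  over.
rewrite [RHS]ge0_integral_fsum//; last 2 first.
  - move=> r; apply: emeasurable_funM; last exact/measurable_EFinP.
    exact/measurable_EFinP/measurableT_comp.
    - by move=> n x _; apply: mule_ge0; [rewrite EFinM nnfun_muleindic_ge0|rewrite lee_fin].
apply: eq_fsbigr => r _.
have mA : measurable (h @^-1` [set r]) by [].
have [r0|r0] := ltP r 0%R.
  rewrite preimage_nnfun0//.
  under eq_integral do rewrite indic0 mulr0; under [RHS]eq_integral do rewrite indic0 mulr0 mul0e.
  by rewrite !integral0.
under eq_integral do rewrite EFinM.
rewrite ge0_integralZl//; last exact/measurable_EFinP.
under [RHS]eq_integral do rewrite EFinM -muleA.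
rewrite [RHS]ge0_integralZl//; last 2 first.
- by apply: emeasurable_funM; exact/measurable_EFinP.
- by move=> x _; rewrite mule_ge0// lee_fin.
congr (_ * _); rewrite integral_indic// setIT nuE// integral_mkcond.
apply: eq_integral => x _; rewrite patchE indicE.
by case: ifP => _; rewrite ?mul1e ?mul0e.
Qed.

Lemma ge0_integral_density (f : T -> \bar R) : measurable_fun setT f ->
  (forall x, 0 <= f x) -> \int[nu]_x f x = \int[mu]_x (f x * (p x)%:E).
Proof.
move=> mf f0; pose f_ := nnsfun_approx measurableT mf.
transitivity (lim (\int[nu]_x (f_ n x)%:E @[n --> \oo])).
  rewrite -monotone_convergence//=.
  - apply: eq_integral => x _; apply/esym/cvg_lim => //=.
    exact: cvg_nnsfun_approx.
  - by move=> n; exact/measurable_EFinP/measurable_funTS.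
  - by move=> n ? _; rewrite lee_fin.
  - by move=> ? _ ? ? mn; rewrite lee_fin; exact/lefP/nd_nnsfun_approx.
under eq_fun do rewrite density_nnsfun.
rewrite -monotone_convergence//=.
- apply: eq_integral => x _; apply/cvg_lim => //=.
  by apply: cvgeZr => //; exact: cvg_nnsfun_approx.
- by move=> n; apply: emeasurable_funM; exact/measurable_EFinP.
- by move=> n ? _; rewrite mule_ge0// lee_fin.
- move=> x _ m n mn; apply: lee_wpmul2r; first by rewrite lee_fin.
  rewrite lee_fin.
  exact/lefP/nd_nnsfun_approx.
Qed.

End density.

Lemma integral_prob_cst {d} {T : measurableType d} {R : realType}
  (P : probability T R) (c : \bar R) : (\int[P]_x c = c)%E.
Proof.
transitivity (c * P setT)%E; first exact: integral_cst.
by rewrite probability_setT mule1.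
Qed.

(** * One-dimensional normal laws *)

Section affine_substitution.
Context {R : realType}.
Notation leb := (@lebesgue_measure R).

Lemma ge0_integral_affine (G : R -> R) (a c : R) : 0 < a -> continuous G ->
  (forall x, 0 <= G x) ->
  (\int[leb]_x (G x)%:E = \int[leb]_x (G (a * x + c) * a)%:E)%E.
Proof.
move=> a0 cG G0.
pose F (x : R) := a * x + c.
have dF (x : R) : is_derive x 1 F a.
  rewrite /F; apply: is_derive_eq; by rewrite addr0 scaler1.
have F'E : F^`()%classic = cst a.
  by apply/funext => x; rewrite derive1E; case: (dF x).
rewrite (@increasing_ge0_integration_by_substitutionT _ F G)//.
- by apply: eq_integral => x _; rewrite F'E.
- by move=> x y xy; rewrite ltrD2r ltr_pM2l.
- by rewrite F'E => z; exact: cvg_cst.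
- by rewrite F'E; exact: is_cvg_cst.
- by rewrite F'E; exact: is_cvg_cst.
- apply/cvgrNyPle => A; exists ((A - c) / a); split; first exact: num_real.
  by move=> x; rewrite ltr_pdivlMr// /F => ?; lra.
- apply/cvgryPge => A; exists ((A - c) / a); split; first exact: num_real.
  by move=> x; rewrite ltr_pdivrMr// /F => ?; lra.
Qed.
End affine_substitution.
Section standard_normal.
Context {R : realType}.
Notation leb := (@lebesgue_measure R).
Notation N1 := (normal_prob (0 : R) 1).
Implicit Types (F : R -> R) (m s u v w : R).

Lemma ge0_integral_normal m s (f : R -> \bar R) : measurable_fun setT f ->
  (forall x, 0 <= f x)%E ->
  (\int[normal_prob m s]_x f x = \int[leb]_x (f x * (normal_pdf m s x)%:E))%E.
Proof.
move=> mf f0; apply: ge0_integral_density => //.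
- exact: measurable_normal_pdf.
- by move=> x; exact: normal_pdf_ge0.
Qed.

(** The change of variables is done on continuous integrands, for which the
    substitution formula on the whole line applies. *)
Lemma normal_prob_scale s F : 0 < s -> continuous F -> (forall x, 0 <= F x) ->
  (\int[normal_prob 0 s]_x (F x)%:E = \int[N1]_y (F (s * y))%:E)%E.
Proof.
move=> s0 cF F0; have s1 : s != 0 by rewrite gt_eqF.
have mF : measurable_fun setT (EFin \o F).
  by apply/measurable_EFinP; exact: continuous_measurable_fun.
have mFs : measurable_fun setT (fun y => (F (s * y))%:E).
  by apply: (measurableT_comp mF); exact: mulrl_measurable.
rewrite (ge0_integral_normal _ _ mF); last by move=> y; rewrite lee_fin.
rewrite (ge0_integral_normal _ _ mFs); last by move=> y; rewrite lee_fin.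
under eq_integral do rewrite -EFinM.
rewrite (@ge0_integral_affine _ (fun x => F x * normal_pdf 0 s x) s 0)//.
- apply: eq_integral => x _; rewrite addr0 -EFinM -mulrA; congr (_ * _)%:E.
  rewrite !normal_pdfE ?oner_neq0// mulrAC; congr (_ * _).
    rewrite /normal_peak expr1n mul1r -mulrnAr sqrtrM ?sqr_ge0// sqrtr_sqr gtr0_norm//.
    by rewrite invfM mulrAC mulVf// mul1r.
  rewrite /normal_fun; congr expR; field.
  by rewrite s1.
- by move=> x; apply: cvgM; [exact: cF|exact: continuous_normal_pdf].
- by move=> x; rewrite mulr_ge0// normal_pdf_ge0.
Qed.

Let measurable_rotated (u v : R) (F : R -> R) : continuous F ->
  measurable_fun [set: R * R] (fun p => (F p.2 * normal_pdf 0 1 p.2 *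
     (normal_peak v * normal_fun (u * p.2) v p.1))%:E).
Proof.
move=> cF; apply/measurable_EFinP; apply: measurable_funM.
  apply: measurable_funM.
    by apply: (measurableT_comp (continuous_measurable_fun cF)).
  by apply: (measurableT_comp (measurable_normal_pdf 0 1)).
apply: measurable_funM => //; rewrite /normal_fun.
apply: measurableT_comp => //; apply: measurable_funM => //.
apply: measurableT_comp => //; apply: measurable_funX.
by apply: measurable_funB => //; apply: measurable_funM.
Qed.

(** After z = (y - u x) / v the exponent - (z ^ 2 + x ^ 2) / 2 is, by completing the
    square, also - (y ^ 2 + ((x - u y) / v) ^ 2) / 2: for fixed y the variable x is
    normal again and integrates to 1. *)
Let normal_prob_rotate1 u v F : 0 < v -> u ^+ 2 + v ^+ 2 = 1 ->
  continuous F -> (forall x, 0 <= F x) ->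
  (\int[N1]_x \int[N1]_z (F (u * x + v * z))%:E = \int[N1]_y (F y)%:E)%E.
Proof.
move=> v0 uv cF F0; have v1 : v != 0 by rewrite gt_eqF.
have inner x : (\int[N1]_z (F (u * x + v * z))%:E =
    \int[leb]_y (F y * normal_pdf 0 1 ((y - u * x) / v) / v)%:E)%E.
  rewrite ge0_integral_normal//; last 2 first.
  - apply/measurable_EFinP; apply: continuous_measurable_fun => z.
    apply: continuous_comp; last exact: cF.
    by apply: continuousD; [exact: cvg_cst|exact: mulrl_continuous].
  - by move=> y; rewrite lee_fin.
  rewrite [RHS](@ge0_integral_affine _ _ v (u * x))//.
  - apply: eq_integral => z _; rewrite -EFinM addrC divfK//; congr (_ * normal_pdf _ _ _)%:E.
    by field.
  - move=> y; apply: cvgM; last exact: cvg_cst.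
    apply: cvgM; first exact: cF.
    apply: (continuous_comp (f := fun y => (y - u * x) / v)); last exact: continuous_normal_pdf.
    apply: cvgM; last exact: cvg_cst.
    by apply: cvgB; [exact: cvg_id|exact: cvg_cst].
  - by move=> y; rewrite divr_ge0 ?mulr_ge0 ?normal_pdf_ge0// ltW.
have mG : measurable_fun setT (fun x => \int[N1]_z (F (u * x + v * z))%:E)%E.
  apply: (measurable_fun_fubini_tonelli_F (m2 := N1)
    (fun p : R * R => (F (u * p.1 + v * p.2))%:E)).
    apply/measurable_EFinP; apply: (measurableT_comp (continuous_measurable_fun cF)).
    by apply: measurable_funD; apply: measurable_funM.
  by move=> p; rewrite lee_fin.
rewrite (ge0_integral_normal _ _ mG); last first.
  by move=> x; apply: integral_ge0 => z _; rewrite lee_fin.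
transitivity (\int[leb]_x \int[leb]_y (F y * normal_pdf 0 1 y *
     (normal_peak v * normal_fun (u * y) v x))%:E)%E.
  apply: eq_integral => x _; rewrite inner -ge0_integralZr//.
  - apply: eq_integral => y _; rewrite -EFinM; congr EFin.
    rewrite !normal_pdfE ?oner_neq0// /normal_peak expr1n mul1r -mulrnAr.
    rewrite sqrtrM ?sqr_ge0// sqrtr_sqr gtr0_norm// invfM.
    set c := (Num.sqrt (pi *+ 2))^-1.
    transitivity (F y * c ^+ 2 / v * (normal_fun 0 1 ((y - u * x) / v) * normal_fun 0 1 x)).
      by ring.
    transitivity (F y * c ^+ 2 / v * (normal_fun 0 1 y * normal_fun (u * y) v x)); last by ring.
    congr (_ * _); rewrite /normal_fun -!expRD; congr expR.
    have v2 : v ^+ 2 = 1 - u ^+ 2 by rewrite -uv addrC addKr.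
    transitivity (- ((y - u * x) ^+ 2 + v ^+ 2 * x ^+ 2) / (2 * v ^+ 2)); first by field.
    transitivity (- (v ^+ 2 * y ^+ 2 + (x - u * y) ^+ 2) / (2 * v ^+ 2)); last by field.
    by congr (- _ / _); rewrite v2; ring.
  - apply/measurable_EFinP; apply: measurable_funM => //; apply: measurable_funM.
      exact: continuous_measurable_fun.
    apply: (measurableT_comp (measurable_normal_pdf 0 1)).
    by apply: measurable_funM => //; exact: measurable_funB.
  - by move=> y _; rewrite lee_fin divr_ge0 ?mulr_ge0 ?normal_pdf_ge0// ltW.
  - by rewrite lee_fin normal_pdf_ge0.
have J0 (p : R * R) : (0 <= (F p.2 * normal_pdf 0 1 p.2 *
     (normal_peak v * normal_fun (u * p.2) v p.1))%:E)%E.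
  by rewrite lee_fin !mulr_ge0 ?normal_pdf_ge0 ?normal_peak_ge0 ?normal_fun_ge0.
apply: (etrans (fubini_tonelli (m1 := leb) (m2 := leb) _ (measurable_rotated u v cF) J0)) => /=.
rewrite ge0_integral_normal; last 2 first.
- by apply/measurable_EFinP; exact: continuous_measurable_fun.
- by move=> x; rewrite lee_fin.
apply: eq_integral => y _.
under eq_integral do rewrite EFinM.
rewrite ge0_integralZl//; last 3 first.
- apply/measurable_EFinP; apply: measurable_funM => //.
  exact: measurable_normal_fun.
- by move=> x _; rewrite lee_fin mulr_ge0 ?normal_peak_ge0 ?normal_fun_ge0.
- by rewrite lee_fin mulr_ge0 ?normal_pdf_ge0.
rewrite -EFinM -[RHS]mule1; congr (_ * _)%E.
rewrite -[RHS](@integral_normal_pdf R (u * y) v).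
by apply: eq_integral => x _; rewrite normal_pdfE.
Qed.

(** The sum of independent centered normal variables is normal. *)
Lemma normal_prob_rotate u v F : 0 <= u -> 0 <= v ->
  continuous F -> (forall x, 0 <= F x) ->
  (\int[N1]_x \int[N1]_z (F (u * x + v * z))%:E =
   \int[N1]_y (F (Num.sqrt (u ^+ 2 + v ^+ 2) * y))%:E)%E.
Proof.
move=> u0; rewrite le_eqVlt => /predU1P[<-|v0] cF F0.
  rewrite expr0n/= addr0 sqrtr_sqr ger0_norm//.
  apply: eq_integral => x _; under eq_integral do rewrite mul0r addr0.
  exact: (integral_prob_cst N1).
set w := Num.sqrt _.
have w0 : 0 < w by rewrite sqrtr_gt0 ltr_wpDl ?exprn_ge0// exprn_gt0.
have w2 : w ^+ 2 = u ^+ 2 + v ^+ 2 by rewrite sqr_sqrtr// addr_ge0 ?exprn_ge0// ltW.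
rewrite -(@normal_prob_rotate1 (u / w) (v / w) (fun y => F (w * y)))//.
- apply: eq_integral => x _; apply: eq_integral => z _; congr (F _)%:E.
  by field; rewrite gt_eqF.
- exact: divr_gt0.
- by rewrite !expr_div_n -mulrDl -w2 divff// expf_neq0// gt_eqF.
- by move=> y; apply: continuous_comp; [exact: mulrl_continuous|exact: cF].
Qed.

(** Finiteness and positivity of the second moment let variances be compared through
    integrals of squares, without computing the moment. *)
Lemma normal_second_moment_gt0 : (0 < \int[N1]_x (x ^+ 2)%:E)%E.
Proof.
have m2 : measurable_fun setT (fun x : R => (x ^+ 2)%:E).
  by apply/measurable_EFinP; exact: measurable_funX.
rewrite ge0_integral_normal//; last by move=> x; rewrite lee_fin sqr_ge0.
under eq_integral do rewrite -EFinM.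
set h := fun x : R => (x ^+ 2 * normal_pdf 0 1 x)%:E.
have h0 x : (0 <= h x)%E by rewrite lee_fin mulr_ge0 ?sqr_ge0 ?normal_pdf_ge0.
have mh : measurable_fun setT h.
  apply/measurable_EFinP; apply: measurable_funM; first exact: measurable_funX.
  exact: measurable_normal_pdf.
have ppos : 0 < normal_pdf 0 1 (2 : R).
  by rewrite normal_pdfE ?oner_neq0// mulr_gt0 ?expR_gt0// normal_peak_gt0 ?oner_neq0.
apply: (@lt_le_trans _ _ (\int[leb]_(x in `[1%R, 2%R]) (cst (normal_pdf 0 1 (2 : R))%:E x))%E).
  rewrite integral_cst//= lebesgue_measure_itv/= lte_fin ltr1n/=.
  by rewrite -EFinD -EFinM lte_fin mulr_gt0//; lra.
apply: (@le_trans _ _ (\int[leb]_(x in `[1%R, 2%R]) h x)%E); last first.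
  exact: ge0_subset_integral.
apply: ge0_le_integral => //=.
- by move=> x _; rewrite lee_fin ltW.
- exact: measurable_funTS.
- move=> x; rewrite /= in_itv/= => /andP[x1 x2]; rewrite /h lee_fin.
  rewrite -[leLHS]mul1r ler_pM//; [exact: normal_pdf_ge0|by rewrite expr_ge1//; lra|].
  rewrite !normal_pdfE ?oner_neq0// ler_wpM2l ?normal_peak_ge0//.
  by rewrite ler_expR !subr0 expr1n; nra.
Qed.

(** Half of the Gaussian exponent dominates x ^ 2, leaving a normal density of
    variance 2. *)
Lemma normal_second_moment_lty : (\int[N1]_x (x ^+ 2)%:E < +oo)%E.
Proof.
have m2 : measurable_fun setT (fun x : R => (x ^+ 2)%:E).
  by apply/measurable_EFinP; exact: measurable_funX.
rewrite ge0_integral_normal//; last by move=> x; rewrite lee_fin sqr_ge0.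
pose s : R := Num.sqrt 2.
have s0 : s != 0 by rewrite gt_eqF// sqrtr_gt0.
pose c : R := 4 * normal_peak 1 / normal_peak s.
have c0 : 0 <= c by rewrite divr_ge0 ?mulr_ge0 ?normal_peak_ge0.
apply: (@le_lt_trans _ _ (\int[leb]_x (c%:E * (normal_pdf 0 s x)%:E))%E).
  apply: ge0_le_integral => //.
  - by move=> x _; rewrite -EFinM lee_fin mulr_ge0 ?sqr_ge0 ?normal_pdf_ge0.
  - apply: emeasurable_funM => //; apply/measurable_EFinP; exact: measurable_normal_pdf.
  - apply: emeasurable_funM => //; apply/measurable_EFinP; exact: measurable_normal_pdf.
  move=> x _; rewrite -!EFinM lee_fin !normal_pdfE ?oner_neq0//.
  have ps : normal_peak s != 0 by rewrite gt_eqF// normal_peak_gt0.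
  rewrite /c; set A := normal_peak 1; set B := normal_peak s.
  rewrite (_ : 4 * A / B * _ = 4 * A * normal_fun 0 s x); last by field.
  rewrite mulrCA -(mulrA 4) (mulrCA 4) ler_wpM2l ?normal_peak_ge0//.
  rewrite /normal_fun !subr0 expr1n sqr_sqrtr//.
  have h4 : (2 *+ 2 : R) = 4 by ring.
  have -> : - x ^+ 2 / (1 *+ 2) = - x ^+ 2 / (2 *+ 2) + - x ^+ 2 / (2 *+ 2) :> R.
    by rewrite h4; lra.
  rewrite expRD; set e := expR _.
  have e0 : 0 < e by exact: expR_gt0.
  have : x ^+ 2 / 4 * e <= 1.
    rewrite -ler_pdivlMr// mul1r /e -expRN; apply: le_trans (expR_ge1Dx _).
    by rewrite h4; lra.
  by rewrite !mulrA ler_pM2r//; lra.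
rewrite ge0_integralZl//.
- by rewrite integral_normal_pdf mule1 ltry.
- by apply/measurable_EFinP; exact: measurable_normal_pdf.
- by move=> x _; rewrite lee_fin normal_pdf_ge0.
Qed.

End standard_normal.

(** * Borel sets of a separable Hilbert space *)

Section hilbert.
Context {R : realType} {H : hilbertType R}.
Implicit Types (x y z h : H).

Lemma innerDr x y z : inner x (y + z) = inner x y + inner x z.
Proof. by rewrite innerC innerDl !(innerC x). Qed.

Lemma innerZr a x y : inner x (a *: y) = a * inner x y.
Proof. by rewrite innerC innerZl (innerC x). Qed.

Lemma inner0l x : inner 0 x = 0.
Proof. by rewrite -(scale0r (0 : H)) innerZl mul0r. Qed.

Lemma inner0r x : inner x 0 = 0.
Proof. by rewrite innerC inner0l. Qed.

Lemma innerBr x y z : inner x (y - z) = inner x y - inner x z.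
Proof. by rewrite innerDr -scaleN1r innerZr mulN1r. Qed.

Lemma innerBl x y z : inner (x - y) z = inner x z - inner y z.
Proof. by rewrite innerC innerBr !(innerC z). Qed.

Lemma inner_le x y : inner x y <= `|x| * `|y|.
Proof.
have [->|x0] := eqVneq x 0; first by rewrite inner0l normr0 mul0r.
have [->|y0] := eqVneq y 0; first by rewrite inner0r normr0 mulr0.
have := sqr_ge0 `|(`|y| *: x - `|x| *: y)|.
rewrite -inner_norm innerBl !innerBr !innerZl !innerZr !inner_norm (innerC y x).
set i := inner x y.
have nx : 0 < `|x| by rewrite normr_gt0.
have ny : 0 < `|y| by rewrite normr_gt0.
have nxy := mulr_gt0 nx ny.
rewrite [X in 0 <= X -> _](_ : _ = 2 * (`|x| * `|y|) * (`|x| * `|y| - i)); last by ring.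
by rewrite pmulr_rge0 ?subr_ge0// mulr_gt0.
Qed.

Lemma norm_inner_le x y : `|inner x y| <= `|x| * `|y|.
Proof.
rewrite ler_norml inner_le andbT lerNl -mulN1r -innerZl.
by apply: le_trans (inner_le _ _) _; rewrite scaleN1r normrN.
Qed.

Lemma continuous_inner h : continuous (inner h).
Proof.
move=> x; apply/cvgrPdist_le => e e0.
have h1 : 0 < `|h| + 1 by rewrite ltr_wpDl.
near=> y; rewrite -innerBr; apply: le_trans (norm_inner_le _ _) _.
apply: (@le_trans _ _ ((`|h| + 1) * `|x - y|)).
  by rewrite ler_wpM2r// lerDl.
rewrite -ler_pdivlMl//.
near: y; apply: cvgr_dist_le; first exact: cvg_id.
by rewrite mulr_gt0// invr_gt0.
Unshelve. all: by end_near.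
Qed.

Lemma separable_dense_seq : separable H ->
  exists e : nat -> H, forall x (r : R), 0 < r -> exists n, `|x - e n| < r.
Proof.
move=> [D cD dD].
have near_D x (r : R) : 0 < r -> exists2 a, D a & `|x - a| < r.
  move=> r0; have [a [xa Da]] : ball x r `&` D !=set0.
    by apply: dD; [exists x; exact: ballxx|exact: ball_open].
  by exists a => //; move: xa; rewrite -ball_normE.
move/pfcard_geP : cD => [D0|[f]].
  by have [a] := near_D 0 1 ltr01; rewrite D0.
exists f => x r r0; have [a Da xa] := near_D x r r0.
by have [n _ na] := @surj _ _ _ _ f a Da; exists n; rewrite na.
Qed.

Lemma open_normP (U : set H) x : open U -> U x ->
  exists2 r : R, 0 < r & forall y, `|x - y| < r -> U y.
Proof.
move=> oU Ux; have /nbhs_ballP[r /= r0 rU] := open_nbhs_nbhs (conj oU Ux).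
by exists r => // y xy; apply: rU; rewrite -ball_normE.
Qed.

Lemma continuous_borel_measurable (f : H -> R) : continuous f ->
  measurable_fun setT (f : borel H -> R).
Proof.
move=> /continuousP cf.
apply: (measurability _ (RGenOpens.measurableE R)) => _ [_ [a [b ->]] <-].
rewrite setTI; apply: sub_sigma_algebra; apply: cf; exact: interval_open.
Qed.

Hypothesis Hsep : separable H.

(** Separability makes the Borel sets of the product the product of the Borel sets:
    an open set is a countable union of products of balls with centers in a dense
    sequence. *)
Lemma open_prod_measurable (U : set (H * H)) : open U ->
  measurable (U : set (borel H * borel H)).
Proof.
move=> oU; have [e eP] := separable_dense_seq Hsep.
pose B (i : nat * nat * nat) : set (H * H) :=
  ball (e i.1.1) (i.2.+1%:R^-1 : R) `*` ball (e i.1.2) (i.2.+1%:R^-1 : R).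
have mB i : measurable (B i : set (borel H * borel H)).
  by apply: measurableX; apply: sub_sigma_algebra; exact: ball_open.
suff -> : U = \bigcup_i (if `[< B i `<=` U >] then B i else set0).
  apply: countable_bigcupT_measurable => // i; case: ifP => // _; exact: mB.
apply/seteqP; split=> [[x y] Uxy|p [i _]]; last first.
  by case: ifP => // /asboolP; exact.
have /nbhs_ballP[r /= r0 rU] := open_nbhs_nbhs (conj oU Uxy).
have [k _ /ltW kr] : exists2 k : nat, True & k.+1%:R^-1 < r / 2.
  exists (Num.trunc (r / 2)^-1) => //.
  by rewrite -[ltRHS]invrK ltf_pV2 ?posrE ?invr_gt0 ?divr_gt0// truncnS_gt.
have k0 : (0 : R) < k.+1%:R^-1 by rewrite invr_gt0.
have [i xi] := eP x _ k0; have [j yj] := eP y _ k0.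
exists (i, j, k) => //.
have Bxy : B (i, j, k) (x, y).
  by split; rewrite -ball_normE/= distrC.
case: ifP => // /negP; case; apply/asboolP => -[x' y'] [/=].
rewrite -!ball_normE/= => ix jy; apply: rU.
split; rewrite -ball_normE/=.
  by apply: le_lt_trans (ler_distD (e i) _ _) _; rewrite (splitr r) ltrD// (lt_le_trans _ kr).
by apply: le_lt_trans (ler_distD (e j) _ _) _; rewrite (splitr r) ltrD// (lt_le_trans _ kr).
Qed.

Lemma continuous2_borel_measurable (f : H * H -> R) : continuous f ->
  measurable_fun setT (f : borel H * borel H -> R).
Proof.
move=> /continuousP cf.
apply: (measurability _ (RGenOpens.measurableE R)) => _ [_ [a [b ->]] <-].
by rewrite setTI; apply: open_prod_measurable; apply: cf; exact: interval_open.
Qed.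

Lemma continuous2_borel_measurableH (f : H * H -> H) : continuous f ->
  measurable_fun setT (f : borel H * borel H -> borel H).
Proof.
move=> /continuousP cf.
have K := (@measurability _ _ (borel H * borel H)%type (borel H) setT f (@open H) erefl).
apply: K => _ [A oA <-].
by rewrite setTI; apply: open_prod_measurable; exact: cf.
Qed.

Definition halfspaces : set (set H) :=
  [set A | exists h c, A = [set x | 0 < inner h x + c]].

(** By Cauchy-Schwarz a ball is the intersection of the half-spaces
    <h, x - a> <= r |h|, and h may be restricted to a dense sequence. *)
Let closed_ball_halfspaces (a : H) (r : R) : 0 <= r ->
  measurable ([set x | `|x - a| <= r] : set (g_sigma_algebraType halfspaces)).
Proof.
move=> r0; have [e eP] := separable_dense_seq Hsep.
suff -> : [set x | `|x - a| <= r] =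
    \bigcap_n ~` [set x | 0 < inner (e n) x + (- inner (e n) a - r * `|e n|)].
  apply: bigcapT_measurable => n; apply: measurableC; apply: sub_sigma_algebra.
  by exists (e n), (- inner (e n) a - r * `|e n|).
apply/seteqP; split=> x /=.
  move=> xar n _ /=; apply/negP; rewrite -leNgt addrA -innerBr subr_le0.
  by apply: le_trans (inner_le _ _) _; rewrite mulrC ler_wpM2r.
move=> xn; rewrite leNgt; apply/negP => rxa.
set u := x - a in rxa.
have u0 : 0 < `|u| by exact: le_lt_trans rxa.
(* An approximation e n of u this close still separates x from the ball. *)
have eps0 : 0 < `|u| * (`|u| - r) / (2 * (`|u| + r)).
  by rewrite divr_gt0 ?mulr_gt0 ?subr_gt0// ltr_wpDr.
have [n un] := eP u _ eps0.
have := xn n I; apply; rewrite /= addrA -innerBr subr_gt0 -/u.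
have -> : e n = u - (u - e n) by rewrite opprB addrC subrK.
have dn := norm_inner_le (u - e n) u.
have := ler_normB u (u - e n).
rewrite innerBl inner_norm.
set v := u - e n in un dn *; move: un dn; rewrite ltr_pdivlMr; last by rewrite mulr_gt0// ltr_wpDr.
move=> un /ler_normlP[_ dn] uv.
apply: (@le_lt_trans _ _ (r * (`|u| + `|v|))); first by rewrite ler_wpM2l.
by nra.
Qed.

(** Hence affine functions generate the Borel sets, as
    [cos_determines_measure] requires. *)
Lemma borel_sub_halfspaces (A : set (borel H)) :
  measurable A -> <<s halfspaces >> A.
Proof.
have [e eP] := separable_dense_seq Hsep.
suff oU (U : set H) : open U -> <<s halfspaces >> U.
  by apply: smallest_sub => //; exact: sigma_algebra_bigcup.
move=> oU.
pose B (i : nat * nat) : set H := [set x | `|x - e i.1| <= i.2.+1%:R^-1].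
have mB i : measurable (B i : set (g_sigma_algebraType halfspaces)).
  by apply: closed_ball_halfspaces.
suff -> : U = \bigcup_i (if `[< B i `<=` U >] then B i else set0).
  apply: (@countable_bigcupT_measurable _ (g_sigma_algebraType halfspaces)) => // i.
  by case: ifP => // _; exact: mB.
apply/seteqP; split=> [x Ux|p [i _]]; last first.
  by case: ifP => // /asboolP; exact.
have [r r0 rU] := open_normP oU Ux.
have [k _ /ltW kr] : exists2 k : nat, True & k.+1%:R^-1 < r / 2.
  exists (Num.trunc (r / 2)^-1) => //.
  by rewrite -[ltRHS]invrK ltf_pV2 ?posrE ?invr_gt0 ?divr_gt0// truncnS_gt.
have k0 : (0 : R) < k.+1%:R^-1 by rewrite invr_gt0.
have [i xi] := eP x _ k0.
exists (i, k) => //.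
have Bx : B (i, k) x by rewrite /B/= ltW.
case: ifP => // /negP; case; apply/asboolP => y /= yi; apply: rU.
apply: le_lt_trans (ler_distD (e i) _ _) _; rewrite (distrC _ y) (splitr r).
by apply: ltr_leD; [exact: lt_le_trans xi kr|exact: le_trans yi kr].
Qed.

End hilbert.

(** * Image and product probabilities *)

Section image_prob.
Context {d1 d2} {T1 : measurableType d1} {T2 : measurableType d2} {R : realType}.
Variables (P : probability T1 R) (phi : T1 -> T2).
Hypothesis mphi : measurable_fun setT phi.

Let phi_mfun : {mfun T1 >-> T2} :=
  HB.pack phi (isMeasurableFun.Build _ _ _ _ _ mphi).

Definition image_prob : probability T2 R := distribution P phi_mfun.

Lemma image_probE A : image_prob A = P (phi @^-1` A).
Proof. by []. Qed.

Lemma ge0_integral_image_prob (f : T2 -> \bar R) : measurable_fun setT f ->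
  (forall y, 0 <= f y)%E -> (\int[image_prob]_y f y = \int[P]_x f (phi x))%E.
Proof.
move=> mf f0; rewrite [LHS](ge0_integral_pushforward (phi := phi))//.
Qed.

End image_prob.

Section prod_prob.
Context {d1 d2} {T1 : measurableType d1} {T2 : measurableType d2} {R : realType}.
Variables (P : probability T1 R) (Q : probability T2 R).

Let prodm := (P \x Q)%E.
HB.instance Definition _ := Measure.on prodm.
Let prodm_setT : prodm setT = 1%E.
Proof.
transitivity (P setT * Q setT)%E; last by rewrite !probability_setT mule1.
by rewrite /prodm -setXTT product_measure1E.
Qed.
HB.instance Definition _ := @Measure_isProbability.Build _ _ R prodm prodm_setT.

Definition prod_prob : probability (T1 * T2)%type R := prodm.

Lemma ge0_integral_prod_prob (f : T1 * T2 -> \bar R) : measurable_fun setT f ->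
  (forall p, 0 <= f p)%E ->
  (\int[prod_prob]_p f p = \int[P]_x \int[Q]_y f (x, y))%E.
Proof. by move=> mf f0; exact: fubini_tonelli1. Qed.

End prod_prob.

(** * Reversibility of the Gaussian proposal *)

(** Adding 1 makes cosines nonnegative, so that Tonelli and changes of variables
    apply to them. *)
Lemma integral_1Dcos {d} {T : measurableType d} {R : realType}
    (P : probability T R) (l : T -> R) : measurable_fun setT l ->
  (\int[P]_x (1 + cos (l x))%:E = 1 + \int[P]_x (cos (l x))%:E)%E.
Proof.
move=> ml; under eq_integral do rewrite EFinD.
rewrite integralD//.
- by rewrite integral_prob_cst.
- exact: finite_measure_integrable_cst.
- apply: (@bounded_integrable _ _ _ P (fun x => cos (l x)) 1).
    exact: (measurableT_comp (continuous_measurable_fun (@continuous_cos R)) ml).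
  by move=> x; exact: cos_max.
Qed.

Section gaussian_law.
Context {R : realType} {H : hilbertType R}.
Hypothesis Hsep : separable H.
Variable gamma : probability (borel H) R.
Hypothesis Hgamma : centered_gaussian gamma.
Notation N1 := (normal_prob (0 : R) 1).

Lemma measurable_inner (h : H) : measurable_fun setT (inner h : borel H -> R).
Proof. by apply: continuous_borel_measurable; exact: continuous_inner. Qed.

Lemma gaussian_marginal (h : H) : exists2 s : R, 0 <= s &
  forall F : R -> R, continuous F -> (forall x, 0 <= F x) ->
  (\int[gamma]_x (F (inner h x))%:E = \int[N1]_y (F (s * y))%:E)%E.
Proof.
have [s s0 gE] := Hgamma h; exists s => // F cF F0.
have mih : measurable_fun setT (inner h : borel H -> measurableTypeR R) := measurable_inner h.
have mF : measurable_fun setT (EFin \o F : measurableTypeR R -> \bar R).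
  by apply/measurable_EFinP; exact: continuous_measurable_fun.
rewrite -(ge0_integral_image_prob gamma mih mF); last first.
  by move=> y; rewrite lee_fin.
have [s_eq0|s_neq0] := eqVneq s 0.
  transitivity (\int[@dirac _ (measurableTypeR R) 0%R R]_y (EFin \o F) y)%E.
    have K := @eq_measure_integral _ _ R setT (@dirac _ (measurableTypeR R) 0 R)
      (image_prob gamma mih) (EFin \o F); apply: K => A mA _; have := gE A mA.
    rewrite s_eq0 eqxx => h0; exact: h0.
  rewrite integral_dirac// diracT mul1e s_eq0.
  under eq_integral do rewrite mul0r.
  by rewrite (integral_prob_cst N1).
transitivity (\int[normal_prob 0 s]_y (EFin \o F) y)%E.
  have K := @eq_measure_integral _ _ R setT (normal_prob 0 s) (image_prob gamma mih)
    (EFin \o F).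
  apply: K => A mA _; have := gE A mA.
  rewrite (negbTE s_neq0) => h0; exact: h0.
by apply: normal_prob_scale => //; rewrite lt_neqAle eq_sym s_neq0.
Qed.

(** The standard deviation of <h, x> under [gamma], specified by what it does to
    integrals so that the degenerate and the normal case need not be separated. *)
Definition marginal_sd (h : H) : R := xget 0 [set s | 0 <= s /\
  forall F : R -> R, continuous F -> (forall x, 0 <= F x) ->
  (\int[gamma]_x (F (inner h x))%:E = \int[N1]_y (F (s * y))%:E)%E].

Let marginal_sdP h : 0 <= marginal_sd h /\
  forall F : R -> R, continuous F -> (forall x, 0 <= F x) ->
  (\int[gamma]_x (F (inner h x))%:E = \int[N1]_y (F (marginal_sd h * y))%:E)%E.
Proof.
rewrite /marginal_sd; case: xgetP => [s _ []//|no].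
have [s s0 sE] := gaussian_marginal h.
by exfalso; apply: (no s).
Qed.

Lemma marginal_sd_ge0 (h : H) : 0 <= marginal_sd h. Proof. by case: (marginal_sdP h). Qed.

Lemma integral_marginal_sd (h : H) (F : R -> R) : continuous F -> (forall x, 0 <= F x) ->
  (\int[gamma]_x (F (inner h x))%:E = \int[N1]_y (F (marginal_sd h * y))%:E)%E.
Proof. by case: (marginal_sdP h) => _; exact. Qed.

Lemma gaussian_second_moment (h : H) :
  (\int[gamma]_x (inner h x ^+ 2)%:E = (marginal_sd h ^+ 2)%:E * \int[N1]_y (y ^+ 2)%:E)%E.
Proof.
rewrite (@integral_marginal_sd h (fun y => y ^+ 2)).
- under eq_integral do rewrite exprMn EFinM.
  rewrite (ge0_integralZl N1)//.
  + by apply/measurable_EFinP; exact: measurable_funX.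
  + by move=> x _; rewrite lee_fin sqr_ge0.
  + by rewrite lee_fin sqr_ge0.
- exact: sqr_continuous.
- by move=> x; exact: sqr_ge0.
Qed.

(** Independence: conditionally on each other both marginals are replaced by normal
    variables, whose sum is normal. *)
Lemma gaussian_pair_cos (a b : H) (c : R) :
  (\int[gamma]_x \int[gamma]_z (1 + cos (inner a x + inner b z + c))%:E =
   \int[N1]_y (1 + cos (Num.sqrt (marginal_sd a ^+ 2 + marginal_sd b ^+ 2) * y + c))%:E)%E.
Proof.
have pos y : 0 <= 1 + cos y :> R by have := cos_geN1 y; lra.
have cc (d e : R) : continuous (fun y => 1 + cos (d + e * y)).
  move=> y; apply: cvgD; first exact: cvg_cst.
  apply: (continuous_comp (f := fun y => d + e * y)); last exact: continuous_cos.
  by apply: cvgD; [exact: cvg_cst|exact: mulrl_continuous].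
transitivity (\int[gamma]_x \int[N1]_z (1 + cos (inner a x + marginal_sd b * z + c))%:E)%E.
  apply: eq_integral => x _.
  under eq_integral do rewrite addrAC -(mul1r (inner b _)).
  rewrite (@integral_marginal_sd b (fun y => 1 + cos (inner a x + c + 1 * y)))//.
  by apply: eq_integral => z _; rewrite mul1r addrAC.
have mf : measurable_fun setT (fun p : borel H * R =>
    (1 + cos (inner a p.1 + marginal_sd b * p.2 + c))%:E).
  apply/measurable_EFinP; apply: measurable_funD => //.
  apply: (measurableT_comp (continuous_measurable_fun (@continuous_cos R))).
  apply: measurable_funD => //; apply: measurable_funD.
    exact: (measurableT_comp (measurable_inner a)).
  exact: measurable_funM.
have f0 p : (0 <= (1 + cos (inner a p.1 + marginal_sd b * p.2 + c))%:E)%E.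
  by rewrite lee_fin.
rewrite (fubini_tonelli (m1 := gamma) (m2 := N1) _ mf f0)/=.
transitivity (\int[N1]_z \int[N1]_x (1 + cos (marginal_sd a * x + marginal_sd b * z + c))%:E)%E.
  apply: eq_integral => z _.
  transitivity (\int[gamma]_x (1 + cos (marginal_sd b * z + c + 1 * inner a x))%:E)%E.
    by apply: eq_integral => x _; congr (1 + cos _)%:E; rewrite /=; ring.
  rewrite (@integral_marginal_sd a (fun y => 1 + cos (marginal_sd b * z + c + 1 * y)))//.
  by apply: eq_integral => x _; congr (1 + cos _)%:E; ring.
rewrite (addrC (marginal_sd a ^+ 2)).
have cF : continuous (fun y => 1 + cos (y + c)).
  rewrite (_ : (fun y => _) = (fun y => 1 + cos (c + 1 * y))); first exact: cc.
  by apply/funext => y; rewrite mul1r (addrC c).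
have := @normal_prob_rotate _ _ _ _ (marginal_sd_ge0 b) (marginal_sd_ge0 a) cF (fun y => pos (y + c)).
move=> <-; apply: eq_integral => z _; apply: eq_integral => x _.
by rewrite (addrC (marginal_sd a * x)).
Qed.

Section rotation.
Variables (rho : R).
Hypothesis Hrho : 0 <= rho < 1.
Let sg := Num.sqrt (1 - rho ^+ 2).

Let sg2 : sg ^+ 2 = 1 - rho ^+ 2.
Proof. by rewrite sqr_sqrtr//; move: Hrho => /andP[? ?]; nra. Qed.

(** The variances of <h, x> + <k, rho x + sg z> and of <k, x> + <h, rho x + sg z>
    agree: they are values of a quadratic form, and rho ^ 2 + sg ^ 2 = 1. *)
Lemma marginal_sd_rotation (h k : H) :
  marginal_sd (h + rho *: k) ^+ 2 + marginal_sd (sg *: k) ^+ 2 =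
  marginal_sd (rho *: h + k) ^+ 2 + marginal_sd (sg *: h) ^+ 2.
Proof.
set v := (\int[N1]_y (y ^+ 2)%:E)%E.
have vfin : v \is a fin_num.
  by rewrite ge0_fin_numE ?normal_second_moment_lty ?ltW ?normal_second_moment_gt0.
have v0 : 0 < fine v by rewrite fine_gt0// normal_second_moment_gt0 normal_second_moment_lty.
have mi h' : measurable_fun setT (fun x : borel H => (inner h' x ^+ 2)%:E).
  by apply/measurable_EFinP; apply: measurable_funX; exact: measurable_inner.
have i0 h' (x : borel H) : setT x -> (0 <= (inner h' x ^+ 2)%:E)%E.
  by move=> _; rewrite lee_fin sqr_ge0.
have : (\int[gamma]_x (inner (h + rho *: k) x ^+ 2)%:E +
        \int[gamma]_x (inner (sg *: k) x ^+ 2)%:E =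
        \int[gamma]_x (inner (rho *: h + k) x ^+ 2)%:E +
        \int[gamma]_x (inner (sg *: h) x ^+ 2)%:E)%E.
  rewrite -!ge0_integralD//; try by move=> *; exact: i0; try exact: mi.
  apply: eq_integral => x _; rewrite -!EFinD; congr EFin.
  rewrite !innerDl !innerZl !exprMn sg2; ring.
rewrite !gaussian_second_moment -/v -(fineK vfin) -!EFinM -!EFinD => -[].
by rewrite -!mulrDl => /(mulIf (lt0r_neq0 v0)).
Qed.

Lemma continuous_pcn_proposal : continuous (fun p : H * H => pcn_proposal rho p.1 p.2).
Proof.
move=> p; apply: cvgD; apply: cvgZl_tmp.
  exact: cvg_fst.
exact: cvg_snd.
Qed.

Lemma measurable_pcn_proposal : measurable_fun setT
  (fun p : borel H * borel H => pcn_proposal rho p.1 p.2 : borel H).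
Proof.
by apply: (continuous2_borel_measurableH Hsep); exact: continuous_pcn_proposal.
Qed.

(** A stationary Gaussian autoregression is reversible: the pair (X, rho X + sg Z) is
    centered Gaussian and its covariance is symmetric in the two coordinates. *)
Lemma pcn_proposal_exchangeable (F : borel H * borel H -> \bar R) :
  measurable_fun setT F -> (forall p, 0 <= F p)%E ->
  (\int[gamma]_x \int[gamma]_z F (x, pcn_proposal rho x z) =
   \int[gamma]_x \int[gamma]_z F (pcn_proposal rho x z, x))%E.
Proof.
move=> mF F0.
have m1 : measurable_fun setT (fun p : borel H * borel H =>
    (p.1, pcn_proposal rho p.1 p.2) : borel H * borel H).
  by apply: measurable_fun_pair => //; exact: measurable_pcn_proposal.
have m2 : measurable_fun setT (fun p : borel H * borel H =>
    (pcn_proposal rho p.1 p.2, p.1) : borel H * borel H).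
  by apply: measurable_fun_pair => //; exact: measurable_pcn_proposal.
pose P := prod_prob gamma gamma.
suff eqP A : measurable A -> image_prob P m1 A = image_prob P m2 A.
  transitivity (\int[image_prob P m1]_p F p)%E.
    rewrite ge0_integral_image_prob// ge0_integral_prod_prob//.
    exact: (measurableT_comp mF m1).
  transitivity (\int[image_prob P m2]_p F p)%E.
    by apply: eq_measure_integral => A mA _; exact: eqP.
  rewrite ge0_integral_image_prob// ge0_integral_prod_prob//.
  exact: (measurableT_comp mF m2).
pose L : set (borel H * borel H -> R) :=
  [set l | exists h k c, l = fun p => inner h p.1 + inner k p.2 + c].
have mL l : L l -> measurable_fun setT l.
  move=> [h [k [c ->]]]; apply: measurable_funD => //; apply: measurable_funD.
    exact: (measurableT_comp (measurable_inner h)).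
  exact: (measurableT_comp (measurable_inner k)).
have La : affine_class L.
  split=> //.
  - by move=> c; exists 0, 0, c; apply/funext => p; rewrite !inner0l !add0r.
  - move=> a _ [h [k [c ->]]]; exists (a *: h), (a *: k), (a * c).
    by apply/funext => p; rewrite !innerZl; ring.
  - move=> _ _ [h [k [c ->]]] [h' [k' [c' ->]]]; exists (h + h'), (k + k'), (c + c').
    by apply/funext => p; rewrite !innerDl; ring.
apply: (cos_determines_measure La) => [{}A mA|l Ll].
  pose G := g_sigma_algebraType [set [set x | 0 < l x] | l in L].
  suff mid : measurable_fun setT (idfun : G -> (borel H * borel H)%type).
    by have := mid measurableT _ mA; rewrite setTI.
  have halfG l : L l -> measurable ([set p | 0 < l p] : set G).
    by move=> Ll; apply: sub_sigma_algebra; exists l.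
  have mG (f : G -> borel H) : (forall h c, measurable [set p | 0 < inner h (f p) + c]) ->
      measurable_fun setT f.
    move=> hf.
    have sub : @measurable _ (borel H) = <<s halfspaces >>.
      apply/seteqP; split; first exact: borel_sub_halfspaces Hsep.
      apply: smallest_sub; first exact: sigma_algebra_measurable.
      move=> _ [h [c ->]]; rewrite -[X in measurable X]setTI.
      have -> : [set x | 0 < inner h x + c] = inner h @^-1` `]- c, +oo[.
        by apply/seteqP; split=> x /=; rewrite in_itv/= andbT; lra.
      exact: (measurable_inner h).
    have K := (@measurability _ _ G (borel H) setT f halfspaces sub); apply: K.
    by move=> _ [_ [h [c ->]] <-]; rewrite setTI; exact: hf.
  apply/measurable_fun_pairP; split; apply: mG => h c.
    apply: (halfG (fun p => inner h p.1 + c)).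
    by exists h, 0, c; apply/funext => p; rewrite inner0l addr0.
  apply: (halfG (fun p => inner h p.2 + c)).
  by exists 0, h, c; apply/funext => p; rewrite inner0l add0r.
have add1I (a b : \bar R) : (1 + a = 1 + b -> a = b)%E.
  by rewrite ![(1 + _)%E]addeC => e; rewrite -(@addeK _ 1%E a)// e addeK.
apply: add1I; rewrite -!(integral_1Dcos _ (mL _ Ll)).
have m1cos : measurable_fun setT (fun p => (1 + cos (l p))%:E).
  apply/measurable_EFinP; apply: measurable_funD => //.
  exact: (measurableT_comp (continuous_measurable_fun (@continuous_cos R)) (mL _ Ll)).
have pos p : (0 <= (1 + cos (l p))%:E)%E.
  by rewrite lee_fin; have := cos_geN1 (l p); lra.
rewrite !(ge0_integral_image_prob _ _ m1cos)//.
rewrite (ge0_integral_prod_prob _ _ (measurableT_comp m1cos m1)); last by move=> p; exact: pos.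
rewrite (ge0_integral_prod_prob _ _ (measurableT_comp m1cos m2)); last by move=> p; exact: pos.
have [h [k [c lE]]] := Ll.
transitivity (\int[N1]_y (1 + cos (Num.sqrt
    (marginal_sd (h + rho *: k) ^+ 2 + marginal_sd (sg *: k) ^+ 2) * y + c))%:E)%E.
  rewrite -gaussian_pair_cos; apply: eq_integral => x _; apply: eq_integral => z _.
  rewrite lE /= /pcn_proposal innerDr !innerZr innerDl !innerZl -/sg; congr (1 + cos _)%:E.
  ring.
rewrite marginal_sd_rotation -gaussian_pair_cos.
apply: eq_integral => x _; apply: eq_integral => z _.
rewrite lE /= /pcn_proposal innerDr !innerZr innerDl !innerZl -/sg; congr (1 + cos _)%:E.
ring.
Qed.

End rotation.
End gaussian_law.

(** * Transition operators and synchronous couplings *)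

Section raw_integral.
Import HBNNSimple.

(** Integrals only see the values of the set function on measurable sets; this is
    needed for bare set functions, which is how kernels are given. *)
Lemma eq_raw_integral {d} {T : measurableType d} {R : realType}
    (m1 m2 : set T -> \bar R) (f : T -> \bar R) :
  (forall A, measurable A -> m1 A = m2 A) ->
  (\int[m1]_x f x = \int[m2]_x f x)%E.
Proof.
move=> m12; rewrite /integral.
have e (h : {nnsfun T >-> R}) : sintegral m1 h = sintegral m2 h.
  rewrite /sintegral; apply: eq_fsbigr => r _; congr (_ * _)%E.
  by rewrite m12.
by congr (ereal_sup _ - ereal_sup _)%E; apply/seteqP; split=> y [h hf <-];
  exists h => //; rewrite e.
Qed.

End raw_integral.

Section transition_operator.
Context {d1 d2} {T : measurableType d1} {W : measurableType d2} {R : realType}.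
Variables (nu : probability W R) (phi : T * W -> T).
Hypothesis mphi : measurable_fun setT phi.
Local Open Scope ereal_scope.
Implicit Types (F G : T -> \bar R).

(** The Markov operator of the chain x |-> phi (x, w) with noise w of law [nu].  Its
    iterates on functions replace the iterated kernels throughout. *)
Definition transition F (x : T) : \bar R := \int[nu]_w F (phi (x, w)).

Lemma transition_ge0 F x : (forall y, 0 <= F y) -> 0 <= transition F x.
Proof. by move=> F0; exact: integral_ge0. Qed.

Lemma measurable_transition F : measurable_fun setT F -> (forall y, 0 <= F y) ->
  measurable_fun setT (transition F).
Proof.
move=> mF F0; apply: (measurable_fun_fubini_tonelli_F (m2 := nu) (F \o phi)).
  exact: measurableT_comp mF mphi.
by move=> p; exact: F0.
Qed.

Let measurable_section F x : measurable_fun setT F ->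
  measurable_fun setT (fun w => F (phi (x, w))).
Proof.
move=> mF; apply: (measurableT_comp mF); apply: (measurableT_comp mphi).
exact: pair1_measurable.
Qed.

Lemma le_transition F G x : measurable_fun setT F -> measurable_fun setT G ->
  (forall y, 0 <= F y) -> (forall y, F y <= G y) ->
  transition F x <= transition G x.
Proof.
move=> mF mG F0 FG; apply: ge0_le_integral => //.
- exact: measurable_section.
- exact: measurable_section.
Qed.

Lemma transitionD F G x : measurable_fun setT F -> measurable_fun setT G ->
  (forall y, 0 <= F y) -> (forall y, 0 <= G y) ->
  transition (fun y => F y + G y) x = transition F x + transition G x.
Proof.
move=> mF mG F0 G0; rewrite /transition ge0_integralD//; exact: measurable_section.
Qed.

Lemma transitionZ F (a : R) x : measurable_fun setT F -> (forall y, 0 <= F y) ->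
  (0 <= a)%R -> transition (fun y => a%:E * F y) x = a%:E * transition F x.
Proof.
move=> mF F0 a0; rewrite /transition ge0_integralZl//; exact: measurable_section.
Qed.

Lemma transition_cst (c : \bar R) x : transition (fun=> c) x = c.
Proof. exact: integral_prob_cst. Qed.

Lemma iter_transition_ge0 n F x : (forall y, 0 <= F y) ->
  0 <= iter n transition F x.
Proof. by elim: n x => //= n IH x F0; apply: transition_ge0 => y; exact: IH. Qed.

Lemma measurable_iter_transition n F : measurable_fun setT F ->
  (forall y, 0 <= F y) -> measurable_fun setT (iter n transition F).
Proof.
move=> mF F0; elim: n => //= n IH; apply: measurable_transition => // y.
exact: iter_transition_ge0.
Qed.

Lemma le_iter_transition n F G x : measurable_fun setT F -> measurable_fun setT G ->
  (forall y, 0 <= F y) -> (forall y, F y <= G y) ->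
  iter n transition F x <= iter n transition G x.
Proof.
move=> mF mG F0 FG; elim: n x => //= n IH x.
by apply: le_transition => //; [exact: measurable_iter_transition|
  apply: measurable_iter_transition => // y; exact: le_trans (F0 y) (FG y)|
  move=> y; exact: iter_transition_ge0].
Qed.

Lemma kernel_iter_transition (K : T -> set T -> \bar R) n x A :
  (forall x A, measurable A -> K x A = transition (fun y => (\1_A y)%:E) x) ->
  measurable A ->
  kernel_iter K n x A = iter n transition (fun y => (\1_A y)%:E) x.
Proof.
move=> KE mA.
have m1A : measurable_fun setT (fun y : T => (\1_A y)%:E : \bar R).
  exact/measurable_EFinP/measurable_indic.
have A0 y : 0 <= (\1_A y)%:E :> \bar R by rewrite lee_fin.
elim: n x => [x|n IH x] //=.
have mx : measurable_fun setT (fun w => phi (x, w)).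
  by apply: (measurableT_comp mphi); exact: pair1_measurable.
rewrite (eq_raw_integral (m2 := image_prob nu mx)).
  under eq_integral do rewrite IH.
  rewrite ge0_integral_image_prob//; first exact: measurable_iter_transition.
  by move=> y; exact: iter_transition_ge0.
move=> B mB; rewrite KE// image_probE /transition.
transitivity (\int[nu]_w (\1_((fun w => phi (x, w)) @^-1` B) w)%:E) => //.
rewrite integral_indic ?setIT//.
by have := mx measurableT _ mB; rewrite setTI.
Qed.

(** The law after [n] steps, as a probability measure: couplings have to be
    exhibited as such. *)
Fixpoint chain_law (n : nat) (mu : probability T R) : probability T R :=
  if n is m.+1 then image_prob (prod_prob (chain_law m mu) nu) mphi else mu.

Lemma integral_chain_law n (mu : probability T R) F : measurable_fun setT F ->
  (forall y, 0 <= F y) ->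
  \int[chain_law n mu]_y F y = \int[mu]_y iter n transition F y.
Proof.
elim: n F => //= n IH F mF F0.
rewrite ge0_integral_image_prob// ge0_integral_prod_prob//.
- rewrite [LHS]IH//; last by move=> y; exact: transition_ge0.
    by apply: eq_integral => y _; rewrite -iterS iterSr.
  exact: measurable_transition.
- exact: measurableT_comp.
Qed.

Lemma invariant_transition (mu : probability T R) n F :
  (forall A, measurable A -> \int[mu]_x transition (fun y => (\1_A y)%:E) x = mu A) ->
  measurable_fun setT F -> (forall y, 0 <= F y) ->
  \int[mu]_x iter n transition F x = \int[mu]_x F x.
Proof.
move=> inv; elim: n F => //= n IH F mF F0.
rewrite -iterS iterSr IH//; [|exact: measurable_transition|
  by move=> y; exact: transition_ge0].
rewrite -(integral_chain_law 1)//.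
apply: eq_measure_integral => A mA _.
transitivity (\int[chain_law 1 mu]_y (\1_A y)%:E).
  by rewrite integral_indic// setIT.
rewrite integral_chain_law; [exact: inv|exact/measurable_EFinP/measurable_indic|].
by move=> y; rewrite lee_fin.
Qed.

End transition_operator.

Section synchronous_coupling.
Context {d1 d2} {T : measurableType d1} {W : measurableType d2} {R : realType}.
Variables (nu : probability W R) (phi : T * W -> T).
Hypothesis mphi : measurable_fun setT phi.
Local Open Scope ereal_scope.

Definition paired (q : (T * T) * W) : T * T :=
  (phi (q.1.1, q.2), phi (q.1.2, q.2)).

Lemma measurable_paired : measurable_fun setT paired.
Proof.
apply: measurable_fun_pair; apply: (measurableT_comp mphi);
  apply: measurable_fun_pair => //; apply: measurableT_comp => //.
Qed.

Lemma iter_paired_fst n (F : T -> \bar R) p :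
  iter n (transition nu paired) (F \o fst) p = iter n (transition nu phi) F p.1.
Proof.
elim: n p => //= n IH p; rewrite /transition.
by under eq_integral do rewrite IH.
Qed.

Lemma iter_paired_snd n (F : T -> \bar R) p :
  iter n (transition nu paired) (F \o snd) p = iter n (transition nu phi) F p.2.
Proof.
elim: n p => //= n IH p; rewrite /transition.
by under eq_integral do rewrite IH.
Qed.

(** The coupling started from the product of the point mass at [x] and [pi]: each
    coordinate moves as the chain itself, and the second one stays distributed as
    [pi]. *)
Lemma wasserstein_le_paired (K : T -> set T -> \bar R) (pi : probability T R)
    (c : T -> T -> R) n x :
  (forall x A, measurable A -> K x A = transition nu phi (fun y => (\1_A y)%:E) x) ->
  Defs.invariant K pi ->
  measurable_fun setT (fun p : T * T => c p.1 p.2) -> (forall x y, 0 <= c x y)%R ->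
  wasserstein c (kernel_iter K n x) pi <=
  \int[pi]_y iter n (transition nu paired) (fun p => (c p.1 p.2)%:E) (x, y).
Proof.
move=> KE inv mc c0.
have mx : measurable_fun setT (fun y : T => (x, y)) by exact: pair1_measurable.
pose lam := chain_law nu measurable_paired n (image_prob pi mx).
have lamE (F : T * T -> \bar R) : measurable_fun setT F -> (forall p, 0 <= F p) ->
    \int[lam]_p F p = \int[pi]_y iter n (transition nu paired) F (x, y).
  move=> mF F0; rewrite integral_chain_law// ge0_integral_image_prob//.
    exact: (measurable_iter_transition nu measurable_paired n mF F0).
  by move=> p; exact: iter_transition_ge0.
rewrite -lamE; [|exact/measurable_EFinP|by move=> p; rewrite lee_fin].
apply: ereal_inf_lbound; exists lam => // A mA.
have A0 (y : T) : 0 <= (\1_A y)%:E :> \bar R by rewrite lee_fin.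
have m1A : measurable_fun setT (fun y : T => (\1_A y)%:E : \bar R).
  exact/measurable_EFinP/measurable_indic.
have inv' B : measurable B -> \int[pi]_y transition nu phi (fun y => (\1_B y)%:E) y = pi B.
  by move=> mB; rewrite -inv//; apply: eq_integral => y _; rewrite KE.
split.
- transitivity (\int[lam]_p ((fun y => (\1_A y)%:E) \o fst) p).
    rewrite -[in LHS](setIT (A `*` setT)) -integral_indic//; last exact: measurableX.
    by apply: eq_integral => p _; rewrite /= !indicE in_setX in_setT andbT.
  rewrite lamE; [|exact: (measurableT_comp m1A measurable_fst)|by move=> p; exact: A0].
  under eq_integral do rewrite iter_paired_fst.
  rewrite /= (integral_prob_cst pi).
  by rewrite (kernel_iter_transition mphi n x KE mA).
- transitivity (\int[lam]_p ((fun y => (\1_A y)%:E) \o snd) p).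
    rewrite -[in LHS](setIT (setT `*` A)) -integral_indic//; last exact: measurableX.
    by apply: eq_integral => p _; rewrite /= !indicE in_setX in_setT.
  rewrite lamE; [|exact: (measurableT_comp m1A measurable_snd)|by move=> p; exact: A0].
  under eq_integral do rewrite iter_paired_snd/=.
  by rewrite (invariant_transition mphi n inv')// integral_indic// setIT.
Qed.

End synchronous_coupling.

(** * Averaging over a uniform threshold *)

Section uniform_threshold.
Context {R : realType}.
Definition unif01 : probability (measurableTypeR R) R := uniform_prob (@ltr01 R).
Notation U := unif01.
Local Open Scope ereal_scope.

Let measurable_le (a : R) : measurable [set u : measurableTypeR R | ((u : R) <= a)%R].
Proof.
by rewrite (_ : [set u | _] = `]-oo, a]%classic)//; apply/seteqP; split=> u /=; rewrite in_itv.
Qed.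

Lemma uniform_prob_le (a : R) : (0 <= a <= 1)%R ->
  U [set u : measurableTypeR R | ((u : R) <= a)%R] = a%:E.
Proof.
move=> /andP[a0 a1].
have mA := measurable_le a.
rewrite -[X in U X]setIT -integral_indic// integral_uniform//; last first.
  exact/measurable_EFinP/measurable_indic.
rewrite subr0 invr1 mul1e integral_indic//=.
rewrite (_ : _ `&` _ = `[0%R, a]%classic).
  rewrite lebesgue_measure_itv/= lte_fin; case: ltP => [_|a0'].
    by rewrite -EFinB subr0.
  by congr EFin; apply/le_anti; rewrite a0.
apply/seteqP; split=> u /=; rewrite !in_itv/=.
  by move=> [ua /andP[-> _]].
by move=> /andP[-> ua]; rewrite (le_trans ua).
Qed.

(** One uniform variable drives both acceptance decisions: below the smaller
    probability both copies accept, between the two exactly one, above none. *)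
Lemma integral_uniform_threshold2 (m M : R) (a b c : \bar R) :
  (0 <= m)%R -> (m <= M)%R -> (M <= 1)%R -> 0 <= a -> 0 <= b -> 0 <= c ->
  \int[U]_u (if (u <= m)%R then a else if (u <= M)%R then b else c) =
  m%:E * a + ((M - m)%:E * b + (1 - M)%:E * c).
Proof.
move=> m0 mM M1 a0 b0 c0.
set h := fun u : R => _.
pose A := [set u : measurableTypeR R | ((u : R) <= m)%R].
pose B := [set u : measurableTypeR R | ((u : R) <= M)%R].
have AB : A `<=` B by move=> u /= um; exact: le_trans um mM.
have UA : U A = m%:E by rewrite uniform_prob_le// m0 (le_trans mM).
have UB : U B = M%:E by rewrite uniform_prob_le// M1 (le_trans m0).
have mA : measurable A by exact: measurable_le.
have mB : measurable B by exact: measurable_le.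
have mBA : measurable (B `\` A) by exact: measurableD.
have mBC : measurable (~` B) by exact: measurableC.
have UBA : U (B `\` A) = (M - m)%:E.
  rewrite measureD//=; last by rewrite UB ltry.
  by rewrite UB (setIidr AB) UA.
have UBC : U (~` B) = (1 - M)%:E by rewrite probability_setC// UB.
have mh : measurable_fun setT h.
  rewrite /h; apply: measurable_fun_ifT => //; first exact: measurable_fun_ler.
  by apply: measurable_fun_ifT => //; exact: measurable_fun_ler.
have h0 u : 0 <= h u by rewrite /h; case: ifP => // _; case: ifP.
have TE : [set: R] = A `|` ((B `\` A) `|` ~` B).
  by rewrite setUA setDUK// setUv.
have mU : measurable ((B `\` A) `|` ~` B) by exact: measurableU.
have mhS (S : set (measurableTypeR R)) : measurable_fun S h by exact: measurable_funS mh.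
have d1 : [disjoint A & ((B `\` A) `|` ~` B)].
  apply/disj_set2P/seteqP; split=> u //= -[uA [[_]|]] //.
  by apply; exact: AB.
have d2 : [disjoint (B `\` A) & ~` B].
  by apply/disj_set2P/seteqP; split=> u //= -[[]].
rewrite TE (ge0_integral_setU _ mA mU (mhS _) _ d1)//.
rewrite (ge0_integral_setU _ mBA mBC (mhS _) _ d2)//.
congr (_ + (_ + _)).
- rewrite (eq_integral (cst a)); first by rewrite -UA muleC; exact: integral_cst.
  by move=> u; rewrite inE /h => /= ->.
- rewrite (eq_integral (cst b)); first by rewrite -UBA muleC; exact: integral_cst.
  by move=> u; rewrite inE /h => /= -[-> /negP/negbTE ->].
- rewrite (eq_integral (cst c)); first by rewrite -UBC muleC; exact: integral_cst.
  move=> u; rewrite inE /h => /= /negP/negbTE uB; rewrite uB; case: ifP => // um.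
  by move: uB; rewrite (le_trans um).
Qed.

Lemma integral_uniform_threshold (m : R) (a b : \bar R) :
  (0 <= m <= 1)%R -> 0 <= a -> 0 <= b ->
  \int[U]_u (if (u <= m)%R then a else b) = m%:E * a + (1 - m)%:E * b.
Proof.
move=> /andP[m0 m1] a0 b0.
rewrite -[RHS](_ : m%:E * a + ((m - m)%:E * b + (1 - m)%:E * b) = _).
  rewrite -integral_uniform_threshold2//; apply: eq_integral => u _.
  by case: ifP.
by rewrite subrr mul0e add0e.
Qed.

End uniform_threshold.

(** * The pCN chain and its invariant measure *)

Section integral_setT.
Context {d} {T : measurableType d} {R : realType} (mu : {measure set T -> \bar R}).
Local Open Scope ereal_scope.
Implicit Types f g : T -> \bar R.

Lemma integralTD f g : measurable_fun setT f -> measurable_fun setT g ->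
  (forall x, 0 <= f x) -> (forall x, 0 <= g x) ->
  \int[mu]_x (f x + g x) = \int[mu]_x f x + \int[mu]_x g x.
Proof. by move=> mf mg f0 g0; rewrite ge0_integralD. Qed.

Lemma integralTZ (a : \bar R) f : measurable_fun setT f -> (forall x, 0 <= f x) ->
  0 <= a -> \int[mu]_x (a * f x) = a * \int[mu]_x f x.
Proof. by move=> mf f0 a0; rewrite ge0_integralZl. Qed.

Lemma le_integralT f g : measurable_fun setT f -> measurable_fun setT g ->
  (forall x, 0 <= f x) -> (forall x, f x <= g x) ->
  \int[mu]_x f x <= \int[mu]_x g x.
Proof. by move=> mf mg f0 fg; exact: ge0_le_integral. Qed.

End integral_setT.

Section pcn_chain.
Context {R : realType} {H : hilbertType R}.
Hypothesis Hsep : separable H.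
Variable gamma : probability (borel H) R.
Variables (g : H -> R) (rho : R).
Hypothesis mg : measurable_fun setT (g : borel H -> R).
Local Open Scope ereal_scope.
Local Notation prop := (@pcn_proposal R H rho).
Local Notation acc := (@pcn_accept R H g).

Definition pcn_noise : probability (borel H * measurableTypeR R)%type R :=
  prod_prob gamma unif01.

Definition pcn_step (q : borel H * (borel H * measurableTypeR R)) : borel H :=
  if ((q.2.2 : R) <= acc q.1 (prop q.1 q.2.1))%R then prop q.1 q.2.1 else q.1.

Lemma accept01 x y : (0 <= acc x y <= 1)%R.
Proof. by rewrite /pcn_accept le_min ler01 expR_ge0/= ge_min lexx. Qed.

Lemma accept_ge0 x y : (0 <= acc x y)%R. Proof. by case/andP: (accept01 x y). Qed.
Lemma accept_le1 x y : (acc x y <= 1)%R. Proof. by case/andP: (accept01 x y). Qed.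

Lemma measurable_accept :
  measurable_fun setT (fun p : borel H * borel H => acc p.1 (prop p.1 p.2)).
Proof.
apply: measurable_minr => //; apply: measurableT_comp => //.
apply: measurable_funB; first exact: (measurableT_comp mg measurable_fst).
exact: (measurableT_comp mg (measurable_pcn_proposal Hsep rho)).
Qed.

Let mprop3 : measurable_fun setT
  (fun q : borel H * (borel H * measurableTypeR R) => prop q.1 q.2.1 : borel H).
Proof.
apply: (measurableT_comp (measurable_pcn_proposal Hsep rho)
  (g := fun q : borel H * (borel H * measurableTypeR R) => (q.1, q.2.1))).
apply: measurable_fun_pair => //.
exact: (measurableT_comp measurable_fst measurable_snd).
Qed.

Lemma measurable_pcn_step : measurable_fun setT pcn_step.
Proof.
apply: measurable_fun_ifT; [|exact: mprop3|exact: measurable_fst].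
apply: measurable_fun_ler.
  exact: (measurableT_comp measurable_snd measurable_snd).
apply: (measurableT_comp measurable_accept
  (g := fun q : borel H * (borel H * measurableTypeR R) => (q.1, q.2.1))).
apply: measurable_fun_pair => //.
exact: (measurableT_comp measurable_fst measurable_snd).
Qed.

Local Notation P := (transition pcn_noise pcn_step).

Lemma transition_pcnE (F : borel H -> \bar R) x : measurable_fun setT F ->
  (forall y, 0 <= F y) ->
  P F x = \int[gamma]_z ((acc x (prop x z))%:E * F (prop x z) +
    (1 - acc x (prop x z))%:E * F x).
Proof.
move=> mF F0; rewrite /transition ge0_integral_prod_prob//.
  apply: eq_integral => z _ /=.
  rewrite -(integral_uniform_threshold (accept01 x (prop x z)))//.
  by apply: eq_integral => u _; rewrite /pcn_step/=; case: ifP.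
apply: (measurableT_comp mF); apply: (measurableT_comp measurable_pcn_step).
exact: pair1_measurable.
Qed.

Let mprop (x : borel H) : measurable_fun setT (fun z : borel H => prop x z : borel H).
Proof.
exact: (measurableT_comp (measurable_pcn_proposal Hsep rho) (pair1_measurable x)).
Qed.

Let macc (x : borel H) : measurable_fun setT (fun z : borel H => acc x (prop x z)).
Proof. exact: (measurableT_comp measurable_accept (pair1_measurable x)). Qed.

(** Integrating out the uniform threshold turns the accept/reject rule into the two
    terms of the kernel. *)
Lemma pcn_transition x (A : set (borel H)) : measurable A ->
  pcn gamma g rho x A = P (fun y => (\1_A y)%:E) x.
Proof.
move=> mA.
have m1A : measurable_fun setT (fun y : borel H => (\1_A y)%:E : \bar R).
  exact/measurable_EFinP/measurable_indic.
rewrite transition_pcnE//.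
have m1 : measurable_fun setT (fun z : borel H =>
    (acc x (prop x z))%:E * (\1_A (prop x z))%:E).
  apply: emeasurable_funM; first exact/measurable_EFinP.
  exact: (measurableT_comp m1A (mprop x)).
have m2 : measurable_fun setT (fun z : borel H => (1 - acc x (prop x z))%:E).
  by apply/measurable_EFinP; apply: measurable_funB.
rewrite ge0_integralD//.
- rewrite /pcn; congr (_ + _).
  transitivity ((\1_A x)%:E * \int[gamma]_z (1 - acc x (prop x z))%:E) => //.
  rewrite -integralTZ//; last by move=> z; rewrite lee_fin subr_ge0 accept_le1.
  by apply: eq_integral => z _; rewrite muleC.
- by move=> z _; rewrite mule_ge0// lee_fin accept_ge0.
- by move=> z _; rewrite mule_ge0// lee_fin// subr_ge0 accept_le1.
- by apply: emeasurable_funM.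
Qed.

(** Both sides are the minimum of exp (- g x) and exp (- g y). *)
Lemma accept_balance x y :
  (expR (- g x) * acc x y = expR (- g y) * acc y x)%R.
Proof.
have e x' y' : (expR (- g x') * acc x' y' = Num.min (expR (- g x')) (expR (- g y')))%R.
  by rewrite /pcn_accept minr_pMr ?expR_ge0// mulr1 -expRD; congr (Num.min _ (expR _)); ring.
by rewrite !e minC.
Qed.

Hypothesis Hgamma : centered_gaussian gamma.
Hypothesis Hrho : (0 <= rho < 1)%R.
Variable pi : probability (borel H) R.
Hypothesis Hpi : gibbs gamma g pi.

(** Metropolis-Hastings: the proposal is reversible for [gamma] and the acceptance
    ratio symmetrises the density of [pi], so [pi] is reversible. *)
Lemma pcn_invariant : Defs.invariant (pcn gamma g rho) pi.
Proof.
move=> A mA; have [c c0 piE] := Hpi.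
pose p x := (c * expR (- g x))%R.
have p0 x : (0 <= p x)%R by rewrite mulr_ge0 ?expR_ge0// ltW.
have mp : measurable_fun setT (p : borel H -> R).
  apply: measurable_funM => //; apply: measurableT_comp => //.
  exact: measurable_funN.
have nuE B : measurable B -> pi B = \int[gamma]_(x in B) (p x)%:E.
  move=> mB; rewrite piE// -ge0_integralZl//.
  - apply/measurable_EFinP; apply: measurable_funTS; apply: measurableT_comp => //.
    exact: measurable_funN.
  - by rewrite lee_fin ltW.
have dens := ge0_integral_density mp p0 nuE.
have m1A : measurable_fun setT (fun y : borel H => (\1_A y)%:E : \bar R).
  exact/measurable_EFinP/measurable_indic.
have A0 (y : borel H) : 0 <= (\1_A y)%:E :> \bar R by rewrite lee_fin.
under eq_integral do rewrite pcn_transition//.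
rewrite dens; [|exact: (measurable_transition pcn_noise measurable_pcn_step m1A A0)|
  by move=> x; exact: transition_ge0].
pose F (q : borel H * borel H) := (p q.1 * acc q.1 q.2 * \1_A q.2)%:E.
pose G (q : borel H * borel H) := (p q.1 * (1 - acc q.1 (prop q.1 q.2)) * \1_A q.1)%:E.
have F0 q : 0 <= F q by rewrite lee_fin mulr_ge0// mulr_ge0// accept_ge0.
have G0 q : 0 <= G q by rewrite lee_fin mulr_ge0// mulr_ge0// subr_ge0 accept_le1.
have mi : measurable_fun setT (fun y : borel H => \1_A y : R) by exact: measurable_indic.
have mp1 : measurable_fun setT (fun q : borel H * borel H => p q.1).
  exact: (measurableT_comp mp measurable_fst).
have m1A1 : measurable_fun setT (fun q : borel H * borel H => \1_A q.1 : R).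
  exact: (measurableT_comp mi measurable_fst).
have mF : measurable_fun setT F.
  apply/measurable_EFinP; apply: measurable_funM; last first.
    exact: (measurableT_comp mi measurable_snd).
  apply: measurable_funM => //; apply: measurable_minr => //.
  apply: measurableT_comp => //; apply: measurable_funB.
    exact: (measurableT_comp mg measurable_fst).
  exact: (measurableT_comp mg measurable_snd).
have mG : measurable_fun setT G.
  apply/measurable_EFinP; apply: measurable_funM => //; apply: measurable_funM => //.
  by apply: measurable_funB => //; exact: measurable_accept.
have mpair : measurable_fun setT (fun q : borel H * borel H => (q.1, prop q.1 q.2) : borel H * borel H).
  by apply: measurable_fun_pair => //; exact: measurable_pcn_proposal.
have mF' : measurable_fun setT (fun q : borel H * borel H => F (q.1, prop q.1 q.2)).
  exact: (measurableT_comp mF mpair).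
have msec (K : borel H * borel H -> \bar R) x : measurable_fun setT K ->
    measurable_fun setT (fun z => K (x, z)).
  by move=> mK; exact: (measurableT_comp mK (pair1_measurable x)).
have mint (K : borel H * borel H -> \bar R) : measurable_fun setT K -> (forall q, 0 <= K q) ->
    measurable_fun setT (fun x => \int[gamma]_z K (x, z)).
  by move=> mK K0; exact: (measurable_fun_fubini_tonelli_F (m2 := gamma) K).
have int0 (K : borel H * borel H -> \bar R) x : (forall q, 0 <= K q) ->
    0 <= \int[gamma]_z K (x, z) by move=> K0; exact: integral_ge0.
have swap2 (K : borel H * borel H -> \bar R) : (forall q, 0 <= K q) ->
    forall q, 0 <= K (q.1, prop q.1 q.2) by [].
transitivity (\int[gamma]_x (\int[gamma]_z F (x, prop x z) + \int[gamma]_z G (x, z))).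
  apply: eq_integral => x _; rewrite transition_pcnE//.
  rewrite muleC -integralTZ ?lee_fin//; last 2 first.
  - apply: emeasurable_funD; apply: emeasurable_funM => //.
    + exact/measurable_EFinP.
    + exact: (measurableT_comp m1A (mprop x)).
    + by apply/measurable_EFinP; apply: measurable_funB.
  - by move=> z; rewrite -!EFinM -EFinD lee_fin addr_ge0// mulr_ge0 ?accept_ge0 ?subr_ge0 ?accept_le1.
  rewrite -integralTD//; [|exact: (msec _ _ mF')|exact: msec].
  by apply: eq_integral => z _; rewrite /F /G -!(EFinM, EFinD); congr EFin; rewrite /=; ring.
have mF2 : measurable_fun setT (fun q : borel H * borel H => F (prop q.1 q.2, q.1)).
  apply: (measurableT_comp mF); apply: measurable_fun_pair => //.
  exact: measurable_pcn_proposal.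
rewrite integralTD; [|exact: (mint _ mF')|exact: mint|
  by move=> x; exact: (int0 _ _ (swap2 _ F0))|by move=> x; exact: int0].
rewrite (pcn_proposal_exchangeable Hsep Hgamma Hrho mF F0).
rewrite -integralTD; [|exact: (mint _ mF2)|exact: mint|
  by move=> x; exact: integral_ge0|by move=> x; exact: int0].
rewrite nuE// [RHS]integral_mkcond; apply: eq_integral => x _.
rewrite -integralTD; [|exact: (msec _ _ mF2)|exact: msec| |]; [|by []..].
rewrite -[RHS](@integral_prob_cst _ _ _ gamma); apply: eq_integral => z _.
rewrite /F/G -EFinD patchE/=.
have := accept_balance x (prop x z).
rewrite /p indicE => bal.
transitivity ((c * expR (- g x) * (x \in A)%:R)%:E).
  congr EFin; rewrite -(mulrA c (expR (- g (prop x z)))) -bal; ring.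
by case: ifP; rewrite ?mulr1 ?mulr0.
Qed.

End pcn_chain.

(** * Pointwise estimates for one step *)

Section real_estimates.
Context {R : realType}.
Implicit Types (a b r s t x y z D : R).

Lemma accept_ratio a b D : `|a - b| <= D ->
  Num.max (Num.min 1 (expR a)) (Num.min 1 (expR b)) <=
  expR D * Num.min (Num.min 1 (expR a)) (Num.min 1 (expR b)).
Proof.
wlog ab : a b / b <= a.
  move=> wl; have [/wl//|/ltW ba] := leP b a.
  by rewrite distrC => /(wl _ _ ba); rewrite maxC (minC (Num.min 1 (expR b))); exact.
rewrite ger0_norm ?subr_ge0// => abD.
have m : Num.min 1 (expR b) <= Num.min 1 (expR a).
  by rewrite le_min ge_min lexx/= ge_min ler_expR ab orbT.
rewrite (max_idPl m) (min_idPr m).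
have D1 : 1 <= expR D by rewrite -expR0 ler_expR; lra.
rewrite minr_pMr ?expR_ge0// mulr1 -expRD le_min !ge_min D1/= ler_expR.
by apply/orP; right; lra.
Qed.

Lemma one_sub_expRN_le x : 1 - expR (- x) <= x.
Proof. by have := expR_ge1Dx (- x); lra. Qed.

(** Why 1 - exp (- A t) is the right concave distortion: when only one of the two
    chains moves the pair may be thrown arbitrarily far, at cost at most
    exp (- A t); the joint moves gain exp (- A q t) - exp (- A t), and the
    ratio of the two probabilities is at most exp (C t) - 1. *)
Lemma coupled_step_contracts A C q T t m M :
  0 < C -> q < 1 -> A * (1 - q) = 2 * C -> 0 <= t <= T ->
  0 <= m -> M <= expR (C * t) * m ->
  (1 - expR (- (A * (q * t)))) * m + ((M - m) + (1 - expR (- (A * t))) * (1 - M))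
  <= (1 - expR (- (A * t))) * (1 - C / A * expR (- (A * T)) * m).
Proof.
move=> C0 q1 Aq /andP[t0 tT] m0 Mm.
have A0 : 0 < A by rewrite -(@pmulr_lgt0 _ (1 - q)) ?subr_gt0// Aq mulr_gt0.
set h := expR (- (A * t)).
have h0 : 0 < h by exact: expR_gt0.
set e := expR (C * t) in Mm *.
have e_ge : 1 + C * t <= e by exact: expR_ge1Dx.
have Ct : 0 <= C * t by rewrite mulr_ge0// ltW.
have hq : expR (- (A * (q * t))) = h * e ^+ 2.
  rewrite /h /e expr2 -!expRD; congr expR.
  have : A * (1 - q) * t = 2 * C * t by rewrite Aq.
  by lra.
have hT : expR (- (A * T)) <= h by rewrite ler_expR lerN2 ler_pM2l.
have f_le : 1 - h <= A * t by exact: one_sub_expRN_le.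
set k := expR (- (A * T)) in hT *.
have k0 : 0 < k by exact: expR_gt0.
have key : C / A * k * (1 - h) <= h * (e ^+ 2 - e).
  apply: (@le_trans _ _ (C * t * k)).
    rewrite (_ : C * t * k = C / A * k * (A * t)); last by field; rewrite gt_eqF.
    by rewrite ler_wpM2l// mulr_ge0 ?divr_ge0// ltW.
  apply: (@le_trans _ _ (C * t * h)); first by rewrite ler_wpM2l.
  by rewrite mulrC ler_pM2l//; nra.
rewrite hq.
have hM : h * M <= h * (e * m) by rewrite ler_pM2l.
have := ler_wpM2r m0 key; lra.
Qed.

(** An accepted move from radius r to v <= rho r + zeta either does not increase the
    norm, or satisfies v <= zeta / (1 - rho), in which case the constant
    (1 - rho) ^ 2 theta / 16 in the exponent bounds the new value by
    exp (theta zeta ^ 2 / 16).  For moderate noise zeta <= K and r >= R1 the value is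
    even halved, which is where the decrease comes from. *)
Lemma drift_pointwise rho theta s K R1 r v zeta al alr :
  0 <= rho < 1 -> 0 < s -> s <= (1 - rho) ^+ 2 * theta / 16 -> 0 <= theta ->
  (forall u, R1 <= u -> expR (s * (rho * u + K) ^+ 2) <= expR (s * u ^+ 2) / 2) ->
  0 <= r -> 0 <= v -> v <= rho * r + zeta -> 0 <= zeta -> 0 <= R1 ->
  0 <= al <= 1 -> 0 <= alr <= 1 -> (zeta <= K -> alr <= al) ->
  al * expR (s * v ^+ 2) + (1 - al) * expR (s * r ^+ 2) <=
  (if zeta <= K then expR (s * r ^+ 2) * (1 - alr / 2) else expR (s * r ^+ 2)) +
  (expR (s * R1 ^+ 2) + expR (theta / 16 * zeta ^+ 2)).
Proof.
move=> /andP[rho0 rho1] s0 s_le th0 HR1 r0 v0 v_le z0 R10 /andP[al0 al1] /andP[alr0 alr1] al_ge.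
set V := expR (s * r ^+ 2); set E := expR (theta / 16 * zeta ^+ 2).
set V1 := expR (s * R1 ^+ 2); set W := expR (s * v ^+ 2).
have [V0 E0 V10 W0] : [/\ 0 < V, 0 < E, 0 < V1 & 0 < W] by split; exact: expR_gt0.
have WE : W <= V + E.
  have [vr|rv] := leP v r.
    have : W <= V by rewrite ler_expR ler_pM2l// lerXn2r.
    lra.
  suff : W <= E by lra.
  rewrite ler_expR.
  have vz : (1 - rho) * v <= zeta.
    have : rho * r <= rho * v by rewrite ler_wpM2l// ltW.
    lra.
  apply: (@le_trans _ _ ((1 - rho) ^+ 2 * theta / 16 * v ^+ 2)).
    by rewrite ler_wpM2r// sqr_ge0.
  rewrite (_ : _ * v ^+ 2 = theta / 16 * ((1 - rho) * v) ^+ 2); last by ring.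
  by rewrite ler_wpM2l ?divr_ge0// lerXn2r// nnegrE mulr_ge0//; lra.
have conv : al * W + (1 - al) * V <= V + E.
  have : al * W <= al * (V + E) by rewrite ler_wpM2l.
  have : al * E <= E by rewrite ler_piMl// ltW.
  lra.
case: ifP => [zK|_]; last by lra.
have [R1r|rR1] := leP R1 r.
  have WV : W <= V / 2.
    apply: le_trans (HR1 _ R1r); rewrite ler_expR ler_pM2l// lerXn2r ?nnegrE//.
      by rewrite addr_ge0 ?mulr_ge0//; lra.
    lra.
  have : al * W <= al * (V / 2) by rewrite ler_wpM2l.
  have := al_ge zK => ala.
  have : alr * V <= al * V by rewrite ler_wpM2r// ltW.
  lra.
have : V <= V1 by rewrite ler_expR ler_pM2l// lerXn2r ?nnegrE// ltW.
have : V * alr <= V by rewrite ler_piMr// ltW.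
lra.
Qed.

Lemma drift_radius_exists rho s K : 0 <= rho < 1 -> 0 < s -> 0 <= K ->
  exists2 R1, 0 <= R1 & forall u, R1 <= u ->
    expR (s * (rho * u + K) ^+ 2) <= expR (s * u ^+ 2) / 2.
Proof.
move=> /andP[rho0 rho1] s0 K0.
have d0 : 0 < 1 - rho by lra.
exists (2 * K / (1 - rho) + 2 / (s * (1 - rho)) + 1).
  by rewrite !addr_ge0// divr_ge0 ?mulr_ge0// ltW.
move=> u Hu.
have a0 : 0 <= 2 * K / (1 - rho) by rewrite divr_ge0 ?mulr_ge0// ltW.
have b0 : 0 <= 2 / (s * (1 - rho)) by rewrite divr_ge0 ?mulr_ge0// ltW.
have u1 : 1 <= u by lra.
have uK : 2 * K <= (1 - rho) * u by rewrite [leRHS]mulrC -ler_pdivrMr//; lra.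
have us : 2 <= s * (1 - rho) * u by rewrite [leRHS]mulrC -ler_pdivrMr ?mulr_gt0//; lra.
have e2 : 2 <= expR 1 :> R by have := expR_ge1Dx (1 : R); lra.
have: expR (s * (rho * u + K) ^+ 2) * 2 <= expR (s * u ^+ 2); last by lra.
apply: (@le_trans _ _ (expR (s * (rho * u + K) ^+ 2) * expR 1)).
  by rewrite ler_wpM2l ?expR_ge0.
rewrite -expRD ler_expR.
set d := 1 - rho in d0 uK us.
have rE : rho * u = u - d * u by rewrite /d; ring.
have le1 : rho * u + K <= u - d * u / 2 by lra.
have ge0 : 0 <= rho * u + K by rewrite addr_ge0// mulr_ge0//; lra.
have : (rho * u + K) ^+ 2 <= (u - d * u / 2) ^+ 2 by rewrite lerXn2r ?nnegrE//; lra.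
move=> /(ler_wpM2l (ltW s0)) h.
have d1 : d <= 1 by rewrite /d; lra.
have ud : (d * u) * u <= (d * u) * (2 * u - d * u / 2) by rewrite ler_wpM2l ?mulr_ge0//; nra.
have : 2 * 1 <= s * d * u * u by rewrite ler_pM//; lra.
nra.
Qed.

(** The weights are chosen so that the arithmetic mean, linear in f1 and U1, touches
    the geometric mean at f1 = f, U1 = U. *)
Lemma sqrt_amgm (f U f1 U1 : R) : 0 < f -> 0 < U -> 0 <= f1 -> 0 <= U1 ->
  Num.sqrt (f1 * U1) <=
  Num.sqrt (f * U) / 2 / f * f1 + Num.sqrt (f * U) / 2 / U * U1.
Proof.
move=> f0 U0 f10 U10.
have fU := mulr_gt0 f0 U0.
set w := Num.sqrt (f * U).
have w0 : 0 < w by rewrite sqrtr_gt0.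
have w2 : w ^+ 2 = f * U by rewrite sqr_sqrtr// ltW.
rewrite -[leRHS]ger0_norm; last by rewrite addr_ge0// mulr_ge0// !divr_ge0// ltW.
rewrite -sqrtr_sqr ler_wsqrtr//.
rewrite (_ : _ ^+ 2 = w ^+ 2 / 4 * (f1 / f + U1 / U) ^+ 2); last by field; rewrite !gt_eqF.
rewrite w2 (_ : f * U / 4 * _ = (f1 * U + U1 * f) ^+ 2 / (4 * (f * U))); last first.
  by field; rewrite !gt_eqF.
rewrite ler_pdivlMr ?mulr_gt0//.
have := sqr_ge0 (f1 * U - U1 * f); nra.
Qed.

End real_estimates.

(** * Sets of half mass *)

Section good_set.
Context {d} {T : measurableType d} {R : realType} (P : probability T R).
Local Open Scope ereal_scope.

(** The value on a set of mass at least one half is guaranteed to count for one half. *)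
Lemma integral_if_half (h : T -> bool) (a b : R) : measurable_fun setT h ->
  (2^-1)%:E <= P [set z | h z] -> (0 <= a)%R -> (a <= b)%R ->
  \int[P]_z (if h z then a else b)%:E <= ((a + b) / 2)%:E.
Proof.
move=> mh PG a0 ab; have b0 := le_trans a0 ab.
set G := [set z | h z] in PG *.
have mG : measurable G.
  rewrite -[X in measurable X]setTI (_ : G = h @^-1` [set true])//.
  exact: mh.
have mGC : measurable (~` G) by exact: measurableC.
have mi : measurable_fun setT (fun z => (if h z then a else b)%:E).
  by apply/measurable_EFinP; exact: measurable_fun_ifT.
have i0 z : (0 <= (if h z then a else b)%:E) by rewrite lee_fin; case: ifP.
have dG : [disjoint G & ~` G] by apply/disj_set2P; rewrite setICr.
have -> : \int[P]_z (if h z then a else b)%:E =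
    a%:E * P G + b%:E * P (~` G).
  rewrite -[in LHS](setUv G) (ge0_integral_setU _ mG mGC _ _ dG)//; last first.
    by rewrite setUv.
  congr (_ + _).
    rewrite (eq_integral (cst a%:E)); last by move=> x; rewrite inE /G/= => ->.
    exact: integral_cst.
  rewrite (eq_integral (cst b%:E)); last by move=> x; rewrite inE /G/= => /negP/negbTE ->.
  exact: integral_cst.
rewrite probability_setC// -(@fineK _ (P G)) ?fin_num_measure//.
rewrite -EFinB -!EFinM -EFinD lee_fin.
have : (2^-1 <= fine (P G))%R by rewrite -lee_fin fineK ?fin_num_measure.
nra.
Qed.

Lemma exists_half_sublevel (h : T -> R) : measurable_fun setT h ->
  (forall x, 0 <= h x)%R ->
  exists2 K : R, (0 <= K)%R & (2^-1)%:E <= P [set x | (h x <= K)%R].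
Proof.
move=> mh h0.
have mS (n : nat) : measurable [set x | (h x <= n%:R)%R].
  rewrite -[X in measurable X]setTI.
  have -> : [set x | (h x <= n%:R)%R] = h @^-1` `]-oo, n%:R]%classic.
    by apply/seteqP; split=> x /=; rewrite in_itv.
  exact: mh.
have cv : P [set x | (h x <= n%:R)%R] @[n --> \oo] --> P setT.
  have -> : [set: T] = \bigcup_n [set x | (h x <= n%:R)%R].
    apply/seteqP; split=> // x _; exists (Num.trunc (h x)).+1 => //=.
    by rewrite ltW// truncnS_gt.
  apply: nondecreasing_cvg_mu => //; first exact: bigcup_measurable.
  move=> n m nm; apply/subsetPset => x /= /le_trans; apply.
  by rewrite ler_nat.
move: cv; rewrite probability_setT => /fine_cvg cv.
have h1 : (2^-1 < 1 :> R)%R by rewrite invf_lt1// ltr1n.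
have [N _ HN] := cvgr_ge _ cv _ h1.
exists N%:R; first exact: ler0n.
have := HN N (leqnn N); rewrite /= -lee_fin => /le_trans; apply.
by rewrite fineK ?fin_num_measure.
Qed.

End good_set.

(** * Drift and contraction of the coupled chain *)

Section holder_potential.
Context {R : realType} {H : hilbertType R}.
Variables (g : H -> R) (beta Cg : R).
Hypotheses (beta0 : 0 < beta) (Cg0 : 0 < Cg) (Hg : holder g beta Cg).

Lemma holder_continuous : continuous g.
Proof.
move=> x; apply/cvgrPdist_le => e e0.
have d0 : 0 < (e / Cg) `^ beta^-1 by apply: powR_gt0; rewrite divr_gt0.
near=> y; have xy : `|x - y| <= (e / Cg) `^ beta^-1.
  by near: y; apply: cvgr_dist_le; [exact: cvg_id|exact: d0].
apply: le_trans (Hg _ _) _.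
rewrite mulrC -ler_pdivlMr//.
apply: (@le_trans _ _ (((e / Cg) `^ beta^-1) `^ beta)).
  by rewrite ge0_ler_powR ?nnegrE ?(ltW beta0) ?(ltW d0).
by rewrite -powRrM mulVf ?gt_eqF// powRr1// divr_ge0 ?ltW.
Unshelve. all: by end_near.
Qed.

Lemma measurable_holder : measurable_fun setT (g : borel H -> R).
Proof. by apply: continuous_borel_measurable; exact: holder_continuous. Qed.

Lemma accept_ge x y (r : R) : `|x - y| <= r -> expR (- (Cg * r `^ beta)) <= pcn_accept g x y.
Proof.
move=> xyr.
have xy : Cg * `|x - y| `^ beta <= Cg * r `^ beta.
  rewrite ler_pM2l// ge0_ler_powR ?nnegrE// ?(ltW beta0)//.
  exact: le_trans xyr.
have := Hg x y; rewrite ler_norml => /andP[gl gu].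
have p0 : 0 <= Cg * r `^ beta by rewrite mulr_ge0 ?powR_ge0// ltW.
by rewrite /pcn_accept le_min -[X in _ <= X]expR0 !ler_expR; apply/andP; split; lra.
Qed.

End holder_potential.

Section pcn_estimates.
Context {R : realType} {H : hilbertType R}.
Hypothesis Hsep : separable H.
Variable gamma : probability (borel H) R.
Variables (g : H -> R) (beta Cg rho : R).
Hypotheses (beta0 : 0 < beta) (Cg0 : 0 < Cg) (Hg : holder g beta Cg).
Hypothesis Hrho : 0 <= rho < 1.
Let mg := measurable_holder beta0 Cg0 Hg.
Let mstep := measurable_pcn_step Hsep rho mg.
Local Notation prop := (@pcn_proposal R H rho).
Local Notation acc := (@pcn_accept R H g).
Local Notation P := (transition (pcn_noise gamma) (pcn_step g rho)).
Local Notation Q := (transition (pcn_noise gamma) (paired (pcn_step g rho))).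

Let sg1 : Num.sqrt (1 - rho ^+ 2) <= 1.
Proof. by rewrite -[leRHS]sqrtr1 ler_wsqrtr// gerBl sqr_ge0. Qed.

Let norm_sg_le (z : H) : `|Num.sqrt (1 - rho ^+ 2) *: z| <= `|z|.
Proof. by rewrite normrZ ger0_norm ?sqrtr_ge0// ler_piMl. Qed.

Lemma norm_proposal_le x z : `|prop x z| <= rho * `|x| + `|z|.
Proof.
case/andP: Hrho => rho0 _.
apply: le_trans (ler_normD _ _) _; apply: lerD => //.
by rewrite normrZ ger0_norm.
Qed.

Lemma dist_proposal_le x z : `|x - prop x z| <= (1 - rho) * `|x| + `|z|.
Proof.
case/andP: Hrho => rho0 rho1.
rewrite /pcn_proposal opprD addrA -[X in X - _ - _]scale1r -scalerBl.
apply: le_trans (ler_normB _ _) _; apply: lerD => //.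
by rewrite normrZ ger0_norm// subr_ge0 ltW.
Qed.

Lemma dist_proposals x y z : `|prop x z - prop y z| = rho * `|x - y|.
Proof.
case/andP: Hrho => rho0 _.
rewrite /pcn_proposal opprD addrACA subrr addr0 -scalerBr normrZ ger0_norm//.
Qed.

Lemma measurable_norm : measurable_fun setT (fun x : borel H => `|(x : H)| : R).
Proof. by apply: continuous_borel_measurable; exact: norm_continuous. Qed.

Let mprop x : measurable_fun setT (fun z : borel H => prop x z : borel H).
Proof.
exact: (measurableT_comp (measurable_pcn_proposal Hsep rho) (pair1_measurable (x : borel H))).
Qed.

Let macc x : measurable_fun setT (fun z : borel H => acc x (prop x z)).
Proof.
exact: (measurableT_comp (measurable_accept Hsep rho mg) (pair1_measurable (x : borel H))).
Qed.

Lemma noise_level : exists2 K : R, 0 <= K &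
  ((2^-1)%:E <= gamma [set z : borel H | (`|(z : H)| <= K)%R])%E.
Proof. by apply: exists_half_sublevel => //; exact: measurable_norm. Qed.

Section drift.
Variables (theta K : R).
Hypotheses (theta0 : 0 < theta) (K0 : 0 <= K).
Hypothesis HK : ((2^-1)%:E <= gamma [set z : borel H | (`|(z : H)| <= K)%R])%E.
Hypothesis Hfernique :
  (\int[gamma]_xi (expR (theta * `|xi : H| ^+ 2))%:E < +oo)%E.

(** The acceptance probability in the ball of radius [r] when the noise is at most
    [K]: the move has length at most (1 - rho) r + K. *)
Definition low_accept (r : R) := expR (- (Cg * ((1 - rho) * r + K) `^ beta)).

Lemma low_accept_gt0 r : 0 < low_accept r. Proof. exact: expR_gt0. Qed.

Lemma low_accept_le1 r : low_accept r <= 1.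
Proof. by rewrite /low_accept -[leRHS]expR0 ler_expR oppr_le0 mulr_ge0 ?powR_ge0// ltW. Qed.

Lemma low_accept_nonincreasing r s : 0 <= r -> r <= s -> low_accept s <= low_accept r.
Proof.
case/andP: Hrho => rho0 rho1 r0 rs.
have d : 0 <= 1 - rho by lra.
rewrite ler_expR lerN2 ler_pM2l// ge0_ler_powR ?nnegrE ?(ltW beta0)//.
- by rewrite addr_ge0// mulr_ge0.
- by rewrite addr_ge0// mulr_ge0// (le_trans r0).
- by rewrite lerD2r ler_wpM2l.
Qed.

Lemma low_accept_le x z (r : R) : `|x| <= r -> `|z| <= K -> low_accept r <= acc x (prop x z).
Proof.
case/andP: Hrho => rho0 rho1 xr zK.
apply: (accept_ge beta0 Cg0 Hg); apply: le_trans (dist_proposal_le _ _) _.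
by apply: lerD => //; rewrite ler_wpM2l// subr_ge0 ltW.
Qed.

Definition lyap (s : R) (x : borel H) : R := expR (s * `|x : H| ^+ 2).

Lemma lyap_ge1 s x : 0 <= s -> 1 <= lyap s x.
Proof. by move=> s0; rewrite /lyap -[leLHS]expR0 ler_expR mulr_ge0 ?sqr_ge0. Qed.

Lemma measurable_lyap s : measurable_fun setT (lyap s).
Proof.
apply: measurableT_comp => //; apply: measurable_funM => //.
by apply: measurable_funX; exact: measurable_norm.
Qed.

Lemma measurable_ball_bool : measurable_fun setT (fun z : borel H => `|(z : H)| <= K).
Proof. by apply: measurable_fun_ler => //; exact: measurable_norm. Qed.

(** The factor 1 / 4 is 1 / 2 from the halving of the Lyapunov function at moderate
    noise times 1 / 2 from the mass of such noise; large noise contributes the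
    constant, finite by exponential integrability. *)
Lemma drift s : 0 < s -> s <= (1 - rho) ^+ 2 * theta / 16 ->
  exists2 b : R, 0 <= b & forall x,
    (P (fun y => (lyap s y)%:E) x <=
     (lyap s x * (1 - low_accept `|x : H| / 4) + b)%:E)%E.
Proof.
move=> s0 s_le.
have [R1 R10 HR1] := drift_radius_exists Hrho s0 K0.
have mexp c : measurable_fun setT (fun z : borel H => (expR (c * `|z : H| ^+ 2))%:E).
  by apply/measurable_EFinP; exact: (measurable_lyap c).
set E := (\int[gamma]_z (expR (theta / 16 * `|z : H| ^+ 2))%:E)%E.
have E0 : (0 <= E)%E by apply: integral_ge0 => z _; rewrite lee_fin expR_ge0.
have Eoo : (E < +oo)%E.
  apply: le_lt_trans Hfernique; apply: le_integralT => //.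
  move=> z; rewrite lee_fin ler_expR ler_wpM2r ?sqr_ge0//.
    by move: theta0; lra.
have Efin : E \is a fin_num by rewrite ge0_fin_numE.
pose b := expR (s * R1 ^+ 2) + fine E.
exists b; first by rewrite addr_ge0 ?expR_ge0 ?fine_ge0.
move=> x; have mL : measurable_fun setT (fun y => (lyap s y)%:E).
  by apply/measurable_EFinP; exact: measurable_lyap.
have L0 y : (0 <= (lyap s y)%:E)%E by rewrite lee_fin expR_ge0.
rewrite (transition_pcnE Hsep gamma rho mg x mL L0).
set al := low_accept `|x : H|.
have al1 : 0 <= al <= 1 by rewrite low_accept_le1 ltW// low_accept_gt0.
pose V := lyap s x.
have V0 : 0 <= V by exact: expR_ge0.
pose h (z : borel H) : R := if `|z : H| <= K then V * (1 - al / 2) else V.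
have h0 z : 0 <= h z by rewrite /h; case: ifP => // _; rewrite mulr_ge0//; lra.
have mh : measurable_fun setT h.
  by apply: measurable_fun_ifT => //; exact: measurable_ball_bool.
have mc : measurable_fun setT (fun z : borel H =>
    (expR (s * R1 ^+ 2) + expR (theta / 16 * `|z : H| ^+ 2))%:E).
  apply/measurable_EFinP; apply: measurable_funD => //.
  exact: (measurable_lyap (theta / 16)).
apply: (@le_trans _ _ (\int[gamma]_z ((h z)%:E +
    (expR (s * R1 ^+ 2) + expR (theta / 16 * `|z : H| ^+ 2))%:E))%E).
  apply: le_integralT.
  - apply: emeasurable_funD; apply: emeasurable_funM => //.
    + by apply/measurable_EFinP; exact: macc.
    + exact: (measurableT_comp mL (mprop x)).
    + by apply/measurable_EFinP; apply: measurable_funB => //; exact: macc.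
  - by apply: emeasurable_funD => //; exact/measurable_EFinP.
  - move=> z; rewrite -!EFinM -EFinD lee_fin.
    by rewrite addr_ge0// mulr_ge0 ?expR_ge0 ?accept_ge0// subr_ge0 accept_le1.
  - move=> z; rewrite -!EFinM -!EFinD lee_fin /h.
    apply: (drift_pointwise Hrho s0 s_le (ltW theta0) HR1) => //.
    + exact: norm_proposal_le.
    + exact: accept01.
    + by move=> zK; exact: low_accept_le.
rewrite integralTD; [|exact/measurable_EFinP|exact: mc|
  by move=> z; rewrite lee_fin|by move=> z; rewrite lee_fin addr_ge0 ?expR_ge0].
rewrite EFinD; apply: leeD.
  have := integral_if_half measurable_ball_bool HK (a := V * (1 - al / 2)) (b := V).
  move=> /(_ _ _)/le_trans; apply.
  - by rewrite mulr_ge0//; lra.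
  - by rewrite ler_piMr//; lra.
  - by rewrite lee_fin /V; lra.
under eq_integral do rewrite EFinD.
rewrite integralTD//.
by rewrite integral_prob_cst /b EFinD fineK.
Qed.
End drift.

Section contraction.

Let q := rho `^ beta.
Let q0 : 0 <= q. Proof. exact: powR_ge0. Qed.
Let q1 : q < 1.
Proof.
case/andP: Hrho => rho0 rho1.
have : rho `^ beta < 1 `^ beta by apply: gt0_ltr_powR => //; rewrite nnegrE.
by rewrite powR1.
Qed.

(** The two log-acceptance ratios differ by at most
    Cg |x - y| ^ beta + Cg |rho (x - y)| ^ beta; then [rate_A] balances the gain of
    joint moves against the loss of single moves. *)
Definition rate_C := Cg * (1 + q).
Definition rate_A := 2 * rate_C / (1 - q).
Definition hdist (p : borel H * borel H) : R := `|(p.1 : H) - (p.2 : H)| `^ beta.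
(** The bounded cost, comparable to the minimum of 1 and |x - y| ^ beta. *)
Definition fdist p : R := 1 - expR (- (rate_A * hdist p)).

Lemma rate_C_gt0 : 0 < rate_C.
Proof. by rewrite mulr_gt0// ltr_pwDl. Qed.

Lemma rate_A_gt0 : 0 < rate_A.
Proof. by apply: divr_gt0; [rewrite mulr_gt0 ?rate_C_gt0|rewrite subr_gt0]. Qed.

Lemma hdist_ge0 p : 0 <= hdist p. Proof. exact: powR_ge0. Qed.

Lemma fdist01 p : 0 <= fdist p <= 1.
Proof.
rewrite subr_ge0 gerBl expR_ge0 andbT -[leRHS]expR0 ler_expR oppr_le0.
by rewrite mulr_ge0 ?hdist_ge0// ltW// rate_A_gt0.
Qed.

Lemma fdist_ge0 p : 0 <= fdist p. Proof. by case/andP: (fdist01 p). Qed.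

Lemma fdist_eq0 p : fdist p = 0 -> p.1 = p.2.
Proof.
move/eqP; rewrite subr_eq0 eq_sym => /eqP; rewrite -[RHS]expR0 => /expR_inj/eqP.
rewrite oppr_eq0 mulf_eq0 gt_eqF ?rate_A_gt0//= powR_eq0 => /andP[/eqP h _].
by apply/eqP; rewrite -subr_eq0 -normr_eq0 h.
Qed.

Lemma fdist_diag x : fdist (x, x) = 0.
Proof. by rewrite /fdist /hdist subrr normr0 powR0 ?gt_eqF// mulr0 oppr0 expR0 subrr. Qed.

Lemma measurable_hdist : measurable_fun setT hdist.
Proof.
apply: (measurableT_comp (f := fun u : R => u `^ beta)); first exact: measurable_powR.
apply: (continuous2_borel_measurable Hsep) => p.
apply: (continuous_comp (f := fun p : H * H => p.1 - p.2)); last exact: norm_continuous.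
by apply: cvgB; [exact: cvg_fst|exact: cvg_snd].
Qed.

Lemma measurable_fdist : measurable_fun setT fdist.
Proof.
apply: measurable_funB => //; apply: measurableT_comp => //; apply: measurable_funN.
by apply: measurable_funM => //; exact: measurable_hdist.
Qed.

Lemma hdist_proposals x y z : hdist (prop x z, prop y z) = q * hdist (x, y).
Proof. by case/andP: Hrho => ? _; rewrite /hdist dist_proposals powRM. Qed.

Lemma accept_coupled_ratio x y z :
  Num.max (acc x (prop x z)) (acc y (prop y z)) <=
  expR (rate_C * hdist (x, y)) * Num.min (acc x (prop x z)) (acc y (prop y z)).
Proof.
apply: accept_ratio.
have -> : g x - g (prop x z) - (g y - g (prop y z)) =
    (g x - g y) - (g (prop x z) - g (prop y z)) by ring.
apply: le_trans (ler_normB _ _) _.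
rewrite /rate_C -mulrA mulrDl mul1r mulrDr; apply: lerD; first exact: Hg.
by rewrite -(hdist_proposals x y z); exact: Hg.
Qed.

Lemma rate_frac_le (T : R) : 0 <= T -> 0 <= rate_C / rate_A * expR (- (rate_A * T)) <= 1.
Proof.
move=> T0; have CA : 0 <= rate_C / rate_A <= 1.
  rewrite divr_ge0 ?(ltW rate_C_gt0) ?(ltW rate_A_gt0)//= ler_pdivrMr ?rate_A_gt0// mul1r.
  rewrite ler_pdivlMr ?subr_gt0//; have := mulr_ge0 (ltW rate_C_gt0) q0; have := rate_C_gt0; lra.
case/andP: CA => CA0 CA1.
rewrite mulr_ge0 ?expR_ge0//= mulr_ile1 ?expR_ge0//.
by rewrite -[leRHS]expR0 ler_expR oppr_le0 mulr_ge0// ltW// rate_A_gt0.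
Qed.

(** When exactly one copy accepts, nothing is known about the new distance, and the
    cost is bounded by 1. *)
Lemma transition_fdist_le x y T : hdist (x, y) <= T ->
  (Q (fun p => (fdist p)%:E) (x, y) <= \int[gamma]_z
    (fdist (x, y) * (1 - rate_C / rate_A * expR (- (rate_A * T)) *
      Num.min (acc x (prop x z)) (acc y (prop y z))))%:E)%E.
Proof.
move=> hT; have T0 := le_trans (hdist_ge0 (x, y)) hT.
have /andP[k0 k1] := rate_frac_le T0.
have mF : measurable_fun setT (fun w : borel H * measurableTypeR R =>
    (fdist (paired (pcn_step g rho) ((x, y), w)))%:E).
  apply/measurable_EFinP; apply: (measurableT_comp measurable_fdist).
  apply: (measurableT_comp (measurable_paired mstep)).
  exact: (pair1_measurable ((x, y) : borel H * borel H)).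
rewrite /transition ge0_integral_prod_prob//; last first.
  by move=> w; rewrite lee_fin fdist_ge0.
apply: le_integralT.
- apply: (measurable_fun_fubini_tonelli_F (m2 := unif01)
    (fun w => (fdist (paired (pcn_step g rho) ((x, y), w)))%:E) mF).
  by move=> w; rewrite lee_fin fdist_ge0.
- apply/measurable_EFinP; apply: measurable_funM => //; apply: measurable_funB => //.
  by apply: measurable_funM => //; apply: measurable_minr; exact: macc.
- by move=> z; apply: integral_ge0 => u _; rewrite lee_fin fdist_ge0.
move=> z; set m := Num.min _ _.
set M := Num.max (acc x (prop x z)) (acc y (prop y z)).
have m0 : 0 <= m by rewrite le_min !accept_ge0.
have M1 : M <= 1 by rewrite ge_max !accept_le1.
have mM : m <= M by rewrite ge_min le_max lexx.
have f01 := fdist01 (x, y).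
have f101 := fdist01 (prop x z : borel H, prop y z : borel H).
apply: (@le_trans _ _ (\int[unif01]_u (if (u <= m)%R then
    (fdist (prop x z : borel H, prop y z : borel H))%:E
    else if (u <= M)%R then 1 else (fdist (x, y))%:E))%E).
  apply: le_integralT.
  - exact: (measurableT_comp mF (pair1_measurable (z : borel H))).
  - apply: measurable_fun_ifT => //; first exact: measurable_fun_ler.
    by apply: measurable_fun_ifT => //; exact: measurable_fun_ler.
  - by move=> u; rewrite lee_fin fdist_ge0.
  have B p : ((fdist p)%:E <= 1)%E by rewrite lee_fin; case/andP: (fdist01 p).
  move=> u; rewrite /paired/= /pcn_step/= /m /M.
  move: (acc x (prop x z)) (acc y (prop y z)) => a b; rewrite le_min le_max.
  by case: ((u : R) <= a); case: ((u : R) <= b) => /=.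
rewrite integral_uniform_threshold2// ?lee_fin ?fdist_ge0//.
rewrite mulr1 [(1 - M) * _]mulrC [m * _]mulrC.
rewrite [fdist (prop x z : borel H, _)]/fdist hdist_proposals.
apply: coupled_step_contracts.
- exact: rate_C_gt0.
- exact: q1.
- by rewrite /rate_A; field; rewrite gt_eqF// subr_gt0.
- by rewrite hdist_ge0.
- exact: m0.
- exact: accept_coupled_ratio.
Qed.

Let accept_min01 x y z :
  0 <= Num.min (acc x (prop x z)) (acc y (prop y z)) <= 1.
Proof.
have := accept01 g x (prop x z); have := accept01 g y (prop y z).
move: (acc x _) (acc y _) => a b /andP[b0 b1] /andP[a0 a1].
by rewrite le_min a0 b0 ge_min a1.
Qed.

Lemma transition_fdist_nonexpansive x y :
  (Q (fun p => (fdist p)%:E) (x, y) <= (fdist (x, y))%:E)%E.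
Proof.
apply: le_trans (transition_fdist_le (lexx (hdist (x, y)))) _.
have /andP[k0 k1] := rate_frac_le (hdist_ge0 (x, y)).
rewrite -[leRHS](@integral_prob_cst _ _ _ gamma); apply: le_integralT => //.
- apply/measurable_EFinP; apply: measurable_funM => //; apply: measurable_funB => //.
  by apply: measurable_funM => //; apply: measurable_minr; exact: macc.
- move=> z; have /andP[m0 m1] := accept_min01 x y z.
  by rewrite lee_fin mulr_ge0 ?fdist_ge0// subr_ge0 mulr_ile1.
- move=> z; have /andP[m0 m1] := accept_min01 x y z.
  by rewrite lee_fin ler_piMr ?fdist_ge0// gerBl mulr_ge0.
Qed.

Lemma transition_fdist_contracts K r x y T : 0 <= K ->
  ((2^-1)%:E <= gamma [set z : borel H | (`|(z : H)| <= K)%R])%E ->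
  `|x| <= r -> `|y| <= r -> hdist (x, y) <= T ->
  (Q (fun p => (fdist p)%:E) (x, y) <=
   (fdist (x, y) * (1 - rate_C / rate_A * expR (- (rate_A * T)) * low_accept K r / 2))%:E)%E.
Proof.
move=> K0 HK xr yr hT; have T0 := le_trans (hdist_ge0 (x, y)) hT.
have /andP[k0 k1] := rate_frac_le T0.
apply: le_trans (transition_fdist_le hT) _.
set k := rate_C / rate_A * _ in k0 k1 *.
set f := fdist (x, y); have f0 : 0 <= f := fdist_ge0 _.
set l := low_accept K r.
have l0 : 0 <= l := ltW (low_accept_gt0 K r).
have l1 : l <= 1 := low_accept_le1 K r.
have kl1 : k * l <= 1 by rewrite mulr_ile1.
have := integral_if_half (measurable_ball_bool K) HK (a := f * (1 - k * l)) (b := f).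
have a0 : 0 <= f * (1 - k * l) by rewrite mulr_ge0// subr_ge0.
have ab : f * (1 - k * l) <= f by rewrite ler_piMr// gerBl mulr_ge0.
move=> /(_ a0 ab) half.
have mif : measurable_fun setT (fun z : borel H =>
    (if `|z : H| <= K then f * (1 - k * l) else f)%:E).
  by apply/measurable_EFinP; apply: measurable_fun_ifT => //; exact: measurable_ball_bool.
apply: le_trans (le_trans _ half) _; last first.
  by rewrite lee_fin -/l le_eqVlt; apply/orP; left; apply/eqP; field.
apply: le_integralT => //.
- apply/measurable_EFinP; apply: measurable_funM => //; apply: measurable_funB => //.
  by apply: measurable_funM => //; apply: measurable_minr; exact: macc.
- move=> z; have /andP[m0 m1] := accept_min01 x y z.
  by rewrite lee_fin mulr_ge0// subr_ge0 mulr_ile1.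
move=> z; have /andP[m0 m1] := accept_min01 x y z; rewrite lee_fin.
case: ifP => zK; last by rewrite ler_piMr// gerBl mulr_ge0.
rewrite ler_wpM2l// lerB// ler_wpM2l// le_min.
by rewrite !low_accept_le.
Qed.

End contraction.
End pcn_estimates.

(** * Geometric means and leaks *)

Section geometric_mean.
Context {d1 d2} {T : measurableType d1} {W : measurableType d2} {R : realType}.
Variables (nu : probability W R) (phi : T * W -> T).
Hypothesis mphi : measurable_fun setT phi.
Local Notation Q := (transition nu phi).
Implicit Types (f U : T -> R).

(** Cauchy-Schwarz for the operator, in the form of a linear bound with optimal
    weights. *)
Lemma transition_sqrt_le f U (x : T) (u w : R) :
  measurable_fun setT f -> measurable_fun setT U ->
  (forall y, 0 <= f y) -> (forall y, 0 < U y) -> 0 < f x ->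
  (Q (fun y => (f y)%:E) x <= (f x * u)%:E)%E ->
  (Q (fun y => (U y)%:E) x <= (U x * w)%:E)%E ->
  (Q (fun y => (Num.sqrt (f y * U y))%:E) x <=
   (Num.sqrt (f x * U x) * ((u + w) / 2))%:E)%E.
Proof.
move=> mf mU f0 U0 fx Qf QU.
set s := Num.sqrt (f x * U x).
have s0 : 0 <= s by exact: sqrtr_ge0.
set a := s / 2 / f x; set b := s / 2 / U x.
have a0 : 0 <= a by rewrite !divr_ge0// ltW.
have b0 : 0 <= b by rewrite !divr_ge0// ltW.
have mfE : measurable_fun setT (EFin \o f) by exact/measurable_EFinP.
have mUE : measurable_fun setT (EFin \o U) by exact/measurable_EFinP.
have maf : measurable_fun setT (fun y => a%:E * (f y)%:E)%E by exact: emeasurable_funM.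
have mbU : measurable_fun setT (fun y => b%:E * (U y)%:E)%E by exact: emeasurable_funM.
have U0' y : 0 <= U y by exact: ltW.
apply: (@le_trans _ _ (Q (fun y => a%:E * (f y)%:E + b%:E * (U y)%:E)%E x)).
  apply: (le_transition nu mphi).
  - apply/measurable_EFinP; apply: (measurableT_comp (f := @Num.sqrt R)).
      by apply: continuous_measurable_fun; exact: sqrt_continuous.
    exact: measurable_funM.
  - exact: emeasurable_funD.
  - by move=> y; rewrite lee_fin sqrtr_ge0.
  - by move=> y; rewrite -!EFinM -EFinD lee_fin; exact: sqrt_amgm.
rewrite (transitionD nu mphi)//; [|by move=> y; rewrite -EFinM lee_fin mulr_ge0..].
rewrite !(transitionZ nu mphi)//.
apply: (@le_trans _ _ (a%:E * (f x * u)%:E + b%:E * (U x * w)%:E)%E).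
  by apply: leeD; apply: lee_wpmul2l.
rewrite -!EFinM -EFinD lee_fin /a /b le_eqVlt; apply/orP; left; apply/eqP.
by field; rewrite !gt_eqF.
Qed.

(** Each of the [n] steps leaks at most D times the current value of [U], which has
    grown by at most n b in mean. *)
Lemma iter_transition_leaky f U (lam D b : R) n x :
  measurable_fun setT f -> measurable_fun setT U ->
  (forall y, 0 <= f y) -> (forall y, 0 <= U y) ->
  0 <= lam <= 1 -> 0 <= D -> 0 <= b ->
  (forall y, (Q (fun z => (f z)%:E) y <= ((1 - lam) * f y + D * U y)%:E)%E) ->
  (forall y, (Q (fun z => (U z)%:E) y <= (U y + b)%:E)%E) ->
  (iter n Q (fun y => (f y)%:E) x <=
   ((1 - lam) ^+ n * f x + n%:R * D * (U x + n%:R * b))%:E)%E.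
Proof.
move=> mf mU f0 U0 /andP[lam0 lam1] D0 b0 Qf QU.
have mfE : measurable_fun setT (EFin \o f) by exact/measurable_EFinP.
have mUE : measurable_fun setT (EFin \o U) by exact/measurable_EFinP.
elim: n x => [|n IH] x /=; first by rewrite expr0 mul1r !mul0r addr0.
set a := (1 - lam) ^+ n in IH *.
have a01 : 0 <= a <= 1 by rewrite /a exprn_ge0 ?exprn_ile1//; lra.
case/andP: a01 => a0 a1.
set N : R := n%:R in IH *.
have N0 : 0 <= N by exact: ler0n.
have ND : 0 <= N * D by rewrite mulr_ge0.
have NDb : 0 <= N * D * (N * b) by rewrite !mulr_ge0.
have m1 : measurable_fun setT (fun y => a%:E * (f y)%:E)%E by exact: emeasurable_funM.
have m2 : measurable_fun setT (fun y => (N * D)%:E * (U y)%:E)%E by exact: emeasurable_funM.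
have m3 : measurable_fun setT (fun y => (N * D)%:E * (U y)%:E + (N * D * (N * b))%:E)%E.
  by apply: emeasurable_funD.
have f0E y : (0 <= (f y)%:E)%E by rewrite lee_fin.
have U0E y : (0 <= (U y)%:E)%E by rewrite lee_fin.
apply: (@le_trans _ _ (Q (fun y => a%:E * (f y)%:E +
    ((N * D)%:E * (U y)%:E + (N * D * (N * b))%:E))%E x)).
  apply: (le_transition nu mphi).
  - exact: (measurable_iter_transition nu mphi n mfE).
  - exact: emeasurable_funD.
  - by move=> y; exact: iter_transition_ge0.
  - move=> y; apply: le_trans (IH y) _.
    by rewrite -!EFinM -!EFinD lee_fin; lra.
rewrite (transitionD nu mphi)//; last 2 first.
- by move=> y; rewrite mule_ge0.
- by move=> y; rewrite adde_ge0// mule_ge0.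
rewrite (transitionD nu mphi)//; last by move=> y; rewrite mule_ge0.
rewrite !(transitionZ nu mphi)// transition_cst.
apply: (@le_trans _ _ (a%:E * ((1 - lam) * f x + D * U x)%:E +
   ((N * D)%:E * (U x + b)%:E + (N * D * (N * b))%:E))%E).
  by apply: leeD; [|apply: leeD => //]; apply: lee_wpmul2l.
rewrite -!EFinM -!EFinD lee_fin -natr1 -/N exprSr -/a.
have DU : 0 <= D * U x by rewrite mulr_ge0.
have aDU : a * (D * U x) <= D * U x by rewrite ler_piMl.
have Db : 0 <= D * b by rewrite mulr_ge0.
have NDb' : 0 <= N * (D * b) by rewrite mulr_ge0.
lra.
Qed.

End geometric_mean.

(** * Decay of the cost along the coupled chain *)

Lemma powR_le1D {R : realType} (x b : R) : 0 <= x -> 0 < b -> b <= 1 -> x `^ b <= 1 + x.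
Proof.
move=> x0 b0 b1; have [x1|x1] := leP x 1.
  have : x `^ b <= 1 `^ b by apply: ge0_ler_powR => //; rewrite ?nnegrE ?ltW.
  by rewrite powR1; lra.
have : x `^ b <= x `^ 1 by apply: ler_powR => //; exact: ltW.
by rewrite powRr1//; lra.
Qed.

Section arithmetic.
Context {R : realType}.
Implicit Types (eps c a V b l S U k x y : R).

(** The arithmetic of the two regimes, each comparing a pair of factors for cost and
    weight with the common rate 1 - c l.  Far pairs: the cost does not grow and the
    weight decreases.  Near pairs: the cost decreases by k and the weight grows by
    at most k / 2. *)
Lemma far_rate eps c a l : 0 <= l -> l <= a -> 0 <= c -> c <= eps / 48 ->
  1 + (1 - eps * a / 24) <= 2 * (1 - c * l).
Proof.
move=> l0 la c0 ce; have : c * l <= eps / 48 * a by rewrite ler_pM.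
lra.
Qed.

Lemma far_drift eps a V b S U : 0 <= eps -> 0 <= a -> 16 * b <= a * V ->
  a * V <= S -> U <= 3 * V ->
  U + eps * (2 * b - S / 4) <= U * (1 - eps * a / 24).
Proof.
move=> e0 a0 bV VS UV.
have h1 : U * (eps * a) <= 3 * V * (eps * a) by rewrite ler_wpM2r// mulr_ge0.
have h2 : eps * (2 * b - S / 4) <= eps * (- (a * V) / 8) by rewrite ler_wpM2l//; lra.
lra.
Qed.

Lemma near_rate c l k : 0 <= c -> 0 <= l -> l <= 1 -> c <= k / 48 -> 0 <= k ->
  (1 - k) + (1 + k / 2) <= 2 * (1 - c * l).
Proof.
by move=> c0 l0 l1 ck k0; have : c * l <= c by [rewrite ler_piMr]; lra.
Qed.

Lemma near_drift eps b S U k : 0 <= eps -> 2 * eps * b <= k / 2 -> 0 <= S ->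
  1 <= U -> 0 <= k -> U + eps * (2 * b - S / 4) <= U * (1 + k / 2).
Proof.
move=> e0 bk S0 U1 k0.
have h1 : k / 2 <= U * (k / 2) by rewrite ler_peMl// divr_ge0.
have h2 : 0 <= eps * S by rewrite mulr_ge0.
lra.
Qed.

Lemma pair_weight_le3 eps x y : 0 <= eps -> eps <= 1 -> 1 <= x -> 0 <= y -> y <= x ->
  1 + eps * (x + y) <= 3 * x.
Proof.
move=> e0 e1 x1 y0 yx.
have : eps * (x + y) <= x + y by rewrite ler_piMl//; lra.
lra.
Qed.

Lemma eps_choice b k : 0 <= b -> 0 < k -> k <= 1 -> exists eps c,
  [/\ 0 < eps, eps <= 1, 2 * eps * b <= k / 2 & [/\ 0 < c, c <= 1, c <= eps / 48 & c <= k / 48]].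
Proof.
move=> b0 k0 k1; have bb : 0 < 4 * (b + 1) by lra.
have e0 : 0 < k / (4 * (b + 1)) by rewrite divr_gt0.
have e1 : k / (4 * (b + 1)) <= 1 by rewrite ler_pdivrMr//; lra.
have eb : k / (4 * (b + 1)) * (4 * (b + 1)) = k by rewrite divfK// gt_eqF.
set eps := k / _ in e0 e1 eb.
exists eps, (eps * k / 48); have ek := ler_piMl (ltW k0) e1.
have ke := ler_piMr (ltW e0) k1; have ek0 := mulr_gt0 e0 k0.
by split; [|lra..|split; [rewrite divr_gt0|lra..]].
Qed.

Lemma two_sum_le4 x y (e : R) : x <= e -> y <= e -> 2 * (x + y) <= 4 * e.
Proof. lra. Qed.

Lemma leak_exponent (s s0 x y : R) : s0 <= s -> x <= y ->
  s0 * y <= - ((s - s0) * x) + s * y.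
Proof.
move=> ss xy; have : (s - s0) * x <= (s - s0) * y by rewrite ler_wpM2l ?subr_ge0.
lra.
Qed.

End arithmetic.

Section coupled_decay.
Context {R : realType} {H : hilbertType R}.
Hypothesis Hsep : separable H.
Variable gamma : probability (borel H) R.
Variables (g : H -> R) (beta Cg rho : R).
Hypotheses (beta0 : 0 < beta) (beta1 : beta <= 1) (Cg0 : 0 < Cg) (Hg : holder g beta Cg).
Hypothesis Hrho : 0 <= rho < 1.
Variables (theta K : R).
Hypotheses (theta0 : 0 < theta) (K0 : 0 <= K).
Hypothesis HK : ((2^-1)%:E <= gamma [set z : borel H | (`|(z : H)| <= K)%R])%E.
Hypothesis Hfernique :
  (\int[gamma]_xi (expR (theta * `|xi : H| ^+ 2))%:E < +oo)%E.
Variables (s s0 : R).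
Hypotheses (s0_gt0 : 0 < s0) (s0_le : s0 <= s).
Hypothesis s_le : s <= (1 - rho) ^+ 2 * theta / 16.
Let mg := measurable_holder beta0 Cg0 Hg.
Let mstep := measurable_pcn_step Hsep rho mg.
Let mpair := measurable_paired mstep.
Local Notation P := (transition (pcn_noise gamma) (pcn_step g rho)).
Local Notation Q := (transition (pcn_noise gamma) (paired (pcn_step g rho))).
Local Notation la := (low_accept beta Cg rho K).
Local Notation fd := (fdist beta Cg rho).

(** Gaussian weights beat acceptance rates, whose logarithm is at most linear in the
    radius; so in the drift inequality the constant is negligible far away. *)
Lemma low_accept_lyap_unbounded (B : R) : exists2 R0 : R, 0 <= R0 &
  forall r, R0 <= r -> B <= la r * expR (s0 * r ^+ 2).
Proof.
case/andP: Hrho => rho0 rho1.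
pose B' := `|B| + Cg * (1 + K).
have B'0 : 0 <= B' by rewrite addr_ge0// mulr_ge0 ?addr_ge0// ltW.
exists ((Cg + B') / s0 + 1).
  by rewrite addr_ge0// divr_ge0 ?(ltW s0_gt0)// addr_ge0// ltW.
move=> r rR.
have r1 : 1 <= r.
  have : 0 <= (Cg + B') / s0 by rewrite divr_ge0 ?(ltW s0_gt0)// addr_ge0// ltW.
  lra.
have sr : Cg + B' <= s0 * r.
  by rewrite [leRHS]mulrC -ler_pdivrMr//; lra.
have srr : (Cg + B') * r <= s0 * r ^+ 2.
  by rewrite expr2 mulrA ler_wpM2r//; lra.
have B'r : B' <= B' * r by rewrite ler_peMr.
have d : 0 <= (1 - rho) * r + K by rewrite addr_ge0// mulr_ge0//; lra.
have dp : ((1 - rho) * r + K) `^ beta <= 1 + r + K.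
  apply: le_trans (powR_le1D d beta0 beta1) _.
  have : 0 <= rho * r by rewrite mulr_ge0//; lra.
  lra.
have Cdp := ler_wpM2l (ltW Cg0) dp.
rewrite /low_accept -expRD; apply: le_trans (expR_ge1Dx _).
have := ler_norm B; rewrite /B' in B'r srr *; lra.
Qed.

(** The 1 makes the weight harmless near the origin, where [eps] is taken small
    enough for the additive constant of the drift not to spoil the contraction of
    the cost. *)
Definition pair_weight (eps : R) (p : borel H * borel H) : R :=
  1 + eps * (lyap s0 p.1 + lyap s0 p.2).

(** The semimetric of the weak Harris theorem. *)
Definition weighted_dist eps p : R := Num.sqrt (fd p * pair_weight eps p).

Definition lyap_sum (p : borel H * borel H) : R := lyap s p.1 + lyap s p.2.

Let mlyap1 (t : R) : measurable_fun setT (fun p : borel H * borel H => lyap t p.1).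
Proof. exact: (measurableT_comp (measurable_lyap t) measurable_fst). Qed.

Let mlyap2 (t : R) : measurable_fun setT (fun p : borel H * borel H => lyap t p.2).
Proof. exact: (measurableT_comp (measurable_lyap t) measurable_snd). Qed.

Let lyap_ge0 (t : R) (x : H) : 0 <= lyap t x. Proof. exact: expR_ge0. Qed.

Lemma measurable_pair_weight eps : measurable_fun setT (pair_weight eps).
Proof.
apply: measurable_funD => //; apply: measurable_funM => //.
exact: measurable_funD.
Qed.

Lemma measurable_lyap_sum : measurable_fun setT lyap_sum.
Proof. exact: measurable_funD. Qed.

Let transition_lyap_sum (t : R) x y :
  (Q (fun p => (lyap t p.1)%:E + (lyap t p.2)%:E) (x, y) =
   P (fun z => (lyap t z)%:E) x + P (fun z => (lyap t z)%:E) y)%E.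
Proof.
rewrite (transitionD (pcn_noise gamma) mpair) => //.
- by apply/measurable_EFinP; exact: mlyap1.
- by apply/measurable_EFinP; exact: mlyap2.
- by move=> p; rewrite lee_fin.
- by move=> p; rewrite lee_fin.
Qed.

Lemma pair_weight_step eps b x y : 0 <= eps -> 0 <= b ->
  (forall x, (P (fun y => (lyap s0 y)%:E) x <=
     (lyap s0 x * (1 - la `|x : H| / 4) + b)%:E)%E) ->
  (Q (fun p => (pair_weight eps p)%:E) (x, y) <=
   (pair_weight eps (x, y) + eps * (2 * b - (la `|x : H| * lyap s0 x +
      la `|y : H| * lyap s0 y) / 4))%:E)%E.
Proof.
move=> eps0 b0 dr.
have mE (t : R) : measurable_fun setT (fun p : borel H * borel H => (lyap t p.1)%:E + (lyap t p.2)%:E)%E.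
  by apply: emeasurable_funD; exact/measurable_EFinP.
have E0 (p : borel H * borel H) : (0 <= (lyap s0 p.1)%:E + (lyap s0 p.2)%:E)%E.
  by rewrite -EFinD lee_fin addr_ge0.
have -> : (fun p => (pair_weight eps p)%:E) =
    (fun p => 1%:E + eps%:E * ((lyap s0 p.1)%:E + (lyap s0 p.2)%:E))%E.
  by apply/funext => p; rewrite /pair_weight EFinD EFinM EFinD.
rewrite (transitionD (pcn_noise gamma) mpair)//; last 2 first.
- by apply: emeasurable_funM.
- by move=> p; rewrite mule_ge0.
rewrite (transitionZ (pcn_noise gamma) mpair)// transition_cst transition_lyap_sum.
apply: (@le_trans _ _ (1%:E + eps%:E * ((lyap s0 x * (1 - la `|x : H| / 4) + b)%:E +
   (lyap s0 y * (1 - la `|y : H| / 4) + b)%:E))%E).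
  by apply: leeD => //; apply: lee_wpmul2l => //; apply: leeD.
rewrite -!(EFinM, EFinD) lee_fin /pair_weight/=.
move: (lyap s0 x) (lyap s0 y) (la _) (la _) => u v p q; lra.
Qed.

Lemma transition_diag (F : borel H * borel H -> \bar R) x :
  (forall y, F (y, y) = 0%E) -> Q F (x, x) = 0%E.
Proof.
move=> F0; rewrite /transition /paired/=.
by under eq_integral do rewrite F0; rewrite integral0.
Qed.

(** For a pair of norms at most [R0] the cost contracts at a fixed rate.  Otherwise
    the weight of the farther point contracts, at the rate of acceptance at its
    norm, which is at least that at [r]. *)
Lemma weighted_dist_contracts : exists eps c : R, [/\ 0 <= eps, eps <= 1, 0 < c, c <= 1 &
  forall x y (r : R), `|x| <= r -> `|y| <= r ->
  (Q (fun p => (weighted_dist eps p)%:E) (x, y) <= (weighted_dist eps (x, y) * (1 - c * la r))%:E)%E].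
Proof.
have s0_le16 : s0 <= (1 - rho) ^+ 2 * theta / 16 by exact: le_trans s_le.
have [b b0 dr] := drift Hsep beta0 Cg0 Hg Hrho theta0 K0 HK Hfernique s0_gt0 s0_le16.
have [R0 R00 HR0] := low_accept_lyap_unbounded (16 * b).
have la0 r : 0 < la r := low_accept_gt0 beta Cg rho K r.
have la1 r : la r <= 1 := low_accept_le1 beta rho Cg0 K r.
(* Points of norm at most R0 are at distance at most 2 * R0 from each other. *)
have [T TE] : exists T, T = (2 * R0) `^ beta by exists ((2 * R0) `^ beta).
have T0 : 0 <= T by rewrite TE powR_ge0.
have [k kE] : exists k, k = rate_C beta Cg rho / rate_A beta Cg rho *
  expR (- (rate_A beta Cg rho * T)) * la R0 / 2 by exists (rate_C beta Cg rho / rate_A beta Cg rho *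
  expR (- (rate_A beta Cg rho * T)) * la R0 / 2).
have k0 : 0 < k.
  rewrite kE divr_gt0// mulr_gt0// mulr_gt0 ?expR_gt0// divr_gt0//.
    by apply: rate_C_gt0.
  by apply: rate_A_gt0.
have k1 : k <= 1.
  have /andP[c0 c1] := rate_frac_le beta0 Cg0 Hrho T0.
  rewrite kE ler_pdivrMr// mul1r (le_trans (mulr_ile1 c0 (ltW (la0 _)) c1 (la1 _)))//.
  by rewrite ler1n.
have [eps [c [eps0 eps1 epsb [c0 c1 ceps ck]]]] := eps_choice b0 k0 k1.
exists eps, c; split => //; first exact: ltW.
move=> x y r xr yr.
have f0 (p : borel H * borel H) : 0 <= fd p by exact: fdist_ge0.
have U1 p : 1 <= pair_weight eps p.
  by rewrite /pair_weight lerDl mulr_ge0 ?addr_ge0// ltW.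
have U0 p : 0 < pair_weight eps p by exact: lt_le_trans (U1 p).
have [f_eq0|f_neq0] := eqVneq (fd (x, y)) 0.
  have xy : x = y by exact: (fdist_eq0 beta0 Cg0 Hrho f_eq0).
  rewrite -xy transition_diag; last first.
    by move=> z; rewrite /weighted_dist fdist_diag// mul0r sqrtr0.
  by rewrite /weighted_dist fdist_diag// mul0r sqrtr0 mul0r.
have f_gt0 : 0 < fd (x, y) by rewrite lt_neqAle eq_sym f_neq0 f0.
have M0 : 0 <= weighted_dist eps (x, y) by exact: sqrtr_ge0.
have step u w : u + w <= 2 * (1 - c * la r) ->
    (Q (fun p => (fd p)%:E) (x, y) <= (fd (x, y) * u)%:E)%E ->
    (Q (fun p => (pair_weight eps p)%:E) (x, y) <= (pair_weight eps (x, y) * w)%:E)%E ->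
    (Q (fun p => (weighted_dist eps p)%:E) (x, y) <= (weighted_dist eps (x, y) * (1 - c * la r))%:E)%E.
  move=> uw Qf QU.
  have K1 := transition_sqrt_le mpair (measurable_fdist Hsep beta Cg rho)
    (measurable_pair_weight eps) f0 U0 f_gt0 Qf QU.
  apply: (le_trans K1).
  by rewrite lee_fin; apply: ler_wpM2l => //; rewrite ler_pdivrMr// mulrC.
have QU := pair_weight_step x y (ltW eps0) b0 dr.
have lar0 := la0 r; have lar1 := la1 r.
have cla : c * la r <= c by rewrite ler_piMr// ltW.
have Ux := U0 (x, y).
have V1 (z : H) : 1 <= lyap s0 z by apply: lyap_ge1; exact: ltW.
have laV (z : H) : 0 <= la `|z| * lyap s0 z := mulr_ge0 (ltW (la0 _)) (lyap_ge0 _ _).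
have case2 a V : la r <= a -> 16 * b <= a * V ->
   a * V <= la `|x : H| * lyap s0 x + la `|y : H| * lyap s0 y ->
   pair_weight eps (x, y) <= 3 * V ->
  (Q (fun p => (weighted_dist eps p)%:E) (x, y) <= (weighted_dist eps (x, y) * (1 - c * la r))%:E)%E.
  move=> ar ab aV UV.
  apply: (step 1 (1 - eps * a / 24)).
  - exact: far_rate (ltW lar0) ar (ltW c0) ceps.
  - by rewrite mulr1; exact: (transition_fdist_nonexpansive Hsep gamma beta0 Cg0 Hg Hrho).
  apply: le_trans QU _; rewrite lee_fin.
  have a0 : 0 <= a by exact: le_trans (ltW lar0) ar.
  exact: far_drift (ltW eps0) a0 ab aV UV.
have lamono u v : 0 <= u -> u <= v -> la v <= la u.
  by move=> u0 uv; exact: low_accept_nonincreasing.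
have [mR0|mR0] := leP (Num.max `|x| `|y|) R0.
  move: mR0; rewrite ge_max => /andP[xR0 yR0].
  have hT : hdist beta (x, y) <= T.
    rewrite /hdist TE; apply: ge0_ler_powR; rewrite ?nnegrE ?(ltW beta0)//=.
      by rewrite mulr_ge0.
    by apply: le_trans (ler_normB _ _) _; rewrite mulrDl mul1r lerD.
  apply: (step (1 - k) (1 + k / 2)).
  - exact: near_rate (ltW c0) (ltW lar0) lar1 ck (ltW k0).
  - rewrite kE; exact: (transition_fdist_contracts Hsep beta0 Cg0 Hg Hrho K0 HK xR0 yR0 hT).
  apply: le_trans QU _; rewrite lee_fin.
  apply: near_drift (ltW eps0) epsb _ (U1 _) (ltW k0).
  by rewrite addr_ge0.
have Vmono (u v : H) : `|u : H| <= `|v : H| -> lyap s0 u <= lyap s0 v.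
  by move=> uv; rewrite ler_expR ler_pM2l// lerXn2r ?nnegrE.
have [xy|/ltW xy] := leP `|x| `|y|.
  move: mR0; rewrite (max_idPr xy) => /ltW/HR0 yb.
  apply: (case2 (la `|y|) (lyap s0 y)); [exact: lamono|exact: yb| |].
    by rewrite lerDr.
  rewrite /pair_weight/= [lyap s0 x + _]addrC.
  exact: pair_weight_le3 (ltW eps0) eps1 (V1 y) (lyap_ge0 _ _) (Vmono _ _ xy).
move: mR0; rewrite (max_idPl xy) => /ltW/HR0 xb.
apply: (case2 (la `|x|) (lyap s0 x)); [exact: lamono|exact: xb| |].
  by rewrite lerDl.
exact: pair_weight_le3 (ltW eps0) eps1 (V1 x) (lyap_ge0 _ _) (Vmono _ _ xy).
Qed.

(** Inside the ball of radius [r] the semimetric contracts; outside it is at most the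
    weight with exponent [s0], which is exp (- (s - s0) r ^ 2) times that with
    exponent [s]. *)
Theorem coupled_decay : exists c b : R, [/\ 0 < c, c <= 1, 0 <= b &
  forall (r : R) n x y, 0 <= r ->
  (iter n Q (fun p => (fd p)%:E) (x, y) <=
   ((1 - c * la r) ^+ n * (2 * lyap_sum (x, y)) +
    n%:R * (4 * expR (- ((s - s0) * r ^+ 2))) * (lyap_sum (x, y) + n%:R * b))%:E)%E].
Proof.
have [eps [c [eps0 eps1 c0 c1 HM]]] := weighted_dist_contracts.
have s_gt0 : 0 < s by exact: lt_le_trans s0_le.
have [b b0 dr] := drift Hsep beta0 Cg0 Hg Hrho theta0 K0 HK Hfernique s_gt0 s_le.
exists c, (2 * b); split => //; first by rewrite mulr_ge0.
move=> r n x y r0.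
have la0 := low_accept_gt0 beta Cg rho K r.
have la1 := low_accept_le1 beta rho Cg0 K r.
have cl0 : 0 <= c * la r by rewrite mulr_ge0// ltW.
have cl1 : c * la r <= 1 by rewrite mulr_ile1// ltW.
have f0 (p : borel H * borel H) : 0 <= fd p by exact: fdist_ge0.
have V1 (z : H) (t : R) : 0 <= t -> 1 <= lyap t z by move=> ?; exact: lyap_ge1.
have Vs (z : H) : lyap s0 z <= lyap s z by rewrite ler_expR ler_wpM2r ?sqr_ge0.
have U1 p : 1 <= pair_weight eps p by rewrite /pair_weight lerDl mulr_ge0 ?addr_ge0.
have M0 p : 0 <= weighted_dist eps p by exact: sqrtr_ge0.
have U_le p : pair_weight eps p <= 2 * (lyap s0 p.1 + lyap s0 p.2).
  have := V1 p.1 s0 (ltW s0_gt0); have := V1 p.2 s0 (ltW s0_gt0).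
  have : eps * (lyap s0 p.1 + lyap s0 p.2) <= lyap s0 p.1 + lyap s0 p.2.
    by rewrite ler_piMl// addr_ge0.
  by rewrite /pair_weight; lra.
have MU p : weighted_dist eps p <= pair_weight eps p.
  have /andP[f00 f1] := fdist01 beta0 Cg0 Hrho p.
  rewrite /weighted_dist -[leRHS]ger0_norm ?(le_trans ler01)// -sqrtr_sqr ler_wsqrtr//.
  rewrite expr2; apply: ler_wpM2r; first exact: le_trans ler01 (U1 p).
  exact: le_trans f1 (U1 p).
have fM p : fd p <= weighted_dist eps p.
  have /andP[f00 f1] := fdist01 beta0 Cg0 Hrho p.
  rewrite /weighted_dist -[leLHS]ger0_norm// -sqrtr_sqr ler_wsqrtr//.
  rewrite expr2; apply: ler_wpM2l => //; exact: le_trans f1 (U1 p).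
have mM : measurable_fun setT (weighted_dist eps).
  apply: (measurableT_comp (f := @Num.sqrt R)).
    by apply: continuous_measurable_fun; exact: sqrt_continuous.
  by apply: measurable_funM; [exact: measurable_fdist|exact: measurable_pair_weight].
have W0 p : 0 <= lyap_sum p by rewrite addr_ge0.
set D := 4 * expR _.
have D0 : 0 <= D by rewrite mulr_ge0 ?expR_ge0.
have leak p : (Q (fun z => (weighted_dist eps z)%:E) p <=
    ((1 - c * la r) * weighted_dist eps p + D * lyap_sum p)%:E)%E.
  case: p => u v.
  have [|out] := leP (Num.max `|u| `|v|) r.
    rewrite ge_max => /andP[ur vr]; apply: le_trans (HM _ _ _ ur vr) _.
    by rewrite lee_fin mulrC lerDl mulr_ge0.
  set m := Num.max `|u| `|v| in out.
  have um : `|u| <= m by rewrite le_max lexx.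
  have vm : `|v| <= m by rewrite le_max lexx orbT.
  apply: le_trans (HM _ _ _ um vm) _; rewrite lee_fin.
  have lm0 := low_accept_gt0 beta Cg rho K m.
  apply: (@le_trans _ _ (weighted_dist eps (u, v))).
    by apply: ler_piMr (M0 _) _; rewrite gerBl; exact: mulr_ge0 (ltW c0) (ltW lm0).
  suff MD : weighted_dist eps (u, v) <= D * lyap_sum (u, v).
    apply: le_trans MD _; rewrite lerDr; apply: mulr_ge0 (M0 _).
    by rewrite subr_ge0.
  apply: le_trans (MU _) _; apply: le_trans (U_le _) _ => /=.
  have m0 : 0 <= m := le_trans (normr_ge0 u) um.
  have key (z : H) : `|z| <= m -> lyap s0 z <= expR (s0 * m ^+ 2).
    by move=> zm; rewrite ler_expR ler_pM2l// lerXn2r ?nnegrE.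
  have ku := key _ um; have kv := key _ vm.
  have kw : expR (s * m ^+ 2) <= lyap_sum (u, v).
    rewrite /lyap_sum/=; have [->|->] : m = `|u| \/ m = `|v|.
    - by rewrite /m; case: (leP `|u| `|v|) => _; [right|left].
    - by rewrite lerDl.
    - by rewrite lerDr.
  have kD : expR (s0 * m ^+ 2) <= expR (- ((s - s0) * r ^+ 2)) * expR (s * m ^+ 2).
    rewrite -expRD ler_expR.
    by apply: leak_exponent => //; rewrite lerXn2r ?nnegrE// ltW.
  apply: le_trans (ler_wpM2l D0 kw); rewrite /D -mulrA.
  apply: (@le_trans _ _ (4 * expR (s0 * m ^+ 2))); last by rewrite ler_pM2l.
  exact: two_sum_le4 ku kv.
have Wstep p : (Q (fun z => (lyap_sum z)%:E) p <= (lyap_sum p + 2 * b)%:E)%E.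
  case: p => u v.
  have -> : (fun z => (lyap_sum z)%:E) = (fun z => (lyap s z.1)%:E + (lyap s z.2)%:E)%E.
    by apply/funext => z; rewrite -EFinD.
  rewrite transition_lyap_sum.
  apply: (@le_trans _ _ ((lyap s u + b)%:E + (lyap s v + b)%:E)%E).
    have dr' z : (P (fun y => (lyap s y)%:E) z <= (lyap s z + b)%:E)%E.
      apply: le_trans (dr z) _; rewrite lee_fin lerD2r ler_piMr// gerBl.
      by apply: divr_ge0 (ler0n _ _); exact: ltW (low_accept_gt0 _ _ _ _ _).
    exact: leeD.
  by rewrite -EFinD lee_fin /lyap_sum/= addrACA mulr2n mulrDl mul1r.
apply: (@le_trans _ _ (iter n Q (fun p => (weighted_dist eps p)%:E) (x, y))).
  apply: (le_iter_transition (pcn_noise gamma) mpair).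
  - by apply/measurable_EFinP; exact: measurable_fdist.
  - exact/measurable_EFinP.
  - by move=> p; rewrite lee_fin.
  - by move=> p; rewrite lee_fin.
have cl01 : 0 <= c * la r <= 1 by rewrite cl0.
have b20 : 0 <= 2 * b by rewrite mulr_ge0.
apply: le_trans (iter_transition_leaky mpair n (x, y) mM measurable_lyap_sum
  M0 W0 cl01 D0 b20 leak Wstep) _.
rewrite lee_fin lerD2r ler_wpM2l ?exprn_ge0 ?subr_ge0//.
apply: le_trans (MU _) _; apply: le_trans (U_le _) _ => /=.
by rewrite ler_pM2l// /lyap_sum/= lerD.
Qed.

End coupled_decay.

(** * The subgeometric rate *)

Section subgeometric_rate.
Context {R : realType}.
Implicit Types (a b c d p x l : R).

Lemma powR_le_expR p d : 0 < p -> 0 < d -> exists2 B, 0 < B &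
  forall l, 0 <= l -> l `^ p <= B * expR (d * l).
Proof.
move=> p0 d0; exists ((p / d) `^ p); first by apply: powR_gt0; rewrite divr_gt0.
move=> l l0.
have pd : 0 < p / d by rewrite divr_gt0.
have le : l <= p / d * expR (d / p * l).
  have e := expR_ge1Dx (d / p * l).
  have h : p / d * (d / p * l) <= p / d * expR (d / p * l) by rewrite ler_pM2l//; lra.
  by apply: le_trans h; rewrite le_eqVlt; apply/orP; left; apply/eqP; field; rewrite !gt_eqF.
have -> : expR (d * l) = expR (d / p * l) `^ p.
  by rewrite -expRM; congr expR; field; rewrite gt_eqF.
rewrite -powRM ?expR_ge0 ?(ltW pd)// ge0_ler_powR ?nnegrE ?(ltW p0)//.
by rewrite mulr_ge0 ?expR_ge0// ltW.
Qed.

(** Any power of l = ln n is negligible against the power n ^ d = exp (d l). *)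
Lemma powR_le_expR_absorbed k p c d : 0 <= k -> 0 < p -> 0 < c -> 0 < d ->
  exists a, forall l, 0 <= l -> k * l `^ p <= c * expR (d * l) + a.
Proof.
move=> k0 p0 c0 d0.
have d2 : 0 < d / 2 by rewrite divr_gt0.
have [B B0 HB] := powR_le_expR p0 d2.
exists ((k * B) ^+ 2 / (4 * c)) => l l0.
have := ler_wpM2l k0 (HB _ l0).
set z := expR (d / 2 * l).
have -> : expR (d * l) = z ^+ 2 by rewrite /z expr2 -expRD; congr expR; field.
move=> h; apply: le_trans h _.
have c1 : c != 0 by rewrite gt_eqF.
have -> : c * z ^+ 2 + (k * B) ^+ 2 / (4 * c) = k * (B * z) + c * (z - k * B / (2 * c)) ^+ 2.
  by field.
by rewrite lerDl mulr_ge0 ?sqr_ge0// ltW.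
Qed.

(** (theta / 20) (5 / 6) ^ 2 = 5 theta / 144 exceeds theta / 36 by theta / 144; the
    excess, a completed square, absorbs everything linear in X. *)
Lemma quadratic_slack (theta Cg K X : R) : 0 < theta -> 0 < Cg -> 0 <= K -> 0 <= X ->
  2 * (Cg * (1 + X)) - theta / 20 * (5 / 6 * X - K) ^+ 2 <=
  - (theta / 36 * X ^+ 2) +
   (2 * Cg + 36 * (2 * Cg + theta * K / 12) ^+ 2 / theta).
Proof.
move=> t0 Cg0 K0 X0.
set B := 2 * Cg + theta * K / 12.
have t1 : theta != 0 by rewrite gt_eqF.
have : 0 <= theta / 144 * (X - 72 * B / theta) ^+ 2 by rewrite mulr_ge0 ?sqr_ge0// divr_ge0// ltW.
have -> : theta / 144 * (X - 72 * B / theta) ^+ 2 =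
  theta / 144 * X ^+ 2 - B * X + 36 * B ^+ 2 / theta by field.
have : 0 <= theta / 20 * K ^+ 2 by rewrite mulr_ge0 ?sqr_ge0// divr_ge0// ltW.
have -> : B * X = 2 * Cg * X + theta * K / 12 * X by rewrite /B mulrDl.
move: (36 * B ^+ 2 / theta) => Q.
have -> : theta / 20 * (5 / 6 * X - K) ^+ 2 =
    theta * 5 / 144 * X ^+ 2 - theta * K / 12 * X + theta / 20 * K ^+ 2.
  by field.
lra.
Qed.

(** Optimisation over [r].  When ln n is too small for the choice of [r] the trivial
    bound v <= 1 is enough, at the price of the constant exp a1. *)
Lemma subgeometric_rate (beta Cg theta rho K c b : R) :
  0 < beta -> beta <= 1 -> 0 < Cg -> 0 < theta -> 0 <= rho < 1 -> 0 <= K ->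
  0 < c -> c <= 1 -> 0 <= b ->
  let s := (1 - rho) ^+ 2 * theta / 16 in
  exists2 C, 0 <= C & forall (n : nat) (W v : R), (2 <= n)%N -> 1 <= W -> v <= 1 ->
  (forall r, 0 <= r ->
    v <= (1 - c * low_accept beta Cg rho K r) ^+ n * (2 * W) +
      n%:R * (4 * expR (- ((s - s / 5) * r ^+ 2))) * (W + n%:R * b)) ->
  v <= C * W * expR (- (theta * Cg `^ (- (2 / beta)) / 36 * ln n%:R `^ (2 / beta))).
Proof.
move=> beta0 beta1 Cg0 t0 /andP[rho0 rho1] K0 c0 c1 b0 s.
have bi0 : 0 < beta^-1 by rewrite invr_gt0.
(* Any q < 1 with q ^ 2 / 20 > 1 / 36 would do. *)
pose q : R := 5 / 6.
have q01 : 0 < q < 1 by rewrite /q; lra.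
case/andP: q01 => q0 q1.
have d0 : 0 < 1 - q `^ beta.
  have : q `^ beta < 1 `^ beta by apply: gt0_ltr_powR => //; rewrite nnegrE// ltW.
  by rewrite powR1 subr_gt0.
have p0 : 0 < 2 / beta by rewrite divr_gt0.
have k0 : 0 <= theta * Cg `^ (- (2 / beta)) / 36.
  by rewrite divr_ge0 ?mulr_ge0 ?powR_ge0// ltW.
have [a3 Ha3] := powR_le_expR_absorbed k0 p0 c0 d0.
pose a1 := theta / 36 * (K / q) ^+ 2.
pose a2 := 2 * Cg + 36 * (2 * Cg + theta * K / 12) ^+ 2 / theta.
exists (expR a1 + (2 * expR a3 + 4 * (1 + b) * expR a2)).
  by rewrite !addr_ge0// ?mulr_ge0 ?expR_ge0// addr_ge0.
move=> n W v n2 W1 v1 Hv.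
have n1 : 1 < n%:R :> R by rewrite ltr1n.
have n0 : 0 < n%:R :> R by exact: lt_trans n1.
set l := ln n%:R; have l0 : 0 < l by rewrite ln_gt0.
have en : expR l = n%:R by rewrite lnK.
have lC : 0 <= l / Cg by rewrite divr_ge0// ltW.
set X := (l / Cg) `^ beta^-1; have X0 : 0 <= X := powR_ge0 _ _.
have Xb : X `^ beta = l / Cg by rewrite -powRrM mulVf ?gt_eqF// powRr1.
have lX : l = Cg * X `^ beta by rewrite Xb mulrC divfK// gt_eqF.
have kX : theta * Cg `^ (- (2 / beta)) / 36 * l `^ (2 / beta) = theta / 36 * X ^+ 2.
  have -> : X ^+ 2 = (l / Cg) `^ (2 / beta).
    by rewrite -powR_mulrn// /X -powRrM; congr (_ `^ _); rewrite mulrC.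
  rewrite powRM ?invr_ge0 ?(ltW l0) ?(ltW Cg0)// -(powR_inv1 (ltW Cg0)) -powRrM mulN1r.
  by ring.
set E := expR (- _).
have EE : E = expR (- (theta / 36 * X ^+ 2)) by rewrite /E kX.
have E0 : 0 < E by exact: expR_gt0.
have W0 : 0 <= W by exact: le_trans W1.
have [qXK|KqX] := ltP (q * X) K.
  have Xle : X <= K / q by rewrite ler_pdivlMr// mulrC ltW.
  have : 1 <= expR a1 * E.
    rewrite EE -expRD -[leLHS]expR0 ler_expR /a1 subr_ge0 ler_pM2l ?divr_gt0//.
    by rewrite lerXn2r ?nnegrE// divr_ge0// ltW.
  move=> h; apply: le_trans v1 _; apply: le_trans h _.
  rewrite mulrAC; apply: (@le_trans _ _ (expR a1 * E * W)).
    by rewrite ler_peMr// mulr_ge0 ?expR_ge0// ltW.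
  rewrite ler_wpM2r// ler_wpM2r ?(ltW E0)// lerDl addr_ge0// ?mulr_ge0 ?expR_ge0//.
  by rewrite addr_ge0.
have d : 0 < 1 - rho by rewrite subr_gt0.
pose r := (q * X - K) / (1 - rho).
have r0 : 0 <= r by rewrite divr_ge0 ?subr_ge0// ltW.
apply: le_trans (Hv r r0) _.
have rE : (1 - rho) * r + K = q * X by rewrite /r mulrC divfK ?gt_eqF// subrK.
have laE : low_accept beta Cg rho K r = expR (- (q `^ beta * l)).
  rewrite /low_accept rE.
  rewrite powRM ?(ltW q0)// Xb.
  by rewrite mulrCA [Cg * _]mulrC divfK ?gt_eqF.
have la01 : 0 <= c * low_accept beta Cg rho K r <= 1.
  rewrite mulr_ge0 ?(ltW c0) ?(ltW (low_accept_gt0 _ _ _ _ _))//=.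
  by rewrite mulr_ile1 ?(ltW c0) ?(ltW (low_accept_gt0 _ _ _ _ _))// low_accept_le1.
(* This is 1 - x <= exp (- x), to the power n = exp l. *)
have term1 : (1 - c * low_accept beta Cg rho K r) ^+ n <= expR a3 * E.
  apply: (@le_trans _ _ (expR (- (c * expR ((1 - q `^ beta) * l))))).
    rewrite (_ : expR _ = expR (- (c * low_accept beta Cg rho K r)) ^+ n).
      rewrite lerXn2r ?nnegrE ?expR_ge0 ?subr_ge0//; first by case/andP: la01.
      by have := expR_ge1Dx (- (c * low_accept beta Cg rho K r)); lra.
    rewrite -expRM_natl -mulNr -en laE; congr expR.
    rewrite mulrBl mul1r expRD; ring.
  rewrite -expRD ler_expR; have := Ha3 _ (ltW l0).
  by rewrite kX; lra.
have term2 : n%:R ^+ 2 * expR (- ((s - s / 5) * r ^+ 2)) <= expR a2 * E.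
  have -> : (s - s / 5) * r ^+ 2 = theta / 20 * (5 / 6 * X - K) ^+ 2.
    by rewrite /s /r /q; field; rewrite gt_eqF.
  rewrite EE -en expr2 -!expRD ler_expR.
  have ql := quadratic_slack t0 Cg0 K0 X0.
  have : l <= Cg * (1 + X) by rewrite lX ler_pM2l//; exact: powR_le1D.
  by rewrite /a2; lra.
set L := (1 - _) ^+ n in term1 *.
set S := expR (- ((s - s / 5) * r ^+ 2)) in term2 *.
have S0 : 0 <= S := expR_ge0 _.
have Wn : W + n%:R * b <= n%:R * ((1 + b) * W).
  have : 0 <= (n%:R - 1) * W by rewrite mulr_ge0// subr_ge0 ltW.
  have : 0 <= n%:R * b * (W - 1) by rewrite !mulr_ge0// ?subr_ge0// ltW.
  lra.
have t1 : L * (2 * W) <= expR a3 * E * (2 * W) by rewrite ler_wpM2r// mulr_ge0.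
have t2 : n%:R * (4 * S) * (W + n%:R * b) <= 4 * (1 + b) * W * (expR a2 * E).
  apply: (@le_trans _ _ (n%:R * (4 * S) * (n%:R * ((1 + b) * W)))).
    by rewrite ler_wpM2l// !mulr_ge0// ltW.
  rewrite (_ : _ * _ = 4 * (1 + b) * W * (n%:R ^+ 2 * S)); last by ring.
  by rewrite ler_wpM2l// !mulr_ge0// addr_ge0.
have a1E : 0 <= expR a1 * W * E by rewrite !mulr_ge0 ?expR_ge0// ltW.
move: t1 t2 a1E; move: (expR a1) (expR a2) (expR a3) => u1 u2 u3; lra.
Qed.

End subgeometric_rate.

(** * Comparison of two invariant measures *)

Section iterated_linearity.
Context {d1 d2} {T : measurableType d1} {W : measurableType d2} {R : realType}.
Variables (nu : probability W R) (phi : T * W -> T).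
Hypothesis mphi : measurable_fun setT phi.
Local Notation Q := (transition nu phi).
Local Open Scope ereal_scope.

Lemma iter_transitionD n (F G : T -> \bar R) x :
  measurable_fun setT F -> measurable_fun setT G ->
  (forall y, 0 <= F y) -> (forall y, 0 <= G y) ->
  iter n Q (fun y => F y + G y) x = iter n Q F x + iter n Q G x.
Proof.
move=> mF mG F0 G0; elim: n x => //= n IH x.
rewrite -(transitionD nu mphi).
- by congr (Q _ x); apply/funext.
- exact: (measurable_iter_transition nu mphi n mF).
- exact: (measurable_iter_transition nu mphi n mG).
- by move=> y; exact: iter_transition_ge0.
- by move=> y; exact: iter_transition_ge0.
Qed.

Lemma iter_transitionZ n (F : T -> \bar R) (a : R) x :
  measurable_fun setT F -> (forall y, 0 <= F y) -> (0 <= a)%R ->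
  iter n Q (fun y => a%:E * F y) x = a%:E * iter n Q F x.
Proof.
move=> mF F0 a0; elim: n x => //= n IH x.
rewrite -(transitionZ nu mphi)//.
- by congr (Q _ x); apply/funext.
- exact: (measurable_iter_transition nu mphi n mF).
- by move=> y; exact: iter_transition_ge0.
Qed.

Lemma iter_transition_le1 n (f : T -> R) x : measurable_fun setT f ->
  (forall y, 0 <= f y <= 1)%R -> iter n Q (fun y => (f y)%:E) x <= 1.
Proof.
move=> mf f01.
have c1 m y : iter m Q (fun=> 1) y = 1 :> \bar R.
  elim: m y => //= m IH y; rewrite -[RHS](transition_cst nu phi 1 y).
  by congr (Q _ y); apply/funext.
rewrite -[leRHS](c1 n x); apply: (le_iter_transition nu mphi) => //.
- exact/measurable_EFinP.
- by move=> y; rewrite lee_fin; case/andP: (f01 y).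
- by move=> y; rewrite lee_fin; case/andP: (f01 y).
Qed.

End iterated_linearity.

Section invariant_comparison.
Context {d1 d2} {T : measurableType d1} {W : measurableType d2} {R : realType}.
Variables (nu : probability W R) (phi : T * W -> T).
Hypothesis mphi : measurable_fun setT phi.
Let mpair := measurable_paired mphi.
Local Notation P := (transition nu phi).
Local Notation Q := (transition nu (paired phi)).
Local Open Scope ereal_scope.

(** Along the coupling started from the product of [mu] and [pi] the integrals of [F]
    under the two marginals do not change, while the cost tends to 0 in mean by
    dominated convergence. *)
Lemma le_invariant_integral (f : T * T -> R) (F : T -> R) (B : R) (mu pi : probability T R) :
  measurable_fun setT f -> (forall p, 0 <= f p <= 1)%R ->
  (forall p, iter n Q (fun q => (f q)%:E) p @[n --> \oo] --> 0) ->
  measurable_fun setT F -> (forall x, 0 <= F x)%R -> (0 <= B)%R ->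
  (forall p, F p.1 <= F p.2 + B * f p)%R ->
  (forall A, measurable A -> \int[mu]_x P (fun y => (\1_A y)%:E) x = mu A) ->
  (forall A, measurable A -> \int[pi]_x P (fun y => (\1_A y)%:E) x = pi A) ->
  \int[mu]_x (F x)%:E <= \int[pi]_x (F x)%:E.
Proof.
move=> mf f01 f_cvg mF F0 B0 Ff invmu invpi.
pose lam := prod_prob mu pi.
have mfE : measurable_fun setT (fun p => (f p)%:E) by exact/measurable_EFinP.
have mFE : measurable_fun setT (fun p => (F p)%:E) by exact/measurable_EFinP.
have f0 p : 0 <= (f p)%:E by rewrite lee_fin; case/andP: (f01 p).
have F0E p : 0 <= (F p)%:E by rewrite lee_fin.
have mF1 : measurable_fun setT ((fun x => (F x)%:E) \o fst : T * T -> \bar R).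
  exact: (measurableT_comp mFE measurable_fst).
have mF2 : measurable_fun setT ((fun x => (F x)%:E) \o snd : T * T -> \bar R).
  exact: (measurableT_comp mFE measurable_snd).
have I0 n p : 0 <= iter n Q (fun q => (f q)%:E) p by exact: iter_transition_ge0.
have mI n := measurable_iter_transition nu mpair n mfE f0.
have e_cvg : \int[lam]_p iter n Q (fun q => (f q)%:E) p @[n --> \oo] --> 0.
  rewrite -[X in _ --> X](@integral_prob_cst _ _ _ lam 0).
  apply: (@dominated_cvg _ _ _ lam setT measurableT _ _ (cst 1)) => //.
  - exact/finite_measure_integrable_cst.
  - by move=> n p _; rewrite gee0_abs//; exact: (iter_transition_le1 nu mpair).
have key n : \int[mu]_x (F x)%:E <= \int[pi]_x (F x)%:E +
    B%:E * \int[lam]_p iter n Q (fun q => (f q)%:E) p.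
  rewrite -(invariant_transition mphi n invmu mFE F0E).
  rewrite -(invariant_transition mphi n invpi mFE F0E).
  have mPF := measurable_iter_transition nu mphi n mFE F0E.
  have PF0 x : 0 <= iter n P (fun x => (F x)%:E) x by exact: iter_transition_ge0.
  have mQ1 : measurable_fun setT (fun p : T * T => iter n P (fun x => (F x)%:E) p.1).
    exact: (measurableT_comp mPF measurable_fst).
  have mQ2 : measurable_fun setT (fun p : T * T => iter n P (fun x => (F x)%:E) p.2).
    exact: (measurableT_comp mPF measurable_snd).
  have -> : \int[mu]_x iter n P (fun x => (F x)%:E) x =
      \int[lam]_p iter n P (fun x => (F x)%:E) p.1.
    rewrite ge0_integral_prod_prob//; apply: eq_integral => x _ /=.
    by rewrite (integral_prob_cst pi).
  have -> : \int[pi]_x iter n P (fun x => (F x)%:E) x =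
      \int[lam]_p iter n P (fun x => (F x)%:E) p.2.
    by rewrite ge0_integral_prod_prob//= (integral_prob_cst mu).
  rewrite -integralTZ// -integralTD//; last 2 first.
  - by apply: emeasurable_funM.
  - by move=> p; rewrite mule_ge0.
  apply: le_integralT => //.
  - by apply: emeasurable_funD => //; exact: emeasurable_funM.
  move=> p; rewrite -(iter_paired_fst nu phi n) -(iter_paired_snd nu phi n).
  have mBf : measurable_fun setT (fun q => B%:E * (f q)%:E) by exact: emeasurable_funM.
  have Bf0 q : 0 <= B%:E * (f q)%:E by rewrite mule_ge0.
  have F20 (q : T * T) : 0 <= ((fun x => (F x)%:E) \o snd) q by rewrite /= lee_fin.
  have F10 (q : T * T) : 0 <= ((fun x => (F x)%:E) \o fst) q by rewrite /= lee_fin.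
  rewrite -(iter_transitionZ nu mpair n p mfE f0 B0).
  rewrite -(iter_transitionD nu mpair n p mF2 mBf F20 Bf0).
  apply: (le_iter_transition nu mpair) => //.
  - exact: emeasurable_funD.
apply/lee_addgt0Pr => e e0.
have B1 : (0 < B + 1)%R by rewrite ltr_wpDl.
have eB : (0 < e / (B + 1))%R by rewrite divr_gt0.
have e_fin n : \int[lam]_p iter n Q (fun q => (f q)%:E) p \is a fin_num.
  rewrite ge0_fin_numE ?integral_ge0//; apply: (@le_lt_trans _ _ (\int[lam]_p cst 1 p)).
    apply: le_integralT => // p; exact: (iter_transition_le1 nu mpair).
  by rewrite (integral_prob_cst lam) ltry.
move: e_cvg => /fine_cvg /cvgr_le/(_ _ eB)[N _ HN].
apply: le_trans (key N) _; rewrite leeD2l//.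
rewrite -(fineK (e_fin N)) -EFinM lee_fin.
have := HN N (leqnn N); rewrite /= ler_pdivlMr// => h.
apply: le_trans h; rewrite mulrC ler_wpM2l ?fine_ge0 ?integral_ge0//.
by rewrite lerDl.
Qed.

End invariant_comparison.

(** * Convergence of the pCN chain *)

Lemma cos_lipschitz {R : realType} (a b : R) : `|cos a - cos b| <= `|a - b|.
Proof.
wlog ab : a b / b <= a.
  move=> wl; have [/wl//|/ltW ba] := leP b a.
  by rewrite distrC (distrC a); exact: wl.
have [x _ ->] := MVT_segment ab (fun x _ => is_derive_cos x)
  (@continuous_subspaceT _ _ _ _ (@continuous_cos R)).
by rewrite normrM normrN ler_piMl// sin_max.
Qed.

(** Comparison of the truncated distance with the concave cost, through
    exp (- u) <= 1 / (1 + u). *)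
Lemma min_le_one_sub_expR {R : realType} (A t : R) : 0 < A -> 0 <= t ->
  Num.min t 1 <= (1 + A) / A * (1 - expR (- (A * t))).
Proof.
move=> A0 t0.
have u0 : 0 <= A * t by rewrite mulr_ge0// ltW.
have e1 : expR (- (A * t)) <= (1 + A * t)^-1.
  by rewrite expRN lef_pV2 ?posrE ?expR_gt0 ?expR_ge1Dx// ltr_wpDr.
have D0 : 0 < 1 + A * t by rewrite ltr_wpDr.
have A1 : 0 < 1 + A by rewrite addr_gt0.
apply: (@le_trans _ _ ((1 + A) / A * (1 - (1 + A * t)^-1))); last first.
  by rewrite ler_wpM2l ?divr_ge0 ?(ltW A1) ?(ltW A0)// lerD2l lerN2.
rewrite (_ : _ * (1 - _) = (1 + A) * t / (1 + A * t)); last by field; rewrite !gt_eqF.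
rewrite ler_pdivlMr//.
have [t1|t1] := leP t 1; first by rewrite mulrC ler_wpM2r// lerD2l ler_piMr// ltW.
by rewrite mul1r mulrDl mul1r lerD2r ltW.
Qed.

Section convergence.
Context {R : realType} {H : hilbertType R}.
Hypothesis Hsep : separable H.
Variable gamma : probability (borel H) R.
Hypothesis Hgamma : centered_gaussian gamma.
Variables (g : H -> R) (beta Cg rho : R).
Hypotheses (beta0 : 0 < beta) (beta1 : beta <= 1) (Cg0 : 0 < Cg) (Hg : holder g beta Cg).
Variable pi : probability (borel H) R.
Hypothesis Hpi : gibbs gamma g pi.
Hypothesis Hrho : 0 <= rho < 1.
Variable theta : R.
Hypothesis theta0 : 0 < theta.
Hypothesis Hfernique :
  (\int[gamma]_xi (expR (theta * `|xi : H| ^+ 2))%:E < +oo)%E.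
Let mg := measurable_holder beta0 Cg0 Hg.
Let mstep := measurable_pcn_step Hsep rho mg.
Let mpair := measurable_paired mstep.
Local Notation P := (transition (pcn_noise gamma) (pcn_step g rho)).
Local Notation Q := (transition (pcn_noise gamma) (paired (pcn_step g rho))).
Local Notation fd := (fdist beta Cg rho).
Local Notation A := (rate_A beta Cg rho).

Let s := (1 - rho) ^+ 2 * theta / 16.
Let kappa := theta * Cg `^ (- (2 / beta)) / 36.

Let s_gt0 : 0 < s.
Proof.
by case/andP: Hrho => _ r1; rewrite divr_gt0// mulr_gt0// exprn_gt0// subr_gt0.
Qed.

Let mfd : measurable_fun setT (fd : borel H * borel H -> R).
Proof. exact: measurable_fdist. Qed.

Let fd01 (p : borel H * borel H) : 0 <= fd p <= 1.
Proof. exact: fdist01. Qed.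

Let mfdE : measurable_fun setT (fun p : borel H * borel H => (fd p)%:E).
Proof. exact/measurable_EFinP. Qed.

Let fd0E (p : borel H * borel H) : (0 <= (fd p)%:E)%E.
Proof. by rewrite lee_fin; case/andP: (fd01 p). Qed.

Let A_gt0 : 0 < A. Proof. exact: rate_A_gt0. Qed.

(** The drift holds for every exponent up to [s]; the weight uses s0 = s / 5, which
    leaves s - s0 = (1 - rho) ^ 2 theta / 20 for the leak. *)
Lemma paired_rate : exists2 C : R, 0 <= C & forall n x y, (2 <= n)%N ->
  (iter n Q (fun p => (fd p)%:E) (x, y) <=
   (C * (lyap s x + lyap s y) * expR (- (kappa * ln n%:R `^ (2 / beta))))%:E)%E.
Proof.
have [K K0 HK] := noise_level gamma.
have s5 : 0 < s / 5 by rewrite divr_gt0.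
have s5s : s / 5 <= s by rewrite ler_pdivrMr// ler_peMr ?(ltW s_gt0)// ler1n.
have [c [b [c0 c1 b0 Hdecay]]] := coupled_decay Hsep beta0 beta1 Cg0 Hg Hrho theta0
  K0 HK Hfernique s5 s5s (lexx s).
have [C C0 HC] := subgeometric_rate beta0 beta1 Cg0 theta0 Hrho K0 c0 c1 b0.
exists C => // n x y n2.
set I := iter n Q _ _.
have I1 : (I <= 1)%E by exact: (iter_transition_le1 (pcn_noise gamma) mpair).
have I0 : (0 <= I)%E by exact: iter_transition_ge0.
have Ifin : I \is a fin_num by rewrite ge0_fin_numE// (le_lt_trans I1)// ltry.
rewrite -(fineK Ifin) lee_fin; apply: HC => //.
- have := lyap_ge1 x (ltW s_gt0); have := lyap_ge1 y (ltW s_gt0).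
  by move: (lyap s x) (lyap s y) => u v; lra.
- by rewrite -lee_fin fineK.
by move=> r r0; rewrite -lee_fin fineK//; exact: Hdecay.
Qed.

Lemma paired_cvg0 (p : borel H * borel H) :
  (iter n Q (fun q => (fd q)%:E) p @[n --> \oo] --> 0)%E.
Proof.
case: p => x y.
have [C C0 HC] := paired_rate.
set W := lyap s x + lyap s y in HC.
have p1 : 1 <= 2 / beta by rewrite ler_pdivlMr// mul1r (le_trans beta1)// ler1n.
have k0 : 0 < kappa by rewrite divr_gt0// mulr_gt0// powR_gt0.
have CW0 : 0 <= C * W by rewrite mulr_ge0 ?addr_ge0 ?expR_ge0.
have I0 n : (0 <= iter n Q (fun q => (fd q)%:E) (x, y))%E by exact: iter_transition_ge0.
have I1 n : (iter n Q (fun q => (fd q)%:E) (x, y) <= 1)%E.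
  exact: (iter_transition_le1 (pcn_noise gamma) mpair).
have Ifin n : iter n Q (fun q => (fd q)%:E) (x, y) \is a fin_num.
  by rewrite ge0_fin_numE// (le_lt_trans (I1 n))// ltry.
apply: cvg_EFin; first by apply: nearW => n; exact: Ifin.
apply/cvgrPdist_le => e e0.
(* With exp (- u) <= 1 / u, the bound is below e as soon as the power of ln n reaches L. *)
pose L := 1 + C * W / (kappa * e).
have ke : 0 < kappa * e by rewrite mulr_gt0.
have L1 : 1 <= L by rewrite lerDl divr_ge0// ltW.
have L0 : 0 < L by exact: lt_le_trans L1.
near=> n.
have n1 : expR L < n%:R.
  by near: n; case: (near_natS_gt (expR L)) => N _ HN; exists N.+1 => // -[//|n] /=; exact: HN.
have n2 : (2 <= n)%N by near: n; exists 2%N.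
rewrite sub0r normrN ger0_norm ?fine_ge0// -lee_fin fineK//.
apply: le_trans (HC n x y n2) _; rewrite lee_fin -/W.
have lnL : L <= ln n%:R.
  by rewrite -(expRK L) ler_ln ?posrE ?expR_gt0 ?(lt_trans (expR_gt0 L) n1)// ltW.
have lnp : L <= ln n%:R `^ (2 / beta).
  apply: (le_trans lnL); rewrite -[leLHS]powRr1; last first.
    by rewrite ln_ge0// ler1n ltnW.
  by apply: ler_powR => //; exact: le_trans lnL.
set z := _ `^ _ in lnp *.
have kz0 : 0 < kappa * z by rewrite mulr_gt0// (lt_le_trans L0).
have ez : expR (- (kappa * z)) <= (kappa * z)^-1.
  rewrite expRN lef_pV2 ?posrE ?expR_gt0//.
  by apply: le_trans (expR_ge1Dx _); rewrite lerDr.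
apply: le_trans (ler_wpM2l CW0 ez) _.
rewrite ler_pdivrMr//.
apply: (@le_trans _ _ (e * (kappa * L))); last by rewrite !ler_pM2l.
have -> : e * (kappa * L) = e * kappa + C * W.
  by rewrite /L; field; rewrite !gt_eqF.
by rewrite lerDr mulr_ge0 ?(ltW e0)// ltW.
Unshelve. all: by end_near.
Qed.

Lemma transition_invariant (mu : probability (borel H) R) :
  Defs.invariant (pcn gamma g rho) mu ->
  forall B, measurable B -> (\int[mu]_x P (fun y => (\1_B y)%:E) x = mu B)%E.
Proof.
move=> inv B mB; rewrite -inv//; apply: eq_integral => x _.
by rewrite pcn_transition.
Qed.

Lemma holder_dist_le (x y : borel H) :
  holder_dist beta x y <= (1 + A) / A * fd (x, y).
Proof.
rewrite /holder_dist; have := min_le_one_sub_expR A_gt0 (hdist_ge0 beta (x, y)).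
exact.
Qed.

(** Cosines of affine functions are Lipschitz and bounded, hence controlled by the
    cost. *)
Lemma pcn_unique_invariant : unique_invariant (pcn gamma g rho) pi.
Proof.
have invpi := pcn_invariant Hsep mg Hgamma Hrho Hpi.
split => // mu invmu.
pose L : set (borel H -> R) := [set l | exists h c, l = fun x => inner h x + c].
have La : affine_class L.
  split.
  - by move=> c; exists 0, c; apply/funext => x; rewrite inner0l add0r.
  - move=> a _ [h [c ->]]; exists (a *: h), (a * c).
    by apply/funext => x; rewrite innerZl mulrDr.
  - move=> _ _ [h [c ->]] [h' [c' ->]]; exists (h + h'), (c + c').
    by apply/funext => x; rewrite innerDl addrACA.
  - move=> _ [h [c ->]]; apply: measurable_funD => //; exact: measurable_inner.
apply: (cos_determines_measure La).
  move=> B mB; apply: sub_sigma_algebra2 (borel_sub_halfspaces Hsep mB).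
  by move=> _ [h [c ->]]; exists (fun x => inner h x + c) => //; exists h, c.
move=> l Ll.
have ml : measurable_fun setT l by case: La => _ _ _; exact.
have [h [c lE]] := Ll.
have mF : measurable_fun setT (fun x : borel H => 1 + cos (l x)).
  by apply: measurable_funD => //;
    exact: (measurableT_comp (continuous_measurable_fun (@continuous_cos R)) ml).
have F0 x : 0 <= 1 + cos (l x) by have := cos_geN1 (l x); lra.
pose B := (`|h| + 2) * ((1 + A) / A).
have B0 : 0 <= B.
  by rewrite mulr_ge0 ?addr_ge0// divr_ge0 ?(ltW A_gt0)// addr_ge0// ltW.
have close x y : 1 + cos (l x) <= 1 + cos (l y) + B * fd (x, y).
  rewrite -addrA lerD2l addrC -lerBlDr; apply: le_trans (ler_norm _) _.
  rewrite /B -mulrA; apply: (@le_trans _ _ ((`|h| + 2) * holder_dist beta x y)); last first.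
    by rewrite ler_wpM2l ?addr_ge0//; exact: holder_dist_le.
  have h0 : 0 <= `|h| by [].
  have one_pow : 1 = 1 `^ beta by rewrite powR1.
  (* Up to distance 1 the cosine is Lipschitz; beyond it, the difference is at most 2. *)
  have [xy1|xy1] := leP `|(x : H) - (y : H)| 1.
    have xy_le : `|(x : H) - (y : H)| <= `|(x : H) - (y : H)| `^ beta.
      rewrite -[leLHS]powRr1//.
      have [->|xy0] := eqVneq `|(x : H) - (y : H)| 0.
        by rewrite !powR0 ?oner_neq0// gt_eqF.
      by rewrite ger_powR// lt_neqAle eq_sym xy0 normr_ge0.
    have t1 : `|(x : H) - (y : H)| `^ beta <= 1.
      by rewrite one_pow; apply: ge0_ler_powR; rewrite ?nnegrE// ltW.
    rewrite /holder_dist (min_idPl t1).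
    apply: le_trans (cos_lipschitz _ _) _.
    have -> : l x - l y = inner h ((x : H) - (y : H)).
      by rewrite lE innerBr opprD addrACA subrr addr0.
    apply: le_trans (norm_inner_le _ _) _.
    by rewrite ler_pM// lerDl.
  have t1 : 1 <= `|(x : H) - (y : H)| `^ beta.
    by rewrite one_pow; apply: ge0_ler_powR; rewrite ?nnegrE// ltW.
  rewrite /holder_dist (min_idPr t1) mulr1.
  apply: le_trans (ler_normB _ _) _.
  have := cos_max (l x); have := cos_max (l y).
  by move: (`|cos (l x)|) (`|cos (l y)|) => u v; lra.
have sym (p : borel H * borel H) : fd (p.2, p.1) = fd p.
  by case: p => x y; rewrite /fdist /hdist /= distrC.
have add1I (a b : \bar R) : (1 + a = 1 + b -> a = b)%E.
  by rewrite ![(1 + _)%E]addeC => e; rewrite -(@addeK _ 1%E a)// e addeK.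
apply: add1I; rewrite -!(integral_1Dcos _ ml).
have tmu := transition_invariant invmu.
have tpi := transition_invariant invpi.
apply/le_anti/andP; split.
- apply: (le_invariant_integral mstep mfd fd01 paired_cvg0 mF F0 B0 _ tmu tpi).
  by case=> x y; exact: close.
- apply: (le_invariant_integral mstep mfd fd01 paired_cvg0 mF F0 B0 _ tpi tmu).
  by case=> x y; exact: close.
Qed.

(** The potential grows at most linearly, which costs an arbitrarily small part of
    the Gaussian exponent. *)
Lemma gibbs_lyap_lty : (\int[pi]_x (lyap s x)%:E < +oo)%E.
Proof.
have [c c0 piE] := Hpi.
have mexp : measurable_fun setT (fun x : borel H => expR (- g x)).
  by apply: measurableT_comp => //; exact: measurable_funN.
pose p (x : borel H) := c * expR (- g x).
have p0 x : 0 <= p x by rewrite mulr_ge0 ?expR_ge0// ltW.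
have mp : measurable_fun setT p by exact: measurable_funM.
have nuE B : measurable B -> (pi B = \int[gamma]_(x in B) (p x)%:E)%E.
  move=> mB; rewrite piE// -ge0_integralZl//.
  - by apply/measurable_EFinP; apply: measurable_funTS.
  - by rewrite lee_fin ltW.
have mL : measurable_fun setT (fun x : borel H => (lyap s x)%:E).
  by apply/measurable_EFinP; exact: measurable_lyap.
have L0 (x : borel H) : (0 <= (lyap s (x : H))%:E)%E by rewrite lee_fin; exact: expR_ge0.
rewrite (ge0_integral_density mp p0 nuE mL L0).
pose D := c * expR (- g 0 + Cg + Cg ^+ 2 / (2 * theta)).
have D0 : 0 <= D by rewrite mulr_ge0 ?expR_ge0// ltW.
have mT : measurable_fun setT (fun x : borel H => (expR (theta * `|x : H| ^+ 2))%:E).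
  by apply/measurable_EFinP; exact: (measurable_lyap theta).
apply: (@le_lt_trans _ _ (\int[gamma]_x (D%:E * (expR (theta * `|x : H| ^+ 2))%:E))%E).
  apply: le_integralT.
  - by apply: emeasurable_funM => //; exact/measurable_EFinP.
  - exact: emeasurable_funM.
  - by move=> x; rewrite mule_ge0// lee_fin.
  move=> x; rewrite -!EFinM lee_fin /lyap /p /D mulrCA -[leRHS]mulrA ler_pM2l// -!expRD ler_expR.
  have gx : - g x <= - g 0 + Cg * `|x : H| `^ beta.
    have := Hg 0 x; rewrite sub0r normrN ler_norml => /andP[_ h]; lra.
  have xb : Cg * `|x : H| `^ beta <= Cg * (1 + `|x : H|).
    by rewrite ler_pM2l// powR_le1D.
  have st : s * `|x : H| ^+ 2 <= theta / 16 * `|x : H| ^+ 2.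
    rewrite ler_wpM2r ?sqr_ge0// /s -mulrA ler_piMl ?divr_ge0 ?(ltW theta0)//.
    by case/andP: Hrho => r0 r1; rewrite exprn_ile1//; lra.
  have sq : Cg * `|x : H| <= theta / 2 * `|x : H| ^+ 2 + Cg ^+ 2 / (2 * theta).
    have : 0 <= theta / 2 * (`|x : H| - Cg / theta) ^+ 2.
      by rewrite mulr_ge0 ?sqr_ge0// divr_ge0// ltW.
    have -> : theta / 2 * (`|x : H| - Cg / theta) ^+ 2 =
      theta / 2 * `|x : H| ^+ 2 + Cg ^+ 2 / (2 * theta) - Cg * `|x : H|.
      by field; rewrite gt_eqF.
    by rewrite subr_ge0.
  have tt : 0 <= theta * `|x : H| ^+ 2 by rewrite mulr_ge0 ?sqr_ge0// ltW.
  move: gx xb st sq tt; move: (`|x : H| `^ beta) => w.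
  move: (Cg ^+ 2 / (2 * theta)) (g x) (g 0) => u v z; lra.
rewrite integralTZ//.
by apply: lte_mul_pinfty; [rewrite lee_fin| |exact: Hfernique].
Qed.

Lemma pcn_wasserstein_rate : exists C : R, forall (x : H) n, (2 <= n)%N ->
  (wasserstein (holder_dist beta) (kernel_iter (pcn gamma g rho) n x) pi
   <= (C * lyap s x * expR (- (kappa * ln n%:R `^ (2 / beta))))%:E)%E.
Proof.
have [C C0 HC] := paired_rate.
have invpi := pcn_invariant Hsep mg Hgamma Hrho Hpi.
set v := (\int[pi]_x (lyap s x)%:E)%E.
have v0 : (0 <= v)%E by apply: integral_ge0 => x _; rewrite lee_fin; exact: expR_ge0.
have vfin : v \is a fin_num by rewrite ge0_fin_numE// gibbs_lyap_lty.
pose L := (1 + A) / A.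
have L0 : 0 <= L by rewrite divr_ge0 ?(ltW A_gt0)// addr_ge0// ltW.
exists (L * C * (1 + fine v)) => x n n2.
have KE : forall x B, measurable B -> pcn gamma g rho x B = P (fun y => (\1_B y)%:E) x.
  by move=> y B mB; exact: pcn_transition.
have mhd : measurable_fun setT (fun p : borel H * borel H => holder_dist beta p.1 p.2).
  by apply: measurable_minr => //; exact: measurable_hdist.
have hd0 (y z : borel H) : 0 <= holder_dist beta y z.
  by rewrite /holder_dist le_min powR_ge0 ler01.
apply: le_trans (wasserstein_le_paired mstep n x KE invpi mhd hd0) _.
set E := expR _; have E0 : 0 <= E := expR_ge0 _.
have mhE : measurable_fun setT (fun p : borel H * borel H => (holder_dist beta p.1 p.2)%:E).
  exact/measurable_EFinP.
have hE0 (p : borel H * borel H) : (0 <= (holder_dist beta p.1 p.2)%:E)%E by rewrite lee_fin.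
have mIh := measurable_iter_transition (pcn_noise gamma) mpair n mhE hE0.
have lyap0 (y : H) : 0 <= lyap s y := expR_ge0 _.
have ml : measurable_fun setT (fun y : borel H => (lyap s y)%:E).
  by apply/measurable_EFinP; exact: measurable_lyap.
have LCE : 0 <= L * C * E := mulr_ge0 (mulr_ge0 L0 C0) E0.
apply: (@le_trans _ _ (\int[pi]_y ((L * C * E)%:E * ((lyap s x)%:E + (lyap s y)%:E)))%E).
  apply: le_integralT.
  - exact: (measurableT_comp mIh (pair1_measurable (x : borel H))).
  - by apply: emeasurable_funM => //; exact: emeasurable_funD.
  - by move=> y; exact: iter_transition_ge0.
  move=> y; apply: (@le_trans _ _ (iter n Q (fun p => L%:E * (fd p)%:E)%E (x, y))).
    apply: (le_iter_transition (pcn_noise gamma) mpair) => //.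
    - exact: emeasurable_funM.
    - by move=> [u w]; rewrite -EFinM lee_fin; exact: holder_dist_le.
  rewrite (iter_transitionZ (pcn_noise gamma) mpair n (x, y) mfdE fd0E L0).
  apply: (@le_trans _ _ (L%:E * (C * (lyap s x + lyap s y) * E)%:E)%E).
    by apply: lee_wpmul2l; [rewrite lee_fin|exact: HC].
  by rewrite -EFinD -!EFinM lee_fin le_eqVlt; apply/orP; left; apply/eqP; ring.
rewrite integralTZ//; last 2 first.
- exact: emeasurable_funD.
- by move=> y; rewrite -EFinD lee_fin addr_ge0.
rewrite integralTD//; last by move=> y; rewrite lee_fin.
rewrite (integral_prob_cst pi) -/v -(fineK vfin) -EFinD -EFinM lee_fin.
have V1 : 1 <= lyap s x := lyap_ge1 x (ltW s_gt0).
have vv : fine v <= fine v * lyap s x by rewrite ler_peMr// fine_ge0.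
apply: (@le_trans _ _ (L * C * E * ((1 + fine v) * lyap s x))).
  by rewrite ler_wpM2l// mulrDl mul1r lerD2l.
by rewrite le_eqVlt; apply/orP; left; apply/eqP; ring.
Qed.

End convergence.

Theorem theorem13 (R : realType) (H : hilbertType R) (Hsep : separable H)
    (gamma : probability (borel H) R) (Hgamma : centered_gaussian gamma)
    (g : H -> R) (beta Cg : R) (Hbeta : 0 < beta <= 1) (HCg : 0 < Cg)
    (Hg : holder g beta Cg)
    (pi : probability (borel H) R) (Hpi : gibbs gamma g pi)
    (rho : R) (Hrho : 0 <= rho < 1)
    (theta : R) (Htheta : 0 < theta)
    (Hfernique :
      (\int[gamma]_xi (expR (theta * `|xi : H| ^+ 2))%:E < +oo)%E) :
  let s := (1 - rho) ^+ 2 * theta / 16 in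
  let V (x : H) := expR (s * `|x| ^+ 2) in
  let kappa := theta * Cg `^ (- (2 / beta)) / 36 in
  unique_invariant (pcn gamma g rho) pi /\
  exists C1 C2 : R, forall (x : H) (n : nat), (2 <= n)%N ->
    0 <= ln n%:R - C2 * ln (ln n%:R) ->
    (wasserstein (holder_dist beta) (kernel_iter (pcn gamma g rho) n x) pi
     <= (C1 * V x
         * expR (- kappa
                 * (ln n%:R - C2 * ln (ln n%:R)) `^ (2 / beta)))%:E)%E.
Proof.
move=> s V kappa; have /andP[beta0 beta1] := Hbeta.
split; first exact: (pcn_unique_invariant Hsep Hgamma beta0 beta1 HCg Hg Hpi Hrho Htheta Hfernique).
have [C HC] := pcn_wasserstein_rate Hsep Hgamma beta0 beta1 HCg Hg Hpi Hrho Htheta Hfernique.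
exists C, 0 => x n n2 _.
by rewrite mul0r subr0 mulNr; exact: HC.
Qed.
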